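(* Let $X$ be an infinite-dimensional complex Banach space and $T\in L(X)$. (a) Let $\mathbf R$ be one of $\mathcal B_+$, $\mathcal B_-$, $\mathcal B$, $\Phi_+$, $\Phi_-$, $\Phi$, $\mathcal W_+$, $\mathcal W_-$, $\mathcal W$. If $\sigma_{\mathbf R}(T)=\partial\sigma_{\mathbf R}(T)=\operatorname{acc}\sigma_{\mathbf R}(T)$, then $$\sigma_{ec}(T)\subset\sigma_{gKR}(T)=\sigma_{gK}(T)=\sigma_{Kt}(T)=\sigma_{eK}(T)=\sigma_{\mathbf R}(T)=\sigma_{\mathbf{gDR}\mathbf R}(T).$$ (b) Let $(\mathbf R,\mathbf R')$ be one of the pairs $(\mathcal M,\mathcal B_+)$, $(\mathcal Q,\mathcal B_-)$, $(L(X)^{-1},\mathcal B)$. If $\sigma_{\mathbf R}(T)=\partial\sigma_{\mathbf R}(T)\subset\operatorname{acc}\sigma_{\mathbf R'}(T)$, then $$\sigma_{ec}(T)\subset\sigma_{gKR}(T)=\sigma_{gK}(T)=\sigma_{Kt}(T)=\sigma_{eK}(T)=\sigma_K(T)=\sigma_{\mathbf R}(T)=\sigma_{\mathbf{gDR}\mathbf R}(T).$$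
   Context: $\sigma_{ec}(T)=\{\lambda: R(T-\lambda)\text{ is not closed}\}$. $S$ is Kato if $R(S)$ is closed and $N(S)\subset R(S^n)$ for all $n$; $S$ is Riesz if $S-\lambda$ is Fredholm for all $\lambda\ne0$. For an operator $S$ and closed $S$-invariant $M,N$ with $X=M\oplus N$ and $S_M$ Kato: if $S_N$ is Riesz, $S$ admits a GKRD; if $S_N$ is quasinilpotent, a GKD; if $S_N$ is nilpotent, $S$ is of Kato type; if $N$ is finite-dimensional and $S_N$ nilpotent, $S$ is essentially Kato. $\sigma_{gKR}$, $\sigma_{gK}$, $\sigma_{Kt}$, $\sigma_{eK}$, $\sigma_K$: sets of $\lambda$ with $T-\lambda$ not admitting a GKRD, not admitting a GKD, not of Kato type, not essentially Kato, not Kato. Classes: $\mathcal M$ bounded below; $\mathcal Q$ surjective; $L(X)^{-1}$ invertible; $\Phi_+$: finite-dimensional kernel and closed range; $\Phi_-$: finite-codimensional range; $\Phi=\Phi_+\cap\Phi_-$; $\mathcal W_+,\mathcal W_-,\mathcal W$: in $\Phi_+,\Phi_-,\Phi$ with index $\le0,\ge0,=0$; $\mathcal B_+$: $\Phi_+$ with finite ascent; $\mathcal B_-$: $\Phi_-$ with finite descent; $\mathcal B$: Fredholm with finite ascent and descent. $\sigma_{\mathbf R}(T)=\{\lambda:T-\lambda\notin\mathbf R\}$; $\sigma_{\mathbf{gDR}\mathbf R}(T)$ is the set of $\lambda$ for which there are no closed $(T-\lambda)$-invariant $M,N$ with $X=M\oplus N$, $(T-\lambda)_M\in\mathbf R$,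 $(T-\lambda)_N$ Riesz. $\partial$, $\operatorname{acc}$: boundary, accumulation points. *)

(* Defs.v *)
From HB Require Import structures.
From mathcomp Require Import all_boot all_algebra.
From mathcomp Require Import complex.
From mathcomp Require Import all_classical all_reals all_analysis.
Set Implicit Arguments. Unset Strict Implicit. Unset Printing Implicit Defensive.
Import GRing.Theory Num.Theory.
Local Open Scope classical_set_scope.
Local Open Scope ring_scope.

Section OperatorTheory.
Context {R : realType} {X : normedModType R[i]}.
Local Notation C := R[i].

Definition subspace (A : set X) :=
  A 0 /\ forall (a : C) x y, A x -> A y -> A (a *: x + y).
Definition closed_subspace (A : set X) := subspace A /\ closed A.

Definition span_fin n (s : 'I_n -> X) : set X :=
  [set x | exists c : 'I_n -> C, x = \sum_(i < n) c i *: s i].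
Definition lin_indep n (s : 'I_n -> X) :=
  forall c : 'I_n -> C, \sum_(i < n) c i *: s i = 0 -> forall i, c i = 0.

(* A is contained in a finite-dimensional subspace (for a subspace A:
   A is finite-dimensional) *)
Definition findim (A : set X) := exists n (s : 'I_n -> X), A `<=` span_fin s.
Definition dim_is (A : set X) (n : nat) :=
  exists s : 'I_n -> X, (forall i, A (s i)) /\ lin_indep s /\ A `<=` span_fin s.
Definition codim_in (Y B : set X) (n : nat) :=
  exists s : 'I_n -> X, (forall i, Y (s i)) /\
    (forall y, Y y -> exists (c : 'I_n -> C) b, B b /\ y = b + \sum_(i < n) c i *: s i) /\
    (forall (c : 'I_n -> C) b, B b -> b + \sum_(i < n) c i *: s i = 0 -> forall i, c i = 0).

(** operators S : X -> X, considered as restricted to an invariant subspace Y *)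
Definition ker_on (Y : set X) (S : X -> X) : set X := [set x | Y x /\ S x = 0].
Definition rng_on (Y : set X) (S : X -> X) : set X := S @` Y.
Definition shift (S : X -> X) (l : C) : X -> X := fun x => S x - l *: x.

Definition BddBelow_on (Y : set X) (S : X -> X) :=
  exists c : C, 0 < c /\ forall x, Y x -> c * `|x| <= `|S x|.
Definition Surj_on (Y : set X) (S : X -> X) := rng_on Y S = Y.
Definition Inv_on (Y : set X) (S : X -> X) :=
  exists g : X -> X,
    (forall y, Y y -> [/\ Y (g y), S (g y) = y & g (S y) = y]) /\
    {within Y, continuous g}.

Definition PhiP_on (Y : set X) (S : X -> X) := findim (ker_on Y S) /\ closed (rng_on Y S).
Definition PhiM_on (Y : set X) (S : X -> X) := exists n, codim_in Y (rng_on Y S) n.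
Definition Phi_on (Y : set X) (S : X -> X) := PhiP_on Y S /\ PhiM_on Y S.
(* index <= 0, >= 0, = 0 (index = dim ker - codim range, possibly infinite) *)
Definition WP_on (Y : set X) (S : X -> X) := PhiP_on Y S /\
  forall m n, dim_is (ker_on Y S) m -> codim_in Y (rng_on Y S) n -> (m <= n)%N.
Definition WM_on (Y : set X) (S : X -> X) := PhiM_on Y S /\
  forall m n, dim_is (ker_on Y S) m -> codim_in Y (rng_on Y S) n -> (n <= m)%N.
Definition W_on (Y : set X) (S : X -> X) := Phi_on Y S /\
  forall m n, dim_is (ker_on Y S) m -> codim_in Y (rng_on Y S) n -> m = n.
Definition fin_ascent (Y : set X) (S : X -> X) :=
  exists p, ker_on Y (iter p S) = ker_on Y (iter p.+1 S).
Definition fin_descent (Y : set X) (S : X -> X) :=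
  exists q, rng_on Y (iter q S) = rng_on Y (iter q.+1 S).
Definition BP_on (Y : set X) (S : X -> X) := PhiP_on Y S /\ fin_ascent Y S.
Definition BM_on (Y : set X) (S : X -> X) := PhiM_on Y S /\ fin_descent Y S.
Definition B_on (Y : set X) (S : X -> X) := Phi_on Y S /\ fin_ascent Y S /\ fin_descent Y S.

Definition Kato_on (Y : set X) (S : X -> X) :=
  closed (rng_on Y S) /\ forall n, ker_on Y S `<=` rng_on Y (iter n S).
Definition Riesz_on (Y : set X) (S : X -> X) := forall l : C, l != 0 -> Phi_on Y (shift S l).
(* spectral radius 0: lim ||S^n||^(1/n) = 0 *)
Definition Quasinil_on (Y : set X) (S : X -> X) :=
  forall e : C, 0 < e -> exists N, forall n, (N <= n)%N ->
    forall x, Y x -> `|iter n S x| <= e ^+ n * `|x|.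
Definition Nilp_on (Y : set X) (S : X -> X) :=
  exists n, forall x, Y x -> iter n S x = 0.

Definition decomp (S : X -> X) (P Q : set X -> Prop) :=
  exists M N : set X,
    [/\ closed_subspace M, closed_subspace N, S @` M `<=` M, S @` N `<=` N &
    [/\ M `&` N = [set 0], (forall x, exists m n, [/\ M m, N n & x = m + n]),
        P M & Q N]].

Definition GKRD (S : X -> X) := decomp S (fun M => Kato_on M S) (fun N => Riesz_on N S).
Definition GKD (S : X -> X) := decomp S (fun M => Kato_on M S) (fun N => Quasinil_on N S).
Definition KatoType (S : X -> X) := decomp S (fun M => Kato_on M S) (fun N => Nilp_on N S).
Definition EssKato (S : X -> X) :=
  decomp S (fun M => Kato_on M S) (fun N => findim N /\ Nilp_on N S).

Definition spec (P : (X -> X) -> Prop) (T : X -> X) : set C :=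
  [set l | ~ P (shift T l)].
Definition sigma_ec (T : X -> X) : set C := [set l | ~ closed (range (shift T l))].
Definition sigma_gKR (T : X -> X) : set C := spec GKRD T.
Definition sigma_gK (T : X -> X) : set C := spec GKD T.
Definition sigma_Kt (T : X -> X) : set C := spec KatoType T.
Definition sigma_eK (T : X -> X) : set C := spec EssKato T.
Definition sigma_K (T : X -> X) : set C := spec (Kato_on setT) T.
Definition sigma_gDR (Rc : set X -> (X -> X) -> Prop) (T : X -> X) : set C :=
  [set l | ~ decomp (shift T l) (fun M => Rc M (shift T l))
                               (fun N => Riesz_on N (shift T l))].

Inductive clsA := cBP | cBM | cB | cPhiP | cPhiM | cPhi | cWP | cWM | cW.
Definition clsA_on (r : clsA) : set X -> (X -> X) -> Prop :=
  match r with
  | cBP => BP_on | cBM => BM_on | cB => B_on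
  | cPhiP => PhiP_on | cPhiM => PhiM_on | cPhi => Phi_on
  | cWP => WP_on | cWM => WM_on | cW => W_on end.
Inductive clsB := cM | cQ | cInv.
Definition clsB_on (r : clsB) : set X -> (X -> X) -> Prop :=
  match r with cM => BddBelow_on | cQ => Surj_on | cInv => Inv_on end.
Definition clsB_partner (r : clsB) : set X -> (X -> X) -> Prop :=
  match r with cM => BP_on | cQ => BM_on | cInv => B_on end.

End OperatorTheory.

Section CTopo.
Context {R : realType}.
Local Notation C := R[i].
Definition clos_pt (A : set C) (l : C) :=
  forall e : C, 0 < e -> exists m, A m /\ `|m - l| < e.
Definition bdry (A : set C) : set C := [set l | clos_pt A l /\ clos_pt (~` A) l].
Definition accp (A : set C) : set C :=
  [set l | forall e : C, 0 < e -> exists m, [/\ A m, m != l & `|m - l| < e]].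
End CTopo.

(* Main.v *)
(** If [T - l = S] splits as a Kato part [S_M] and a Riesz part [S_N], then for
    small [mu != 0] the operator [S_N - mu] is Browder, with equal finite nullity
    and defect, while [S_M - mu] stays Kato with nullity and defect independent
    of [mu].  Hence whether [S - mu] belongs to a given class does not depend on
    [mu] in a punctured disc around [0]; so [l] cannot be both a boundary point
    and an accumulation point of the spectrum.  This gives the hard inclusion of
    the spectrum in [sigma_gKR]; the other ones follow from Kato's decomposition
    of semi-Fredholm operators.

    For a Kato operator [S], the intersection of the ranges of its iterates is
    closed, contains the kernel, is mapped onto itself by [S], and [S] is bounded
    below modulo it.  So [S - mu] has a lower bound modulo its kernel that is
    uniform in [mu], and kernels and ranges at nearby points are close, which
    forces equal dimensions.  A Riesz operator is Browder at every [l != 0]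
    because, by the same stability applied to Kato's decomposition, this property
    is locally constant along the ray from [l] to the resolvent set. *)
Require Import Defs.
From mathcomp Require Import all_boot all_order all_algebra complex.
From mathcomp Require Import all_classical all_reals all_analysis.
From mathcomp Require Import lra ring zify.
Import GRing.Theory Num.Theory Order.TTheory.
Local Open Scope classical_set_scope.
Local Open Scope ring_scope.
Set Implicit Arguments. Unset Strict Implicit. Unset Printing Implicit Defensive.

(* [subspace] and [shift] are shadowed by mathcomp-analysis. *)
Local Notation subspace := Defs.subspace.
Local Notation shift := Defs.shift.

(** Nullity and defect may be infinite, so stability is expressed through upper bounds: at most [n]
    at [mu] implies at most [n] at [nu], for every [n]. With [mu] and [nu] exchanged this says that
    the two values agree, finite or not. The gap argument behind it allows only steps whose length
    depends on [n], while the disc must not depend on [n]; hence the many small steps under one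
    uniform lower bound. Kernels and ranges are treated in parallel and not through adjoints;
    functionals occur only where a nilpotent chain is split off a semi-Fredholm operator. Operators
    remain maps of [X] and are restricted to closed invariant subspaces [Y], because the two
    summands of a decomposition have to be studied separately and recombined. The Riesz condition
    gives Fredholmness at each nonzero point and says nothing about index, ascent or descent there;
    these have to be carried over from the resolvent set. *)

Section Lmod.
Context (K : comNzRingType) (V : lmodType K).

(* Reflexive decision of linear identities: [lmod] reduces an equation between
   linear combinations to the ring equations between the coefficients. *)
Inductive mexp := MV of nat | M0 | MA of mexp & mexp | MN of mexp | MZ of K & mexp.
Fixpoint mev (env : seq V) (e : mexp) : V :=
  match e with
  | MV j => nth 0 env j | M0 => 0 | MA a b => mev env a + mev env b
  | MN a => - mev env a | MZ c a => c *: mev env a end.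
Fixpoint mco (e : mexp) (i : nat) : K :=
  match e with
  | MV j => if i == j then 1 else 0 | M0 => 0 | MA a b => mco a i + mco b i
  | MN a => - mco a i | MZ c a => c * mco a i end.
Fixpoint mceq n (e1 e2 : mexp) : Prop :=
  if n is m.+1 then mco e1 m = mco e2 m /\ mceq m e1 e2 else True.

Lemma mevE env e : mev env e = \sum_(i < size env) mco e i *: nth 0 env i.
Proof.
elim: e => /= [j||a -> b ->|a ->|c a ->].
- have [js|js] := ltnP j (size env).
    rewrite (bigD1 (Ordinal js)) //= eqxx scale1r big1 ?addr0 // => i /eqP ij.
    by case: eqP => [h|_]; [case: ij; apply: val_inj|rewrite scale0r].
  rewrite nth_default // big1 // => i _; case: eqP => [h|_]; last by rewrite scale0r.
  by have := ltn_ord i; rewrite h ltnNge js.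
- by rewrite big1 // => i _; rewrite scale0r.
- by rewrite -big_split; apply: eq_bigr => i _; rewrite scalerDl.
- by rewrite -sumrN; apply: eq_bigr => i _; rewrite scaleNr.
- by rewrite scaler_sumr; apply: eq_bigr => i _; rewrite scalerA.
Qed.

Lemma mevP env e1 e2 : mceq (size env) e1 e2 -> mev env e1 = mev env e2.
Proof.
move=> h; rewrite !mevE; apply: eq_bigr => i _; congr (_ *: _).
move: h (ltn_ord i); move: (size env) (nat_of_ord i) => n j.
by elim: n => //= n IH [h0 /IH hi]; rewrite ltnS leq_eqVlt => /predU1P[->|].
Qed.
End Lmod.

(* Atoms are compared up to unification: the same vector may be typed through
   different inheritance paths. *)
Ltac lm_idx x env :=
  match env with
  | ?y :: _ => let _ := match goal with _ => unify x y end in constr:(O)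
  | _ :: ?l => let n := lm_idx x l in constr:(S n)
  end.
Ltac lm_mem x env :=
  match env with
  | [::] => constr:(false)
  | ?y :: _ => let _ := match goal with _ => unify x y end in constr:(true)
  | _ :: ?l => lm_mem x l
  end.
Ltac lm_atoms e env :=
  lazymatch e with
  | (?a + ?b)%R => let l := lm_atoms a env in lm_atoms b l
  | (- ?a)%R => lm_atoms a env
  | (_ *: ?a)%R => lm_atoms a env
  | 0%R => env
  | _ => lazymatch lm_mem e env with true => env | false => constr:(e :: env) end
  end.
Ltac lm_reify K e env :=
  lazymatch e with
  | (?a + ?b)%R => let a' := lm_reify K a env in let b' := lm_reify K b env in constr:(@MA K a' b')
  | (- ?a)%R => let a' := lm_reify K a env in constr:(@MN K a')
  | (?c *: ?a)%R => let a' := lm_reify K a env in constr:(@MZ K c a')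
  | 0%R => constr:(@M0 K)
  | _ => let n := lm_idx e env in constr:(@MV K n)
  end.
Ltac lmod_gen K V :=
  lazymatch goal with |- ?a = ?b =>
    let e0 := lm_atoms a constr:(@nil V) in
    let env := lm_atoms b e0 in
    let ra := lm_reify K a env in
    let rb := lm_reify K b env in
    change (@mev K V env ra = @mev K V env rb);
    apply: mevP; cbn [size mceq mco eqn eq_op Equality.sort]; rewrite /=; do ?split; try ring
  end.

(** * Norms and bounded linear maps *)

Section Norm.
Context {R : realType}.
Local Notation C := R[i].

(* Norms are [R[i]]-valued in a normed module over [R[i]]; [nr] is real-valued. *)
Definition nr (V : normedZmodType C) (x : V) : R := complex.Re `|x|.
Arguments nr {V} x.

Lemma nrE (V : normedZmodType C) (x : V) : `|x| = (nr x)%:C%C.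
Proof. by rewrite /nr RRe_real // ger0_real. Qed.

Lemma nr_ge0 (V : normedZmodType C) (x : V) : 0 <= nr x.
Proof. rewrite -lecR -nrE; exact: normr_ge0. Qed.

Lemma nr0 (V : normedZmodType C) : nr (0 : V) = 0.
Proof. by rewrite /nr normr0. Qed.

Lemma nr_eq0 (V : normedZmodType C) (x : V) : nr x = 0 -> x = 0.
Proof. by move=> h; apply/normr0_eq0; rewrite nrE h. Qed.

Lemma nrN (V : normedZmodType C) (x : V) : nr (- x) = nr x.
Proof. by rewrite /nr normrN. Qed.

Lemma nrC (V : normedZmodType C) (x y : V) : nr (x - y) = nr (y - x).
Proof. by rewrite -nrN opprB. Qed.

Lemma nrD (V : normedZmodType C) (x y : V) : nr (x + y) <= nr x + nr y.
Proof. by rewrite -lecR rmorphD /= -!nrE ler_normD. Qed.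

Lemma nrB (V : normedZmodType C) (x y : V) : nr (x - y) <= nr x + nr y.
Proof. by rewrite -(nrN y) nrD. Qed.

Lemma nrT (V : normedZmodType C) (z x y : V) : nr (x - y) <= nr (x - z) + nr (z - y).
Proof. by rewrite -{1}(subrK z x) -addrA nrD. Qed.

Lemma nr_gt0 (V : normedZmodType C) (x : V) : x != 0 -> 0 < nr x.
Proof.
by move=> x0; rewrite lt_neqAle nr_ge0 andbT eq_sym; apply/eqP => /nr_eq0/eqP; apply/negP.
Qed.

Lemma nr_le0 (V : normedZmodType C) (x : V) : nr x <= 0 -> x = 0.
Proof. by move=> h; apply: nr_eq0; apply/eqP; rewrite eq_le h nr_ge0. Qed.

Lemma nrM (a b : C) : nr (a * b) = nr a * nr b.
Proof. by apply: (complexI (R:=R)); rewrite rmorphM /= -!nrE normrM. Qed.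

Lemma nr1 : nr (1 : C) = 1.
Proof. by rewrite /nr normr1. Qed.

Lemma nrV (a : C) : nr a^-1 = (nr a)^-1.
Proof.
have [->|a0] := eqVneq a 0; first by rewrite invr0 nr0 invr0.
apply: (mulIf (lt0r_neq0 (nr_gt0 a0))).
by rewrite -nrM !mulVf ?nr1 // lt0r_neq0 // nr_gt0.
Qed.

Lemma nrX (a : C) n : nr (a ^+ n) = nr a ^+ n.
Proof. by elim: n => [|n IH]; rewrite ?expr0 ?nr1 // !exprS nrM IH. Qed.

Lemma nr_real (r : R) : nr (r%:C%C : C) = `|r|.
Proof.
apply: (complexI (R:=R)); rewrite -nrE normc_def /= expr0n /= addr0 sqrtr_sqr //.
Qed.

Lemma nrZ (V : normedModType C) (a : C) (x : V) : nr (a *: x) = nr a * nr x.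
Proof. by apply: (complexI (R:=R)); rewrite rmorphM /= -!nrE normrZ. Qed.

Lemma nr_sum (V : normedZmodType C) n (F : 'I_n -> V) :
  nr (\sum_(i < n) F i) <= \sum_(i < n) nr (F i).
Proof.
elim/big_ind2 : _ => [|x a y b ha hb|//]; first by rewrite nr0.
by apply: (le_trans (nrD _ _)); rewrite lerD.
Qed.

Lemma C_gt0 (e : C) : 0 < e -> exists2 r : R, 0 < r & e = r%:C%C.
Proof.
move=> e0; have er : e = (complex.Re e)%:C%C by rewrite RRe_real // gtr0_real.
by exists (complex.Re e) => //; rewrite -ltcR -er.
Qed.

Lemma clos_ptP (A : set C) (l : C) :
  clos_pt A l <-> forall e : R, 0 < e -> exists2 m, A m & nr (m - l) < e.
Proof.
split=> h e e0.
  have [|m [Am hm]] := h e%:C%C; first by rewrite ltcR.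
  by exists m => //; rewrite -ltcR -nrE.
have [r r0 ->] := C_gt0 e0; have [m Am hm] := h r r0.
by exists m; split => //; rewrite nrE ltcR.
Qed.

Lemma accpP (A : set C) (l : C) :
  accp A l <-> forall e : R, 0 < e -> exists m, [/\ A m, m != l & nr (m - l) < e].
Proof.
split=> h e e0.
  have [|m [Am ml hm]] := h e%:C%C; first by rewrite ltcR.
  by exists m; split => //; rewrite -ltcR -nrE.
have [r r0 ->] := C_gt0 e0; have [m [Am ml hm]] := h r r0.
by exists m; split => //; rewrite nrE ltcR.
Qed.

Definition cauchyr (V : normedZmodType C) (u : nat -> V) :=
  forall e : R, 0 < e -> exists N, forall m n, (N <= m)%N -> (N <= n)%N -> nr (u m - u n) < e.
Definition limr (V : normedZmodType C) (u : nat -> V) (l : V) :=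
  forall e : R, 0 < e -> exists N, forall n, (N <= n)%N -> nr (u n - l) < e.
Definition complete_on (V : normedZmodType C) (D : set V) :=
  forall u : nat -> V, (forall n, D (u n)) -> cauchyr u -> exists2 l, D l & limr u l.

Lemma cauchyr_tail (V : normedZmodType C) (u : nat -> V) (b : nat -> R) :
  (forall e : R, 0 < e -> exists N, forall n, (N <= n)%N -> b n < e) ->
  (forall m n, (m <= n)%N -> nr (u n - u m) <= b m) -> cauchyr u.
Proof.
move=> b0 ub e e0; have [|N hN] := b0 (e / 2); first by rewrite divr_gt0.
exists N => m n /= Nm Nn; apply: (le_lt_trans (nrT (u N) _ _)).
have h0 := hN N (leqnn N); have h1 := ub _ _ Nm; have h2 := ub _ _ Nn.
by rewrite (nrC (u N)); lra.
Qed.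

Lemma geo_small (q : R) : 0 <= q -> q < 1 -> forall (b e : R), 0 <= b -> 0 < e ->
  exists N, forall n, (N <= n)%N -> b * q ^+ n < e.
Proof.
move=> q0 q1 b e b0 e0.
have := @cvg_geometric R b q; rewrite ger0_norm // => /(_ q1).
move/cvgrPdist_lt => /(_ e e0) [N _ hN]; exists N => n Nn.
by have := hN n Nn; rewrite sub0r normrN ger0_norm // mulr_ge0 // exprn_ge0.
Qed.

Lemma null_seq : exists q : nat -> R, [/\ forall n, 0 < q n,
  forall m n, (m <= n)%N -> q n <= q m &
  forall e : R, 0 < e -> exists N, forall n, (N <= n)%N -> q n < e].
Proof.
exists (fun n => n.+1%:R^-1); split=> [n|m n mn|e e0].
- by rewrite invr_gt0.
- by rewrite lef_pV2 ?posrE ?ltr0n // ler_nat.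
exists (Num.truncn e^-1) => n Nn.
rewrite invf_plt ?posrE ?ltr0n //.
have := truncnS_gt e^-1; move=> h; apply: (lt_le_trans h).
by rewrite ler_nat ltnS.
Qed.

(** Supplies the limits of coefficients in [closed_line]; completeness of the reals is applied to
    real and imaginary parts. *)
Lemma complete_C : complete_on [set: C].
Proof.
have nrCE (z : C) : nr z = Num.sqrt (complex.Re z ^+ 2 + complex.Im z ^+ 2).
  by apply: (complexI (R:=R)); rewrite -nrE normc_def.
have reC (z : C) : `|complex.Re z| <= nr z.
  by rewrite nrCE -sqrtr_sqr ler_wsqrtr // lerDl sqr_ge0.
have imC (z : C) : `|complex.Im z| <= nr z.
  by rewrite nrCE -sqrtr_sqr ler_wsqrtr // lerDr sqr_ge0.
have reimC (z : C) : nr z <= `|complex.Re z| + `|complex.Im z|.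
  rewrite nrCE -[leRHS]ger0_norm ?addr_ge0 // -sqrtr_sqr ler_wsqrtr //.
  by rewrite sqrrD !real_normK ?num_real // addrAC lerDl mulrn_wge0 // mulr_ge0.
have cR (v : nat -> R) : (forall e : R, 0 < e -> exists N, forall m n, (N <= m)%N -> (N <= n)%N ->
    `|v m - v n| < e) -> exists l, forall e : R, 0 < e -> exists N, forall n, (N <= n)%N -> `|v n - l| < e.
  move=> h; have : cvg ((v : nat -> R^o) @ \oo).
    apply: cauchy_cvg; apply: cauchy_exP => e e0; have [N hN] := h e e0.
    by exists (v N); exists N => // n /= Nn; rewrite /ball /=; apply: hN.
  move=> /cvgrPdist_lt hl; exists (lim ((v : nat -> R^o) @ \oo)) => e e0.
  have [N _ hN] := hl e e0; exists N => n Nn; rewrite distrC; exact: hN.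
move=> u _ cu.
have [|a ha] := cR (fun n => complex.Re (u n)).
  move=> e e0; have [N hN] := cu e e0; exists N => m n Nm Nn.
  by have := le_lt_trans (reC _) (hN m n Nm Nn); case: (u m); case: (u n).
have [|b hb] := cR (fun n => complex.Im (u n)).
  move=> e e0; have [N hN] := cu e e0; exists N => m n Nm Nn.
  by have := le_lt_trans (imC _) (hN m n Nm Nn); case: (u m); case: (u n).
exists (a +i* b)%C => // e e0.
have [|N hN] := ha (e / 2); first by rewrite divr_gt0.
have [|N' hN'] := hb (e / 2); first by rewrite divr_gt0.
exists (maxn N N') => n; rewrite geq_max => /andP[/hN h1 /hN' h2].
apply: (le_lt_trans (reimC _)); move: h1 h2.
by case: (u n) => x y /= h1 h2; lra.
Qed.

Definition lin (V W : lmodType C) (A : V -> W) := forall (a : C) x y, A (a *: x + y) = a *: A x + A y.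
Definition bnd (V W : normedModType C) (A : V -> W) := exists K : R, forall x, nr (A x) <= K * nr x.

Section Lin.
Context (V W : lmodType C) (A : V -> W) (lA : lin A).
Lemma linD x y : A (x + y) = A x + A y.
Proof. by have := lA 1 x y; rewrite !scale1r. Qed.
Lemma lin0 : A 0 = 0.
Proof. by have /eqP := linD 0 0; rewrite addr0 -subr_eq0 opprD addNKr oppr_eq0 => /eqP. Qed.
Lemma linZ a x : A (a *: x) = a *: A x.
Proof. by have := lA a x 0; rewrite lin0 !addr0. Qed.
Lemma linN x : A (- x) = - A x.
Proof. by rewrite -scaleN1r linZ scaleN1r. Qed.
Lemma linB x y : A (x - y) = A x - A y.
Proof. by rewrite linD linN. Qed.
Lemma lin_sum n (F : 'I_n -> V) : A (\sum_(i < n) F i) = \sum_(i < n) A (F i).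
Proof. by elim/big_ind2 : _ => [|x a y b <- <-|//]; rewrite ?lin0 ?linD. Qed.
End Lin.

Lemma bndP (V W : normedModType C) (A : V -> W) : bnd A -> exists2 K : R, 0 < K & forall x, nr (A x) <= K * nr x.
Proof.
move=> [K hK]; exists (`|K| + 1); first by rewrite ltr_pwDr.
move=> x; apply: (le_trans (hK x)); rewrite ler_wpM2r ?nr_ge0 //.
by have := ler_norm K; lra.
Qed.

Lemma limr_bnd (V W : normedModType C) (A : V -> W) (u : nat -> V) l :
  lin A -> bnd A -> limr u l -> limr (A \o u) (A l).
Proof.
move=> lA /bndP[K K0 hK] ul e e0; have [|N hN] := ul (e / K); first by rewrite divr_gt0.
exists N => n /hN h; rewrite /= -(linB lA); apply: (le_lt_trans (hK _)).
by rewrite mulrC -ltr_pdivlMr.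
Qed.

Lemma limr_unique (V : normedZmodType C) (u : nat -> V) l l' : limr u l -> limr u l' -> l = l'.
Proof.
move=> h h'; apply/eqP; rewrite -subr_eq0; apply/negPn/negP => /nr_gt0 n0.
have [|N hN] := h (nr (l - l') / 2); first by rewrite divr_gt0.
have [|N' hN'] := h' (nr (l - l') / 2); first by rewrite divr_gt0.
have := hN (maxn N N') (leq_maxl _ _); have := hN' (maxn N N') (leq_maxr _ _).
by have := nrT (u (maxn N N')) l l'; rewrite (nrC l (u _)); lra.
Qed.

End Norm.
Arguments nr {R V} x.

Section Topo.
Context {R : realType} {X : completeNormedModType R[i]}.
Local Notation C := R[i].

Lemma closedP (A : set X) : closed A <->
  forall x, (forall e : R, 0 < e -> exists2 a, A a & nr (x - a) < e) -> A x.
Proof.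
split=> [cA x hx|h x cx].
  apply: cA => B /nbhs_normP [e /= e0 hB].
  have [r r0 re] := C_gt0 e0; have [a Aa ha] := hx r r0.
  by exists a; split => //; apply: hB => /=; rewrite nrE re ltcR.
apply: h => e e0.
have [|a [Aa ha]] := cx (ball x e%:C%C).
  by apply: nbhsx_ballx; rewrite ltcR.
by exists a => //; move: ha; rewrite -ball_normE /= nrE ltcR.
Qed.

Lemma complete_X : complete_on [set: X].
Proof.
move=> u _ cu.
have : cvg (u @ \oo).
  apply: cauchy_cvg; apply: cauchy_exP => e e0.
  have [r r0 ->] := C_gt0 e0; have [N hN] := cu r r0.
  by exists (u N); exists N => // n /= Nn; rewrite -ball_normE /= nrE ltcR; apply: hN.
move=> /cvgrPdist_lt hl; exists (lim (u @ \oo)) => // e e0.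
have [|N _ hN] := hl e%:C%C; first by rewrite ltcR.
by exists N => n Nn; have := hN n Nn; rewrite /= nrE ltcR nrC.
Qed.

Lemma closed_complete (A : set X) : closed A -> complete_on A.
Proof.
move=> /closedP cA u Au /(complete_X (fun=> I)) [l _ ul]; exists l => //.
apply: cA => e e0; have [N hN] := ul e e0.
by exists (u N) => //; rewrite nrC; apply: hN.
Qed.

Lemma continuous_bnd (T : {linear X -> X}) : continuous T -> bnd T.
Proof.
move=> cT.
have /linear_boundedP : bounded_near T (nbhs 0) by apply/linear_bounded_continuous.
move=> [M [Mr hM]].
exists (complex.Re M + 1) => x; rewrite -lecR rmorphM /= -!nrE.
apply: hM; rewrite -[X in X < _](RRe_real Mr) ltcR; lra.
Qed.
End Topo.

(* [nlra] is [lra] with norms as atoms up to conversion: the same vector may be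
   typed through different inheritance paths, which [lra] keeps apart. *)
Ltac nr_merge a x :=
  repeat match goal with
  | |- context [@nr ?K ?W ?y] => unify x y; change (@nr K W y) with a
  | H : context [@nr ?K ?W ?y] |- _ => unify x y; change (@nr K W y) with a in H
  end.
Ltac nr_abs :=
  repeat match goal with
  | |- context [@nr ?K ?W ?x] =>
      let a := fresh "nra" in
      pose a := @nr K W x; change (@nr K W x) with a; nr_merge a x; clearbody a
  | H : context [@nr ?K ?W ?x] |- _ =>
      let a := fresh "nra" in
      pose a := @nr K W x; change (@nr K W x) with a in H; nr_merge a x; clearbody a
  end.
Ltac nlra := intros; nr_abs; lra.

(** * Open mapping theorem on closed subspaces *)

Section OpenMapping.
Context {R : realType} {V : normedModType R[i]} {X : completeNormedModType R[i]}.
Local Notation C := R[i].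

Ltac lmod := lmod_gen (R[i] : comNzRingType) (X : lmodType R[i]).

Lemma limr_le (Z : normedZmodType C) (u : nat -> Z) (l a : Z) (b : R) :
  limr u l -> (exists N, forall n, (N <= n)%N -> nr (u n - a) <= b) -> nr (l - a) <= b.
Proof.
move=> ul [N' hu]; rewrite leNgt; apply/negP => h.
have [|N hN] := ul (nr (l - a) - b); first by rewrite subr_gt0.
have := hN (maxn N N') (leq_maxl _ _); have := hu (maxn N N') (leq_maxr _ _).
by have := nrT (u (maxn N N')) l a; rewrite (nrC l (u _)); lra.
Qed.

Lemma subspaceD (Z : normedModType C) (D : set Z) : subspace D -> forall x y, D x -> D y -> D (x + y).
Proof. by move=> [_ h] x y Dx Dy; have := h 1 x y Dx Dy; rewrite scale1r. Qed.
Lemma subspaceZ (Z : normedModType C) (D : set Z) : subspace D -> forall a x, D x -> D (a *: x).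
Proof. by move=> [h0 h] a x Dx; have := h a x 0 Dx h0; rewrite addr0. Qed.
Lemma subspaceN (Z : normedModType C) (D : set Z) : subspace D -> forall x, D x -> D (- x).
Proof. by move=> h x Dx; rewrite -scaleN1r; apply: subspaceZ. Qed.
Lemma subspaceB (Z : normedModType C) (D : set Z) : subspace D -> forall x y, D x -> D y -> D (x - y).
Proof. by move=> h x y Dx Dy; apply: subspaceD => //; apply: subspaceN. Qed.
Lemma subspace_sum (Z : normedModType C) (D : set Z) : subspace D ->
  forall n (F : 'I_n -> Z), (forall i, D (F i)) -> D (\sum_(i < n) F i).
Proof.
move=> h n F hF; elim/big_ind : _ => //; first by case: h.
exact: subspaceD.
Qed.

(** Successive approximation: correcting the residual again and again gives a geometric series with
    ratio [th], whose sum is an exact preimage. The set [U] of admissible residuals is left free; it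
    is later the range itself, its closure, a hyperrange or a whole subspace. *)
Lemma approx (A : V -> X) (D : set V) (U : set X) (c th : R) :
  lin A -> bnd A -> subspace D -> complete_on D -> 0 <= c -> 0 <= th < 1 ->
  (forall y, U y -> exists x, [/\ D x, nr x <= c * nr y, U (y - A x) & nr (y - A x) <= th * nr y]) ->
  forall y, U y -> exists x, [/\ D x, A x = y & nr x <= c / (1 - th) * nr y].
Proof.
move=> lA bA sD cD c0 /andP[th0 th1] h y Uy.
have step y' : exists x, U y' ->
    [/\ D x, nr x <= c * nr y', U (y' - A x) & nr (y' - A x) <= th * nr y'].
  by have [/h[x hx]|nU] := pselect (U y'); [exists x | exists 0].
have [g hg] := choice step.
pose r k := iter k (fun r => r - A (g r)) y.
pose x k := \sum_(i < k) g (r i).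
have Ur k : U (r k) by elim: k => //= k /hg[].
have rb k : nr (r k) <= th ^+ k * nr y.
  elim: k => [|k IH]; first by rewrite expr0 mul1r.
  have [_ _ _ h1] := hg _ (Ur k); apply: (le_trans h1).
  by rewrite exprS -mulrA ler_wpM2l.
have Dx k : D (x k) by apply: subspace_sum => // i; have [] := hg _ (Ur i).
have xb m d : nr (x (m + d)%N - x m) <= c * nr y * (th ^+ m * (1 - th ^+ d) / (1 - th)).
  elim: d => [|d IH]; first by rewrite addn0 subrr nr0 expr0 subrr mulr0 mul0r mulr0.
  rewrite addnS {1}/x big_ord_recr /= -/(x (m + d)%N) addrAC.
  apply: (le_trans (nrD _ _)); have [_ h1 _ _] := hg _ (Ur (m + d)%N).
  have h2 : nr (g (r (m + d)%N)) <= c * nr y * th ^+ (m + d)%N.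
    apply: (le_trans h1); rewrite -mulrA ler_wpM2l // mulrC; exact: rb.
  apply: (le_trans (lerD IH h2)); rewrite -mulrDr ler_wpM2l ?mulr_ge0 ?nr_ge0 //.
  rewrite le_eqVlt; apply/orP; left; apply/eqP; rewrite exprD exprS; field; lra.
have xb' m n : (m <= n)%N -> nr (x n - x m) <= c * nr y / (1 - th) * th ^+ m.
  move=> mn; have := xb m (n - m)%N; rewrite subnKC // => hx; apply: (le_trans hx).
  have -> : c * nr y / (1 - th) * th ^+ m = c * nr y * (th ^+ m * 1 / (1 - th)) by ring.
  apply: ler_wpM2l; first by rewrite mulr_ge0 ?nr_ge0.
  apply: ler_wpM2r; first by rewrite invr_ge0; lra.
  by apply: ler_wpM2l; rewrite ?exprn_ge0 // gerBl exprn_ge0.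
have bb : 0 <= c * nr y / (1 - th) by rewrite mulr_ge0 ?mulr_ge0 ?nr_ge0 // invr_ge0; lra.
have [l Dl xl] := cD x Dx (@cauchyr_tail _ _ _ (fun m => c * nr y / (1 - th) * th ^+ m)
  (fun e e0 => geo_small th0 th1 bb e0) xb').
exists l; split => //.
  have rl : limr r 0.
    move=> e e0; have [N hN] := geo_small th0 th1 (nr_ge0 y) e0; exists N => n Nn.
    by rewrite subr0; apply: (le_lt_trans (rb n)); rewrite mulrC; exact: hN.
  have Ax k : A (x k) = y - r k.
    elim: k => [|k IH]; first by rewrite /x big_ord0 (lin0 lA) subrr.
    by rewrite {1}/x big_ord_recr /= -/(x k) (linD lA) IH opprB addrA addrAC.
  apply: (limr_unique (limr_bnd lA bA xl)) => e e0; have [N hN] := rl e e0; exists N => n Nn.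
  by rewrite /= Ax addrAC subrr sub0r nrN; have := hN n Nn; rewrite subr0.
rewrite -[l]subr0; apply: (limr_le xl); exists 0%N => n _.
have := xb' 0%N n (leq0n n); rewrite expr0 mulr1 {2}/x big_ord0 => hh.
by apply: (le_trans hh); rewrite mulrAC.
Qed.

(** Baire's argument inside the closed range. If no image of a ball of integer radius were dense in
    a ball of the range, nested balls could be built whose [n]-th step stays away from the image of
    the ball of radius [n]. Their common point is the image of some [x], which contradicts any [n]
    above the norm of [x]. *)
Lemma baire_image (A : V -> X) (D : set V) :
  lin A -> D 0 -> closed (A @` D) ->
  exists n : nat, exists y0, exists2 r : R, 0 < r & (A @` D) y0 /\ forall y, (A @` D) y -> nr (y - y0) < r ->
    forall e : R, 0 < e -> exists z, [/\ D z, nr z <= n%:R & nr (y - A z) < e].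
Proof.
move=> lA D0 cR; apply: contrapT => hn.
have step (n : nat) (p : X * R) : exists q : X * R, (A @` D) p.1 -> 0 < p.2 ->
    [/\ (A @` D) q.1, 0 < q.2, nr (q.1 - p.1) + q.2 <= p.2, q.2 <= p.2 / 2 &
      forall z, D z -> nr z <= n%:R -> 2 * q.2 <= nr (q.1 - A z)].
  case: p => y0 r /=; have [[Ry0 r0]|nR] := pselect ((A @` D) y0 /\ 0 < r); last first.
    by exists (0, 0) => h1 h2; case: nR.
  suff [y [Ry yr [e e0 he]]] : exists y, [/\ (A @` D) y, nr (y - y0) < r & exists2 e : R, 0 < e &
      forall z, D z -> nr z <= n%:R -> e <= nr (y - A z)].
    (* The three bounds keep the new ball inside the old one, halve its radius, and leave twice that
       radius below the margin [e]. *)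
    pose t := Num.min (r - nr (y - y0)) (Num.min (r / 2) (e / 2)).
    have t0 : 0 < t by rewrite !lt_min subr_gt0 yr !divr_gt0.
    have t1 : t <= r - nr (y - y0) by rewrite ge_min lexx.
    have t2 : t <= r / 2 by rewrite !ge_min lexx orbT.
    have t3 : t <= e / 2 by rewrite !ge_min lexx !orbT.
    exists (y, t) => _ _ /=; split => //; first by lra.
    by move=> z Dz zn; have := he z Dz zn; lra.
  apply: contrapT => hy; apply: hn; exists n, y0, r => //; split => // y Ry yr e e0.
  apply: contrapT => hz; apply: hy; exists y; split => //; exists e => // z Dz zn.
  by rewrite leNgt; apply/negP => hlt; apply: hz; exists z.
have [F hF] := choice (fun np : nat * (X * R) => step np.1 np.2).
pose p := fix p n : X * R := if n is m.+1 then F (m, p m) else (0, 1).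
have R0 : (A @` D) 0 by exists 0 => //; rewrite (lin0 lA).
have pP n : (A @` D) (p n).1 /\ 0 < (p n).2.
  by elim: n => [//|n [h1 h2]] /=; have [] := hF (n, p n) h1 h2.
have p2 n : (p n).2 <= 1 * 2^-1 ^+ n.
  elim: n => [|n IH]; first by rewrite expr0 mulr1.
  have [h1 h2] := pP n; have [_ _ _ h3 _] := hF (n, p n) h1 h2.
  by apply: (le_trans h3); rewrite exprS /=; lra.
have pm m d : nr ((p (m + d)%N).1 - (p m).1) + (p (m + d)%N).2 <= (p m).2.
  elim: d => [|d IH]; first by rewrite addn0 subrr nr0 add0r.
  have [h1 h2] := pP (m + d)%N; have [_ _ h3 _ _] := hF ((m + d)%N, p (m + d)%N) h1 h2.
  rewrite addnS; move: h3 => /=.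
  set q := F _; have := nrT (p (m + d)%N).1 q.1 (p m).1; lra.
have pm' m n : (m <= n)%N -> nr ((p n).1 - (p m).1) <= (p m).2.
  by move=> mn; have := pm m (n - m)%N; rewrite subnKC //; have [_] := pP n; lra.
have [l Rl pl] : exists2 l, (A @` D) l & limr (fst \o p) l.
  apply: (closed_complete cR) => [n|]; first by have [] := pP n.
  apply: (@cauchyr_tail _ _ _ (fun n => (p n).2)) => // e e0.
  have [||N hN] := @geo_small R (2^-1) _ _ 1 e ler01 e0; [lra|lra|].
  by exists N => n /hN; apply: le_lt_trans.
case: Rl => x Dx xl.
pose n := (Num.truncn (nr x)).+1.
have xn : nr x <= n%:R by apply: ltW; exact: truncnS_gt.
have [h1 h2] := pP n; have [_ h3 _ _ h4] := hF (n, p n) h1 h2.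
have := h4 x Dx xn; rewrite xl nrC.
have /= : nr (l - (p n.+1).1) <= (p n.+1).2.
  by apply: (limr_le pl); exists n.+1 => k hk; apply: pm'.
by move: h3 => /=; lra.
Qed.

Lemma open_mapping (A : V -> X) (D : set V) :
  lin A -> bnd A -> subspace D -> complete_on D -> closed (A @` D) ->
  exists2 c : R, 0 < c & forall x, D x -> exists z, [/\ D z, A z = A x & nr z <= c * nr (A x)].
Proof.
move=> lA bA sD cD cR.
have [n [y0 [r r0 [Ry0 h]]]] := baire_image lA (proj1 sD) cR.
have sR : subspace (A @` D).
  split; first by exists 0; [case: sD | rewrite (lin0 lA)].
  move=> a _ _ [x Dx <-] [y Dy <-]; exists (a *: x + y) => //.
  by case: sD => _; apply.
(* Differences of approximate preimages of [y0 + y] and [y0] move the centre to the origin, at the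
   price of doubling the bound on the preimage. *)
have h2 y : (A @` D) y -> nr y < r -> forall e : R, 0 < e ->
    exists z, [/\ D z, nr z <= 2 * n%:R & nr (y - A z) < e].
  move=> Ry yr e e0.
  have [z1 [D1 n1 e1]] : exists z, [/\ D z, nr z <= n%:R & nr (y0 + y - A z) < e / 2].
    by apply: h; [exact: subspaceD|rewrite addrAC subrr add0r|rewrite divr_gt0].
  have [z2 [D2 n2 e2]] : exists z, [/\ D z, nr z <= n%:R & nr (y0 - A z) < e / 2].
    by apply: h; [|rewrite subrr nr0|rewrite divr_gt0].
  exists (z1 - z2); split; first exact: subspaceB.
    by have := nrB z1 z2; lra.
  rewrite (linB lA).
  have -> : y - (A z1 - A z2) = (y0 + y - A z1) - (y0 - A z2).
    lmod.
  by have := nrB (y0 + y - A z1) (y0 - A z2); lra.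
(* Scaling [y] to norm [r / 2] and asking for an error below [r / 4] halves the residual; scaling a
   preimage of norm at most [2 * n] back gives this constant. *)
pose c : R := 4 * n%:R / r.
have c0 : 0 <= c by rewrite mulr_ge0 ?invr_ge0 ?mulr_ge0 // ltW.
suff hs : forall y, (A @` D) y -> exists x,
    [/\ D x, nr x <= c * nr y, (A @` D) (y - A x) & nr (y - A x) <= 2^-1 * nr y].
  have th : 0 <= (2^-1 : R) < 1 by apply/andP; split; lra.
  have hx := approx lA bA sD cD c0 th hs.
  exists (c / (1 - 2^-1) + 1).
    by rewrite ltr_pwDr // divr_ge0 //; lra.
  move=> x Dx; have [|z [Dz Az zn]] := hx (A x); first by exists x.
  exists z; split => //; apply: (le_trans zn); rewrite ler_wpM2r ?nr_ge0 //; lra.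
move=> y Ry; have [->|y0'] := eqVneq y 0.
  exists 0; rewrite !(lin0 lA) !nr0 subr0 nr0 !mulr0; split => //; first by case: sD.
  by case: sR.
have ny := nr_gt0 y0'.
pose t : R := r / (2 * nr y).
have t0 : 0 < t by rewrite divr_gt0 ?mulr_gt0.
have nt : nr (t%:C%C : C) = t by rewrite nr_real ger0_norm // ltW.
have tn : (t%:C%C : C) != 0 by apply/eqP => ht; move: nt; rewrite ht nr0; lra.
have [z [Dz zn ze]] : exists z, [/\ D z, nr z <= 2 * n%:R & nr (t%:C%C *: y - A z) < r / 4].
  apply: h2; [exact: subspaceZ| |by rewrite divr_gt0].
  rewrite nrZ nt /t; have -> : r / (2 * nr y) * nr y = r / 2 by field; lra.
  lra.
exists ((t%:C%C)^-1 *: z); split.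
- exact: subspaceZ.
- rewrite nrZ nrV nt; apply: (@le_trans _ _ (t^-1 * (2 * n%:R))).
    by rewrite ler_wpM2l // invr_ge0 ltW.
  rewrite le_eqVlt; apply/orP; left; apply/eqP; rewrite /t /c; field; lra.
- apply: subspaceB => //; exists (t%:C%C^-1 *: z) => //; exact: subspaceZ.
have -> : y - A (t%:C%C^-1 *: z) = (t%:C%C)^-1 *: (t%:C%C *: y - A z).
  by rewrite (linZ lA) scalerBr scalerA mulVf // scale1r.
rewrite nrZ nrV nt; apply: (@le_trans _ _ (t^-1 * (r / 4))).
  by rewrite ler_wpM2l ?invr_ge0 // ltW.
rewrite le_eqVlt; apply/orP; left; apply/eqP; rewrite /t; field; lra.
Qed.
End OpenMapping.

(** * Dimension modulo a subspace *)

Section Dim.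
Context {R : realType} {X : completeNormedModType R[i]}.
Local Notation C := R[i].
Ltac lmod := lmod_gen (R[i] : comNzRingType) (X : lmodType R[i]).
Implicit Types (A B D W : set X) (s t : nat -> X) (c : nat -> C).

(* [spn W n s] is [W] plus the span of [s 0, ..., s n.-1]; families are indexed
   by [nat] and only their first [n] terms matter.  [dimle A W n] bounds the
   dimension of [(A + W) / W]. *)
Definition spn W n s : set X := [set x | exists c, W (x - \sum_(i < n) c i *: s i)].
Definition dimle A W n := exists s, A `<=` spn W n s.
Definition indep A W n s := (forall i, (i < n)%N -> A (s i)) /\
  forall c, W (\sum_(i < n) c i *: s i) -> forall i, (i < n)%N -> c i = 0.
Definition rdim A W n := exists2 s, indep A W n s & A `<=` spn W n s.

(** Passes from families over ['I_n], as in the definitions of finite dimension, to families over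
    [nat]; the value beyond [n] is [0]. *)
Definition ext0 (T : zmodType) n (f : 'I_n -> T) (k : nat) : T := oapp f 0 (insub k).
Lemma ext0E (T : zmodType) n (f : 'I_n -> T) (i : 'I_n) : ext0 f i = f i.
Proof. by rewrite /ext0 valK. Qed.

Lemma subspace0 : subspace [set 0 : X].
Proof. by split => // a x y -> ->; rewrite scaler0 addr0. Qed.

(** The coordinates of the [t i] in the [s j] form an [m x n] matrix. For [n < m] its left kernel
    contains a nonzero row, which is a relation among the [t i] modulo [W]. *)
Lemma indep_le A W m n t : subspace W -> indep A W m t -> dimle A W n -> (m <= n)%N.
Proof.
move=> sW [At it] [s hs]; rewrite leqNgt; apply/negP => nm.
have step (i : 'I_m) : exists c, W (t i - \sum_(j < n) c j *: s j).
  by apply: hs; apply: At.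
have [f hf] := choice step.
pose M : 'M[C]_(m, n) := \matrix_(i, j) f i j.
have /rowV0Pn[v vM v0] : kermx M != 0.
  rewrite -mxrank_eq0 mxrank_ker subn_eq0 -ltnNge.
  by apply: leq_ltn_trans nm; apply: rank_leq_col.
have {}vM : v *m M = 0 by apply/eqP; rewrite -sub_kermx.
have : W (\sum_(i < m) ext0 (v 0) i *: t i).
  have -> : \sum_(i < m) ext0 (v 0) i *: t i = \sum_(i < m) v 0 i *: (t i - \sum_(j < n) f i j *: s j).
    under [RHS]eq_bigr do rewrite scalerBr scaler_sumr.
    rewrite sumrB exchange_big /= [X in _ = _ - X]big1 ?subr0.
      by apply: eq_bigr => i _; rewrite ext0E.
    move=> j _; under eq_bigr do rewrite scalerA.
    rewrite -scaler_suml; have /rowP/(_ j) := vM; rewrite !mxE => vj.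
    rewrite (_ : \sum_(i < m) v 0 i * f i j = 0) ?scale0r // -[RHS]vj.
    by apply: eq_bigr => i _; rewrite mxE.
  by apply: subspace_sum => // i; apply: subspaceZ.
move/it => hv; case/eqP: v0; apply/rowP => i; rewrite mxE.
by rewrite -ext0E hv.
Qed.

Lemma spn_subspace W n s : subspace W -> subspace (spn W n s).
Proof.
move=> sW; split.
  by exists (fun=> 0); rewrite big1 ?subr0; [case: sW|move=> i _; rewrite scale0r].
move=> a x y [c hx] [d hy]; exists (fun i => a * c i + d i).
have -> : \sum_(i < n) (a * c i + d i) *: s i = a *: (\sum_(i < n) c i *: s i) + \sum_(i < n) d i *: s i.
  by rewrite scaler_sumr -big_split; apply: eq_bigr => i _; rewrite scalerDl scalerA.
have := (proj2 sW) a _ _ hx hy; congr (W _); lmod.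
Qed.

Lemma spn_sub W n s : subspace W -> W `<=` spn W n s.
Proof.
move=> sW x Wx; exists (fun=> 0); rewrite big1 ?subr0 // => i _; exact: scale0r.
Qed.

Lemma spn_gen W n s i : subspace W -> (i < n)%N -> spn W n s (s i).
Proof.
move=> sW ni; exists (fun j => if j == i then 1 else 0).
rewrite (bigD1 (Ordinal ni)) //= eqxx scale1r big1 ?addr0 ?subrr; first by case: sW.
move=> j /eqP hj; case: eqP => [ji|_]; last by rewrite scale0r.
by case: hj; apply: val_inj.
Qed.

Lemma sum_ifs n c s a : \sum_(i < n) c i *: (if (i : nat) == n then a else s i) = \sum_(i < n) c i *: s i.
Proof. by apply: eq_bigr => i _; rewrite ltn_eqF. Qed.

Lemma sum_ifc n c s a : \sum_(i < n) (if (i : nat) == n then a else c i) *: s i = \sum_(i < n) c i *: s i.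
Proof. by apply: eq_bigr => i _; rewrite ltn_eqF. Qed.

Lemma sum_lt n c (d : 'I_n -> C) s :
  \sum_(i < n) (if (i < n)%N then c i else d i) *: s i = \sum_(i < n) c i *: s i.
Proof. by apply: eq_bigr => i _; rewrite ltn_ord. Qed.

Lemma indep_ext A W n t a : subspace W -> indep A W n t -> A a -> ~ spn W n t a ->
  indep A W n.+1 (fun i => if i == n then a else t i).
Proof.
move=> sW [At it] Aa na; split=> [i|c].
  by rewrite ltnS leq_eqVlt; case: eqP => //= _ /At.
rewrite big_ord_recr /= eqxx sum_ifs => h.
have cn : c n = 0.
  apply/eqP/negPn/negP => cn0; apply: na; exists (fun i => - (c n)^-1 * c i).
  have := subspaceZ sW (c n)^-1 h; rewrite scalerDr scalerA mulVf // scale1r.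
  under [X in W (a - X)]eq_bigr do rewrite -scalerA.
  rewrite -scaler_sumr; congr (W _); lmod.
move=> i; rewrite ltnS leq_eqVlt => /predU1P[->//|].
by apply: it; move: h; rewrite cn scale0r addr0.
Qed.

(** A dichotomy that makes sense in infinite dimension as well: independent families are extended
    one vector at a time until they span or reach length [n]. *)
Lemma dim_dich A W n : subspace W ->
  (exists2 m, (m < n)%N & rdim A W m) \/ exists t, indep A W n t.
Proof.
move=> sW; elim: n => [|n [[m mn hm]|[t it]]].
- by right; exists (fun=> 0).
- by left; exists m => //; apply: ltnW.
have [h|h] := pselect (A `<=` spn W n t); first by left; exists n => //; exists t.
right; have [a Aa na] : exists2 a, A a & ~ spn W n t a.
  by apply: contrapT => hh; apply: h => a Aa; apply: contrapT => na; apply: hh; exists a.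
by eexists; apply: indep_ext it Aa na.
Qed.

Lemma dimle_rdim A W n : subspace W -> dimle A W n -> exists2 m, (m <= n)%N & rdim A W m.
Proof.
move=> sW hn; case: (dim_dich A n.+1 sW) => [[m mn hm]|[t it]]; first by exists m.
by have := indep_le sW it hn; rewrite ltnn.
Qed.

Lemma rdim_dimle A W n : rdim A W n -> dimle A W n.
Proof. by move=> [s _ h]; exists s. Qed.

Lemma rdim_le A W m n : subspace W -> rdim A W m -> dimle A W n -> (m <= n)%N.
Proof. by move=> sW [t it _]; apply: indep_le it. Qed.

Lemma rdim_inj A W m n : subspace W -> rdim A W m -> rdim A W n -> m = n.
Proof.
by move=> sW hm hn; apply/eqP; rewrite eqn_leq !(@rdim_le A W) //; apply: rdim_dimle.
Qed.

Lemma dimle_widen A W m n : (m <= n)%N -> dimle A W m -> dimle A W n.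
Proof.
move=> mn [s h]; exists s => x /h [c hc]; exists (fun i => if (i < m)%N then c i else 0).
rewrite -(subnKC mn) big_split_ord /= sum_lt [\sum_(i < n - m) _]big1 ?addr0 // => i _.
by rewrite ltnNge leq_addr scale0r.
Qed.

Lemma dimle_sub A B W n : A `<=` B -> dimle B W n -> dimle A W n.
Proof. by move=> AB [s h]; exists s => x /AB/h. Qed.

(* [u] is independent of [B] modulo [W], so it accounts for one dimension of [A]. *)
Lemma dimle_drop A B W D n u : subspace W -> subspace D -> dimle A W n -> B `<=` A -> A u -> subspace B ->
  (forall b (a : C), B b -> W (b + a *: u) -> D b /\ a = 0) -> (0 < n)%N /\ dimle B D n.-1.
Proof.
move=> sW sD hn BA Au sB hu.
have key m t : indep B D m t -> (m < n)%N.
  move=> [Bt it]; apply: (@indep_le A W m.+1 n (fun i => if i == m then u else t i)) => //.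
  split=> [i|c].
    by rewrite ltnS leq_eqVlt; case: eqP => //= _ /Bt/BA.
  rewrite big_ord_recr /= eqxx sum_ifs.
  move/hu => []; first by apply: subspace_sum => // i; apply: subspaceZ => //; apply: Bt.
  move=> /it ci cm i; rewrite ltnS leq_eqVlt => /predU1P[->//|]; exact: ci.
have n0 : (0 < n)%N by apply: (key 0%N (fun=> 0)).
split => //; case: (dim_dich B n sD) => [[m mn /rdim_dimle]|[t /key]]; last by rewrite ltnn.
by apply: dimle_widen; rewrite -ltnS prednK.
Qed.

Lemma rdim_add A B W p q : subspace W -> W `<=` B -> B `<=` A -> subspace A -> subspace B ->
  rdim B W p -> rdim A B q -> rdim A W (p + q).
Proof.
move=> sW WB BA sA sB [s [Bs is_] hs] [t [At it] ht].
pose u i := if (i < p)%N then s i else t (i - p)%N.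
have uE c : \sum_(i < p + q) c i *: u i = \sum_(i < p) c i *: s i + \sum_(i < q) c (p + i)%N *: t i.
  rewrite big_split_ord /=; congr (_ + _); apply: eq_bigr => i _; rewrite /u ?ltn_ord //.
  by rewrite ltnNge leq_addr /= addKn.
exists u.
  split=> [i|c].
    rewrite /u; have [ip _|pi ipq] := ltnP i p; [by apply: BA; apply: Bs|apply: At; lia].
  rewrite uE => h.
  have h1 : B (\sum_(i < p) c i *: s i).
    by apply: subspace_sum => // i; apply: subspaceZ => //; apply: Bs.
  have h2 : forall i, (i < q)%N -> c (p + i)%N = 0.
    apply: (it (fun i => c (p + i)%N)).
    by have := subspaceB sB (WB _ h) h1; rewrite addrAC subrr add0r.
  have h3 : forall i, (i < p)%N -> c i = 0.
    apply: is_; move: h; rewrite [X in _ + X]big1 ?addr0 // => i _.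
    by rewrite h2 ?scale0r.
  move=> i ipq; have [/h3//|pi] := ltnP i p; rewrite -(subnKC pi); apply: h2; lia.
move=> x /ht [d /hs [c hc]].
pose e i := if (i < p)%N then c i else d (i - p)%N.
exists e; rewrite uE /e sum_lt (_ : \sum_(i < q) _ = \sum_(i < q) d i *: t i).
  by move: hc; congr (W _); lmod.
by apply: eq_bigr => i _; rewrite ltnNge leq_addr /= addKn.
Qed.

Lemma dist_pos W v : closed W -> ~ W v -> exists2 d : R, 0 < d & forall w, W w -> d <= nr (v - w).
Proof.
move=> cW nWv; apply: contrapT => h; apply: nWv; apply: (iffLR (closedP W) cW) => e e0.
apply: contrapT => hh; apply: h; exists e => // w Ww; rewrite leNgt; apply/negP => hlt.
by apply: hh; exists w.
Qed.

(** For [v] outside [W], the distance from [v] to [W] bounds the coefficient of [v], so the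
    coefficients of approximating points form a Cauchy sequence. *)
Lemma closed_line W v : subspace W -> closed W -> closed [set x | exists c : C, W (x - c *: v)].
Proof.
move=> sW cW; have [Wv|nWv] := pselect (W v).
  suff -> : [set x | exists c : C, W (x - c *: v)] = W by [].
  apply/seteqP; split => x /=; last by exists 0; rewrite scale0r subr0.
  by move=> [c hc]; rewrite -(subrK (c *: v) x); apply: subspaceD => //; apply: subspaceZ.
have [d d0 hd] := dist_pos cW nWv.
have hd' (c : C) w : W w -> nr c * d <= nr (c *: v - w).
  move=> Ww; have [->|c0] := eqVneq c 0; first by rewrite nr0 mul0r nr_ge0.
  have -> : c *: v - w = c *: (v - c^-1 *: w) by rewrite scalerBr scalerA mulfV // scale1r.
  by rewrite nrZ ler_wpM2l ?nr_ge0 // hd //; apply: subspaceZ.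
apply/closedP => x hx.
have [q [q0 qm qs]] := @null_seq R.
have step (n : nat) : exists c : C, exists2 w, W w & nr (x - c *: v - w) < q n.
  have [a [c hc] ha] := hx (q n) (q0 n).
  by exists c, (a - c *: v) => //; move: ha; congr (nr _ < _); lmod.
have [f hf] := choice step.
have [l _ fl] : exists2 l, [set: C] l & limr f l.
  apply: complete_C => //.
  apply: (@cauchyr_tail _ _ _ (fun m => 2 / d * q m)) => [e e0|m n mn].
    have [|N hN] := qs (e / (2 / d)); first by rewrite !divr_gt0.
    by exists N => n Nn; rewrite mulrC -ltr_pdivlMr ?divr_gt0 // hN.
  have [w Ww hw] := hf m; have [w' Ww' hw'] := hf n.
  have := hd' (f n - f m) (w - w') (subspaceB sW Ww Ww').
  have -> : (f n - f m) *: v - (w - w') = (x - f m *: v - w) - (x - f n *: v - w') by lmod.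
  have := nrB (x - f m *: v - w) (x - f n *: v - w').
  have := qm _ _ mn.
  rewrite [2 / d]mulrC -mulrA ler_pdivlMl // [d * _]mulrC; nlra.
exists l; apply: (iffLR (closedP W) cW) => e e0.
have v1 : 0 < nr v + 1 by have := nr_ge0 v; lra.
have [|N hN] := fl (e / 2 / (nr v + 1)); first by rewrite !divr_gt0.
have [|N' hN'] := qs (e / 2); first by rewrite divr_gt0.
pose k := maxn N N'; have [w Ww hw] := hf k; exists w => //.
have h1 := hN k (leq_maxl _ _); have h2 := hN' k (leq_maxr _ _).
have -> : x - l *: v - w = (x - f k *: v - w) + (f k - l) *: v by lmod.
apply: (le_lt_trans (nrD _ _)); rewrite nrZ.
have : nr (f k - l) * nr v <= e / 2 / (nr v + 1) * (nr v + 1).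
  by apply: ler_pM; rewrite ?nr_ge0 // ?ltW //; lra.
rewrite divfK; last by apply/eqP; lra.
by move: hw h2; lra.
Qed.

Lemma spn_rec W n s : subspace W -> spn W n.+1 s = [set x | exists c : C, spn W n s (x - c *: s n)].
Proof.
move=> sW; apply/seteqP; split => x /=.
  by move=> [c]; rewrite big_ord_recr /= => hc; exists (c n), c; move: hc; congr (W _); lmod.
move=> [a [c hc]]; exists (fun i => if i == n then a else c i).
rewrite big_ord_recr /= eqxx sum_ifc.
by move: hc; congr (W _); lmod.
Qed.

Lemma spn_closed W n s : subspace W -> closed W -> closed (spn W n s).
Proof.
move=> sW cW; elim: n => [|n IH].
  suff -> : spn W 0 s = W by [].
  apply/seteqP; split => x; last exact: spn_sub.
  by move=> [c]; rewrite big_ord0 subr0.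
by rewrite spn_rec //; apply: closed_line => //; apply: spn_subspace.
Qed.

End Dim.

(** * Near-orthogonal families and the gap between subspaces *)

Section Gap.
Context {R : realType} {X : completeNormedModType R[i]}.
Local Notation C := R[i].
Ltac lmod := lmod_gen (R[i] : comNzRingType) (X : lmodType R[i]).
Implicit Types (A B D W E F G Y : set X) (s t : nat -> X) (c : nat -> C).

(** Riesz's lemma with constant one half, in a form ready to bound one coefficient of a linear
    combination. *)
Lemma riesz_vector A W a : subspace A -> subspace W -> closed W -> W `<=` A -> A a -> ~ W a ->
  exists b, [/\ A b, nr b <= 1 & forall (x : C) w, W w -> nr x / 2 <= nr (x *: b - w)].
Proof.
move=> sA sW cW WA Aa nWa; have [d d0 hd] := dist_pos cW nWa.
pose E := [set nr (a - w) | w in W].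
have E0 : E !=set0 by exists (nr (a - 0)); exists 0 => //; case: sW.
have dE : lbound E d by move=> _ [w Ww <-]; exact: hd.
have hE : has_inf E by split => //; exists d.
have dl : d <= inf E by apply: lb_le_inf.
(* Taking the infimum itself as tolerance gives a point of [W] within twice the distance from
   [a]. *)
have [_ [w0 Ww0 <-] hw0] := inf_adherent (ltac:(lra) : 0 < inf E) hE.
have hw w : W w -> inf E <= nr (a - w) by move=> Ww; apply: ge_inf; [exists d | exists w].
have n0 : 0 < nr (a - w0) by have := hd _ Ww0; lra.
pose r : C := (nr (a - w0))^-1%:C%C.
have rn : nr r = (nr (a - w0))^-1 by rewrite nr_real ger0_norm // invr_ge0 ltW.
exists (r *: (a - w0)); split.
- by apply: subspaceZ => //; apply: subspaceB => //; apply: WA.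
- by rewrite nrZ rn mulVf // gt_eqF.
move=> x w Ww; have [->|x0] := eqVneq x 0; first by rewrite nr0 mul0r nr_ge0.
have xr0 : x * r != 0.
  by rewrite mulf_neq0 //; apply/eqP => h; move: rn; rewrite h nr0; have := invr_gt0 (nr (a - w0)); lra.
have -> : x *: (r *: (a - w0)) - w = (x * r) *: (a - (w0 + (x * r)^-1 *: w)).
  by rewrite opprD addrA [RHS]scalerBr !scalerA mulfV // scale1r.
rewrite nrZ nrM rn -mulrA ler_wpM2l ?nr_ge0 // ler_pdivlMl //.
have /hw : W (w0 + (x * r)^-1 *: w) by apply: subspaceD => //; apply: subspaceZ.
nlra.
Qed.

(* The constant of [riesz_seq], which depends on the length [n] only: this makes
   the gap lemmas uniform. *)
Fixpoint kap n : R := if n is m.+1 then 3 * kap m + 2 else 1.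
Lemma kap_gt0 n : 0 < kap n.
Proof. by elim: n => //= n h; lra. Qed.

(** Each new vector is chosen by [riesz_vector] against [W] and the previous ones. If the norm on
    the right is [r], the last coefficient is at most [2 * r], and dropping its term leaves norm at
    most [3 * r]; this is the recursion of [kap]. *)
Lemma riesz_seq A W n t : subspace A -> subspace W -> closed W -> W `<=` A -> indep A W n t ->
  exists e : nat -> X, (forall i, (i < n)%N -> A (e i) /\ nr (e i) <= 1) /\
   forall c w, W w -> \sum_(i < n) nr (c i) <= kap n * nr (\sum_(i < n) c i *: e i - w).
Proof.
move=> sA sW cW WA [At it].
suff : forall m, (m <= n)%N -> exists e : nat -> X, (forall i, (i < m)%N -> A (e i) /\ nr (e i) <= 1) /\
   forall c w, W w -> \sum_(i < m) nr (c i) <= kap m * nr (\sum_(i < m) c i *: e i - w).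
  by move=> h; apply: h (leqnn n).
elim=> [_|m IH mn].
  exists (fun=> 0); split=> // c w _; rewrite big_ord0 mulr_ge0 ?nr_ge0 //.
have [|e [he ke]] := IH; first exact: ltnW.
(* Otherwise [n] independent vectors would lie in a space of dimension at most [m < n] modulo
   [W]. *)
have [i [im nV]] : exists i, (i < n)%N /\ ~ spn W m e (t i).
  apply: contrapT => h.
  have : indep (spn W m e) W n t.
    split=> // i im; apply: contrapT => hh; apply: h; by exists i.
  move=> hi; have /(indep_le sW hi) : dimle (spn W m e) W m by exists e.
  lia.
have VA : spn W m e `<=` A.
  move=> x [c /WA hx]; rewrite -(subrK (\sum_(i < m) c i *: e i) x); apply: subspaceD => //.
  by apply: subspace_sum => // j; apply: subspaceZ => //; have [] := he j (ltn_ord j).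
have [b [Ab b1 hb]] := riesz_vector sA (@spn_subspace _ _ W m e sW) (@spn_closed _ _ W m e sW cW) VA (At _ im) nV.
exists (fun i => if i == m then b else e i); split=> [j|c w Ww].
  by rewrite ltnS leq_eqVlt; case: eqP => //= _ /he.
rewrite !big_ord_recr /= eqxx sum_ifs.
have h1 := ke c w Ww.
have h2 := hb (c m) (w - \sum_(i < m) c i *: e i).
have h3 : spn W m e (w - \sum_(i < m) c i *: e i).
  exists (fun i => - c i); under [X in W (_ - X)]eq_bigr do rewrite scaleNr.
  by rewrite sumrN opprK subrK.
move: {h2} (h2 h3).
have -> : c m *: b - (w - \sum_(i < m) c i *: e i) = \sum_(i < m) c i *: e i + c m *: b - w by lmod.
have h4 := nrB (\sum_(i < m) c i *: e i + c m *: b - w) (c m *: b).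
have h5 : \sum_(i < m) c i *: e i + c m *: b - w - c m *: b = \sum_(i < m) c i *: e i - w by lmod.
rewrite h5 [nr (c m *: b)]nrZ in h4 => h6.
have h7 := ler_wpM2l (nr_ge0 (c m)) b1.
have h8 : nr (\sum_(i < m) c i *: e i - w) <= 3 * nr (\sum_(i < m) c i *: e i + c m *: b - w) by nlra.
have h9 := ler_wpM2l (ltW (kap_gt0 m)) h8.
nlra.
Qed.

(* No topological comparison of the subspaces is needed: [m.+1] nearly
   orthogonal vectors of [E] would be close to dependent vectors of [F]. *)
Lemma gap_dim E F n (eta : R) : subspace E -> dimle F [set 0] n -> 0 <= eta ->
  eta * kap n.+1 < 1 ->
  (forall x, E x -> exists2 f, F f & nr (x - f) <= eta * nr x) -> dimle E [set 0] n.
Proof.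
move=> sE hF eta0 hk hE; have s0 := @subspace0 R X.
case: (dim_dich E n.+1 s0) => [[m mn /rdim_dimle]|[t it]]; first exact: dimle_widen.
have c0 : closed [set 0 : X].
  by apply/closedP => x hx; apply: nr_eq0; apply/eqP; rewrite eq_le nr_ge0 andbT leNgt;
    apply/negP => /hx [a /= ->]; rewrite subr0 ltxx.
have E0 : [set 0] `<=` E by move=> x ->; case: sE.
have [e [he ke]] := riesz_seq sE s0 c0 E0 it.
have step (i : nat) : exists f, (i < n.+1)%N -> F f /\ nr (e i - f) <= eta.
  have [hi|hi] := ltnP i n.+1; last by exists 0.
  have [Ei ei1] := he i hi; have [f Ff hf] := hE _ Ei; exists f => _; split => //.
  by apply: (le_trans hf); rewrite ler_piMr.
have [f hf] := choice step.
suff : indep F [set 0] n.+1 f by move=> hi; have := indep_le s0 hi hF; rewrite ltnn.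
split=> [i /hf[]//|c /= hc].
have S0 : \sum_(i < n.+1) nr (c i) = 0.
  apply/eqP; rewrite eq_le sumr_ge0 ?andbT => [|i _]; last exact: nr_ge0.
  have := ke c 0 erefl; rewrite subr0.
  have -> : \sum_(i < n.+1) c i *: e i = \sum_(i < n.+1) c i *: (e i - f i).
    by under [RHS]eq_bigr do rewrite scalerBr; rewrite sumrB hc subr0.
  set S := \sum_(i < n.+1) nr (c i).
  have : nr (\sum_(i < n.+1) c i *: (e i - f i)) <= eta * S.
    apply: (le_trans (nr_sum _)); rewrite /S mulr_sumr; apply: ler_sum => i _.
    by rewrite nrZ mulrC ler_wpM2r ?nr_ge0 //; have [] := hf i (ltn_ord i).
  have S0 : 0 <= S by apply: sumr_ge0 => i _; exact: nr_ge0.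
  have := kap_gt0 n.+1; move: hk; nr_abs; move: (kap n.+1) => k hk k0 h1 h2.
  have : k * nra <= k * (eta * S) by rewrite ler_pM2l.
  nra.
move=> i ni; apply: nr_eq0; apply/eqP.
have /eqP := S0; rewrite psumr_eq0 => [|j _]; last exact: nr_ge0.
by move=> /allP/(_ (Ordinal ni)); rewrite mem_index_enum => /(_ isT).
Qed.

(** Counterpart of [gap_dim] for quotients: a relation modulo [G] among [n.+1] vectors nearly
    orthogonal modulo [Q] is a vector of [G], hence close to [Q], and this forces its coefficients
    to vanish. *)
Lemma gap_codim Y Q G n (eta : R) : subspace Y -> subspace Q -> closed Q -> Q `<=` Y -> subspace G ->
  dimle Y G n -> 0 <= eta -> eta * kap n.+1 < 1 ->
  (forall g, G g -> exists2 r, Q r & nr (g - r) <= eta * nr g) -> dimle Y Q n.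
Proof.
move=> sY sQ cQ QY sG hY eta0 hk hG.
case: (dim_dich Y n.+1 sQ) => [[m mn /rdim_dimle]|[t it]]; first exact: dimle_widen.
have [e [he ke]] := riesz_seq sY sQ cQ QY it.
suff : indep Y G n.+1 e by move=> hi; have := indep_le sG hi hY; rewrite ltnn.
split=> [i /he[]//|c /= hc].
have S0 : \sum_(i < n.+1) nr (c i) = 0.
  apply/eqP; rewrite eq_le sumr_ge0 ?andbT => [|i _]; last exact: nr_ge0.
  have [r Qr hr] := hG _ hc; have := ke c r Qr; move: hr.
  set S := \sum_(i < n.+1) nr (c i).
  have : nr (\sum_(i < n.+1) c i *: e i) <= S.
    apply: (le_trans (nr_sum _)); apply: ler_sum => i _.
    by rewrite nrZ ler_piMr ?nr_ge0 //; have [] := he i (ltn_ord i).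
  have S0 : 0 <= S by apply: sumr_ge0 => i _; exact: nr_ge0.
  have := kap_gt0 n.+1; move: hk; nr_abs; move: (kap n.+1) => k hk k0 h1 h2 h3.
  have : k * nra0 <= k * (eta * S) by rewrite ler_pM2l //; nra.
  nra.
move=> i ni; apply: nr_eq0; apply/eqP.
have /eqP := S0; rewrite psumr_eq0 => [|j _]; last exact: nr_ge0.
by move=> /allP/(_ (Ordinal ni)); rewrite mem_index_enum => /(_ isT).
Qed.
End Gap.

(** * Separation of a point from a closed subspace *)

Section Separation.
Context {R : realType} {X : completeNormedModType R[i]}.
Local Notation C := R[i].
Ltac lmod := lmod_gen (R[i] : comNzRingType) (X : lmodType R[i]).
Implicit Types (A B W : set X).

(* The hyperplane is maximal among the real subspaces containing [W] at distance
   at least [d] from [u]. *)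
Lemma real_hyperplane W u (d : R) : subspace W -> 0 < d -> (forall w, W w -> d <= nr (u - w)) ->
  exists A : set X, [/\ W `<=` A,
    forall (r : R) x y, A x -> A y -> A (r%:C%C *: x + y),
    forall (r : R) h, A h -> `|r| * d <= nr (r%:C%C *: u - h) &
    forall v, exists r : R, A (v - r%:C%C *: u)].
Proof.
move=> sW d0 hd.
pose P A := [/\ forall (r : R) x y, A x -> A y -> A (r%:C%C *: x + y),
   forall h, A h -> d <= nr (u - h) & forall h w, A h -> W w -> A (h + w)].
have [|A [PA maxA]] := @Zorn_bigcup X P.
  move=> F FP Ft; split.
  - move=> r x y [A FA Ax] [B FB By]; have [AB|BA] := Ft A B FA FB.
      by exists B => //; have [h _ _] := FP _ FB; apply: h => //; apply: AB.
    by exists A => //; have [h _ _] := FP _ FA; apply: h => //; apply: BA.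
  - by move=> h [A FA Ah]; have [_ hA _] := FP _ FA; apply: hA.
  by move=> h w [A FA Ah] Ww; exists A => //; have [_ _ hA] := FP _ FA; apply: hA.
have [lA dA WA] := PA.
have PW : P W.
  split=> // [r x y Wx Wy|h w Wh Ww]; last exact: subspaceD.
  by apply: subspaceD => //; apply: subspaceZ.
(* The empty set satisfies [P] vacuously, so the maximal set is compared with [W] to see that it is
   inhabited. *)
have [h0 Ah0] : A !=set0.
  apply/set0P/negP => /eqP A0; apply: (maxA W) => //; rewrite A0; split; first exact: sub0set.
  by move=> /(_ 0); apply; case: sW.
have A0 : A 0.
  have := lA (-1) h0 h0 Ah0 Ah0; congr (A _).
  by rewrite rmorphN1; lmod.
have WsA : W `<=` A by move=> w Ww; rewrite -[w]add0r; apply: WA.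
have sc (r : R) x : A x -> A (r%:C%C *: x) by move=> Ax; rewrite -[_ *: _]addr0; apply: lA.
have dA' (r : R) h : A h -> `|r| * d <= nr (r%:C%C *: u - h).
  move=> Ah; have [->|r0] := eqVneq r 0; first by rewrite normr0 mul0r nr_ge0.
  have rc0 : r%:C%C != 0 :> C by apply/eqP => /(complexI (R:=R)) h'; rewrite h' eqxx in r0.
  have -> : r%:C%C *: u - h = r%:C%C *: (u - r^-1%:C%C *: h).
    by rewrite scalerBr scalerA -rmorphM mulfV // scale1r.
  by rewrite nrZ nr_real ler_wpM2l // dA //; apply: sc.
exists A; split => // v; apply: contrapT => hv.
(* To add [v - r u] to [A], the number [r * d] must lie above every [- nr (s u + h + v) - s * d] and
   below every [nr (s u + h + v) - s * d]. By [Eb] the supremum of the former values does. *)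
pose E := [set z : R | exists s h, A h /\ z = - nr (s%:C%C *: u + h + v) - s * d].
have Eb s h : A h -> ubound E (nr (s%:C%C *: u + h + v) - s * d).
  move=> Ah _ [s' [h' [Ah' ->]]].
  have /(dA' (s - s')) : A (h' - h).
    by have := lA (-1) h h' Ah Ah'; rewrite rmorphN1; congr (A _); lmod.
  have -> : (s - s')%:C%C *: u - (h' - h) = (s%:C%C *: u + h + v) - (s'%:C%C *: u + h' + v).
    by rewrite rmorphB; lmod.
  have := nrB (s%:C%C *: u + h + v) (s'%:C%C *: u + h' + v).
  have := ler_wpM2r (ltW d0) (ler_norm (s - s')); rewrite mulrBl.
  nlra.
have hE : has_sup E.
  split; last by exists (nr (0%:C%C *: u + 0 + v) - 0 * d); apply: Eb.
  by exists (- nr (0%:C%C *: u + 0 + v) - 0 * d); exists 0, 0.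
pose r := sup E / d.
have rd : r * d = sup E by rewrite divfK // gt_eqF.
have hr s h : A h -> `|s + r| * d <= nr (s%:C%C *: u + h + v).
  move=> Ah.
  have h1 : r * d <= nr (s%:C%C *: u + h + v) - s * d.
    by rewrite rd; apply: sup_le_ub (Eb _ _ Ah); case: hE.
  have h2 : - nr (s%:C%C *: u + h + v) - s * d <= r * d.
    by rewrite rd; apply: sup_upper_bound => //; exists s, h.
  have -> : `|s + r| * d = `|(s + r) * d| by rewrite normrM (gtr0_norm d0).
  by rewrite ler_norml mulrDl; apply/andP; split; lra.
(* The real span of [A] and [v - r u] would be strictly larger than [A] and still at distance at
   least [d] from [u]. *)
pose B := [set x | exists t : R, A (x - t%:C%C *: (v - r%:C%C *: u))].
apply: (maxA B); split.
- by move=> x Ax; exists 0; rewrite scale0r subr0.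
- by move=> BA; apply: hv; exists r; apply: BA; exists 1; rewrite rmorph1 scale1r subrr.
- move=> a x y [t ht] [t' ht']; exists (a * t + t').
  have := lA a _ _ ht ht'; congr (A _).
  by rewrite rmorphD rmorphM /=; lmod.
- move=> h [t ht]; have [t0|t0] := eqVneq t 0.
    by move: ht; rewrite t0 scale0r subr0; apply: dA.
  have tc0 : t%:C%C != 0 :> C by apply/eqP => /(complexI (R:=R)) h'; rewrite h' eqxx in t0.
  have := hr (- (t^-1 + r)) _ (sc t^-1 _ ht).
  rewrite opprD subrK normrN normrV ?unitfE // mulrC ler_pdivrMr ?normr_gt0 // mulrC.
  rewrite -(nr_real t) -nrZ -(nrN (_ *: _)); congr (_ <= nr _).
  by rewrite rmorphB rmorphN fmorphV /=; lmod; field.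
- by move=> h w [t ht] Ww; exists t; have := WA _ _ ht Ww; congr (A _); lmod.
Qed.

(* Complexification: [f x = g x - i g (i x)] for the real functional [g] defined
   by the hyperplane. *)
Lemma separation W u : subspace W -> closed W -> ~ W u ->
  exists f : X -> C, [/\ forall a x y, f (a *: x + y) = a * f x + f y,
    exists K : R, forall x, nr (f x) <= K * nr x, forall w, W w -> f w = 0 & f u = 1].
Proof.
move=> sW cW nWu; have [d d0 hd] := dist_pos cW nWu.
have [A [WA lA dA hA]] := real_hyperplane sW d0 hd.
have [g hg] := choice hA.
have A0 : A 0 by apply: WA; case: sW.
have uniq r v : A (v - r%:C%C *: u) -> r = g v.
  move=> hr; apply/eqP; rewrite -subr_eq0 -normr_eq0 eq_le normr_ge0 andbT.
  have : A ((v - (g v)%:C%C *: u) - (v - r%:C%C *: u)).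
    have := lA (-1) _ _ hr (hg v); rewrite rmorphN1; congr (A _); lmod.
  have -> : (v - (g v)%:C%C *: u) - (v - r%:C%C *: u) = (r - g v)%:C%C *: u.
    by rewrite rmorphB; lmod.
  by move=> /(dA (r - g v)); rewrite subrr nr0 pmulr_lle0.
have gl (r : R) x y : g (r%:C%C *: x + y) = r * g x + g y.
  apply/esym/uniq; have := lA r _ _ (hg x) (hg y); congr (A _).
  by rewrite rmorphD rmorphM /=; lmod.
have gb v : `|g v| * d <= nr v.
  have Ah : A (- (v - (g v)%:C%C *: u)).
    by have := lA (-1) _ _ (hg v) A0; rewrite rmorphN1; congr (A _); lmod.
  have := dA (g v) _ Ah; congr (_ <= nr _); lmod.
have gW w : W w -> g w = 0.
  by move=> Ww; apply/esym/uniq; rewrite scale0r subr0; apply: WA.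
have gu : g u = 1.
  by apply/esym/uniq; rewrite scale1r subrr.
have g0 : g 0 = 0 by apply: gW; case: sW.
have gD x y : g (x + y) = g x + g y by have := gl 1 x y; rewrite mul1r scale1r.
have gZ (r : R) x : g (r%:C%C *: x) = r * g x.
  by have := gl r x 0; rewrite !addr0 g0 addr0.
pose f x : C := (g x)%:C%C - 'i%C * (g ('i%C *: x))%:C%C.
have fl a x y : f (a *: x + y) = a * f x + f y.
  have ea : a = (complex.Re a)%:C%C + 'i%C * (complex.Im a)%:C%C by case: a => p q; rewrite -complexE.
  move: (complex.Re a) (complex.Im a) ea => p q ->.
  have i2 : 'i%C * 'i%C = -1 :> C by rewrite -expr2 sqr_i.
  have e1 : g ((p%:C%C + 'i%C * q%:C%C) *: x + y) = p * g x + q * g ('i%C *: x) + g y.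
    rewrite gD scalerDl gD gZ -scalerA; congr (_ + _ + _).
    by rewrite -gZ !scalerA mulrC.
  have e2 : g ('i%C *: ((p%:C%C + 'i%C * q%:C%C) *: x + y)) = p * g ('i%C *: x) - q * g x + g ('i%C *: y).
    have -> : 'i%C *: ((p%:C%C + 'i%C * q%:C%C) *: x + y) =
        p%:C%C *: ('i%C *: x) + (- q)%:C%C *: x + 'i%C *: y.
      rewrite rmorphN scalerDr !scalerA -scalerDl; congr (_ *: x + _).
      by rewrite mulrDr mulrA i2 mulN1r mulrC.
    by rewrite !gD !gZ mulNr.
  rewrite /f e1 e2 !rmorphD rmorphN !rmorphM /=.
  move: i2; set I : C := 'i%C => i2.
  transitivity (p%:C%C * (g x)%:C%C + q%:C%C * (g (I *: x))%:C%C + (g y)%:C%C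
    - I * (p%:C%C * (g (I *: x))%:C%C - q%:C%C * (g x)%:C%C + (g (I *: y))%:C%C)) => //.
  have -> : q%:C%C * (g (I *: x))%:C%C = - (I * I) * (q%:C%C * (g (I *: x))%:C%C) by rewrite i2 opprK mul1r.
  ring.
have fW w : W w -> f w = 0.
  move=> Ww; rewrite /f !gW //; first by rewrite mulr0 subr0.
  exact: subspaceZ.
have fu0 : f u != 0.
  rewrite /f gu; apply/eqP => h.
  have : complex.Re (1%:C%C - 'i%C * (g ('i%C *: u))%:C%C) = 0 by rewrite h.
  rewrite /= !mul0r !mulr0 /=; lra.
exists (fun x => (f u)^-1 * f x); split.
- by move=> a x y /=; rewrite fl; ring.
- exists (nr (f u)^-1 * (2 / d)) => x; rewrite nrM -mulrA ler_wpM2l ?nr_ge0 //.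
  apply: (le_trans (nrB _ _)); rewrite nrM !nr_real.
  have ni : nr ('i%C : C) = 1.
    by apply: (complexI (R:=R)); rewrite -nrE normc_def /= expr0n /= add0r expr1n sqrtr1.
  have := gb x; have := gb ('i%C *: x); rewrite nrZ ni !mul1r.
  rewrite -!ler_pdivlMr // => h1 h2; have := lerD h2 h1; congr (_ <= _); ring.
- move=> w Ww; by rewrite (fW w Ww) mulr0.
by rewrite mulVf.
Qed.
End Separation.

(** * Stability of Kato operators *)

Section Kato.
Context {R : realType} {X : completeNormedModType R[i]}.
Local Notation C := R[i].
Ltac lmod := lmod_gen (R[i] : comNzRingType) (X : lmodType R[i]).
Implicit Types (Y V W : set X) (S U : X -> X) (l mu nu : C).

Definition blin S := lin S /\ bnd S.
Definition inv_on Y S := forall x, Y x -> Y (S x).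

Lemma blin_shift S l : blin S -> blin (shift S l).
Proof.
move=> [lS /bndP[K K0 hK]]; split; first by move=> a x y; rewrite /shift lS; lmod.
exists (K + nr l) => x; apply: (le_trans (nrB _ _)); rewrite mulrDl lerD //.
by rewrite nrZ.
Qed.

Lemma blin_iter S n : blin S -> blin (iter n S).
Proof.
move=> [lS /bndP[K K0 hK]]; elim: n => [|n [lI /bndP[K' K'0 hK']]].
  by split=> [a x y //|]; exists 1 => x; rewrite mul1r.
split=> [a x y|]; first by rewrite !iterS lI lS.
exists (K * K') => x; rewrite iterS -mulrA; apply: (le_trans (hK _)).
by rewrite ler_wpM2l // ltW.
Qed.

Lemma iter_inv Y S n : inv_on Y S -> inv_on Y (iter n S).
Proof. by move=> h; elim: n => //= n IH x /IH/h. Qed.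

Lemma shift_inv Y S l : subspace Y -> inv_on Y S -> inv_on Y (shift S l).
Proof. by move=> sY h x Yx; apply: subspaceB => //; [apply: h|apply: subspaceZ]. Qed.

Lemma shift_shift S l mu : shift (shift S l) mu = shift S (l + mu).
Proof. by apply/funext => x; rewrite /shift; lmod. Qed.

Lemma shift0 S : shift S 0 = S.
Proof. by apply/funext => x; rewrite /shift scale0r subr0. Qed.

Lemma rng_iterS Y S n : rng_on Y (iter n.+1 S) = rng_on (rng_on Y (iter n S)) S.
Proof.
apply/seteqP; split => x /=; first by move=> [y Yy <-]; exists (iter n S y) => //; exists y.
by move=> [_ [y Yy <-] <-]; exists y.
Qed.

Lemma rng_iter0 Y S : rng_on Y (iter 0 S) = Y.
Proof. by apply/seteqP; split => x; [move=> [y Yy <-]|exists x]. Qed.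

Lemma rng_subspace Y S : subspace Y -> blin S -> subspace (rng_on Y S).
Proof.
move=> sY [lS _]; split; first by exists 0; [case: sY|rewrite lin0].
move=> a _ _ [x Yx <-] [y Yy <-]; exists (a *: x + y); last by rewrite lS.
by case: sY => _; apply.
Qed.

Lemma ker_subspace Y S : subspace Y -> blin S -> subspace (ker_on Y S).
Proof.
move=> sY [lS _]; split; first by split; [case: sY|rewrite lin0].
move=> a x y [Yx Sx] [Yy Sy]; split; first by case: sY => _; apply.
by rewrite lS Sx Sy scaler0 addr0.
Qed.

Lemma rng_inv Y S : inv_on Y S -> rng_on Y S `<=` Y.
Proof. by move=> h _ [x Yx <-]; apply: h. Qed.

(** For linear [S] on a subspace this bounds the distance from [x] to the kernel by [c] times the
    norm of [S x]: a lower bound modulo the kernel, without quotient spaces. *)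
Definition lifts Y S (c : R) := forall x, Y x -> exists z, [/\ Y z, S z = S x & nr z <= c * nr (S x)].

Lemma closed_rng_lifts Y S : closed_subspace Y -> blin S -> closed (rng_on Y S) ->
  exists2 c : R, 0 < c & lifts Y S c.
Proof.
by move=> [sY cY] [lS bS] cR; apply: open_mapping => //; apply: closed_complete.
Qed.

(** A point [y] of the closure is within half its norm of a value of [S]. That value has norm at
    most [2 * nr y], and a bounded lift of it is a first step of the successive approximation. *)
Lemma lifts_closed_rng Y S (c : R) : closed_subspace Y -> blin S -> 0 <= c -> lifts Y S c ->
  closed (rng_on Y S).
Proof.
move=> [sY cY] [lS bS] c0 hc; apply/closedP.
pose U := [set y | forall e : R, 0 < e -> exists2 a, rng_on Y S a & nr (y - a) < e].
have th : 0 <= (2^-1 : R) < 1 by apply/andP; split; lra.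
have hs : forall y, U y -> exists x,
    [/\ Y x, nr x <= (2 * c) * nr y, U (y - S x) & nr (y - S x) <= 2^-1 * nr y].
  move=> y Uy; have [->|y0] := eqVneq y 0.
    exists 0; rewrite !(lin0 lS) !nr0 subr0 nr0 !mulr0; split => //; first by case: sY.
    by move=> e e0; exists 0; [exists 0; [case: sY|rewrite (lin0 lS)]|rewrite subrr nr0].
  have n0 := nr_gt0 y0.
  have [|_ [x Yx <-] hx] := Uy (nr y / 2); first by rewrite divr_gt0.
  have [z [Yz Sz nz]] := hc x Yx; exists z; rewrite Sz; split => //; last by nlra.
    apply: (le_trans nz).
    have : nr (S x) <= 2 * nr y by have := nrT y (S x) 0; rewrite !subr0 (nrC (S x)); nlra.
    by rewrite [2 * c]mulrC -mulrA; apply: ler_wpM2l.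
  move=> e e0; have [_ [x' Yx' <-] hx'] := Uy e e0.
  exists (S (x' - x)); first by exists (x' - x) => //; apply: subspaceB.
  by move: hx'; congr (nr _ < _); rewrite (linB lS); lmod.
have hx := approx lS bS sY (closed_complete cY) (ltac:(lra) : 0 <= 2 * c) th hs.
by move=> y /hx [x [Yx <- _]]; exists x.
Qed.

(** A bounded lift in [Y] of a value taken on [V] differs from a point of [V] by a kernel vector,
    hence lies in [V] already. *)
Lemma closed_img Y V S : closed_subspace Y -> closed_subspace V -> V `<=` Y -> blin S ->
  ker_on Y S `<=` V -> closed (rng_on Y S) -> closed (rng_on V S).
Proof.
move=> cY cV VY bS kV cR; have [c c0 hc] := closed_rng_lifts cY bS cR.
apply: (lifts_closed_rng cV bS (ltW c0)) => x Vx.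
have [z [Yz Sz nz]] := hc x (VY _ Vx); exists z; split => //.
have Vxz : V (x - z).
  apply: kV; split; first by apply: subspaceB (VY _ Vx) Yz; case: cY.
  by rewrite (linB (proj1 bS)) Sz subrr.
rewrite -(subKr x z); apply: subspaceB => //; by case: cV.
Qed.

(** The hyperrange of [S] on [Y]. *)
Definition Yinf Y S : set X := [set x | forall n, rng_on Y (iter n S) x].

Section OneKato.
Variables (Y : set X) (S : X -> X).
Hypotheses (cY : closed_subspace Y) (iY : inv_on Y S) (bS : blin S) (kS : Kato_on Y S).

Lemma rng_iter_sub n : rng_on Y (iter n S) `<=` Y.
Proof. by apply: rng_inv; apply: iter_inv. Qed.

(** [closed_img] applies at every stage, since the kernel lies in the range of each iterate. *)
Lemma Kato_iter_closed n : closed_subspace (rng_on Y (iter n S)).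
Proof.
elim: n => [|n IH]; first by rewrite rng_iter0.
split; first by apply: rng_subspace; [case: cY|apply: blin_iter].
rewrite rng_iterS; apply: (closed_img cY IH) => //; first exact: rng_iter_sub.
  by case: kS => _; apply.
by case: kS.
Qed.

Lemma Yinf_sub : Yinf Y S `<=` Y.
Proof. by move=> x /(_ 0%N); rewrite rng_iter0. Qed.

Lemma Yinf_csub : closed_subspace (Yinf Y S).
Proof.
split; first split.
- by move=> n; have [[]] := Kato_iter_closed n.
- by move=> a x y hx hy n; have [[_ h]] := Kato_iter_closed n; move=> _; apply: h.
apply/closedP => x hx n; have [_ /closedP] := Kato_iter_closed n; apply => e e0.
by have [a ha hxa] := hx e e0; exists a.
Qed.

Lemma Yinf_inv : inv_on (Yinf Y S) S.
Proof.
by move=> x hx n; have [y Yy <-] := hx n; exists (S y); [apply: iY|rewrite -iterSr iterS].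
Qed.

Lemma Yinf_ker : ker_on Y S `<=` Yinf Y S.
Proof. by move=> x hx n; case: kS => _; apply. Qed.

(** One preimage serves for all [n]: it differs from [S ^ n z], where [S ^ n.+1 z = y], by a kernel
    vector, and these lie in the hyperrange. *)
Lemma Yinf_surj y : Yinf Y S y -> exists2 x, Yinf Y S x & S x = y.
Proof.
move=> hy; have [x Yx Sx] := hy 1%N; exists x => // n.
have [z Yz Sz] := hy n.+1.
have h : ker_on Y S (x - iter n S z).
  split; first by apply: subspaceB => //; [case: cY|apply: iter_inv].
  by rewrite (linB (proj1 bS)) [S x]Sx -iterS Sz subrr.
rewrite -(subrK (iter n S z) x); apply: subspaceD; first by have [] := Kato_iter_closed n.
  exact: Yinf_ker.
by exists z.
Qed.

Lemma Yinf_ker_iter q : ker_on Y (iter q S) `<=` Yinf Y S.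
Proof.
elim: q => [|q IH] x [Yx hx].
  by move: hx => /= ->; case: (Yinf_csub) => [[]].
have /Yinf_surj [z hz Sz] : Yinf Y S (S x) by apply: IH; split; [exact: iY|rewrite -iterSr iterS].
rewrite -(subrK z x); apply: (subspaceD (proj1 Yinf_csub)) => //.
apply: Yinf_ker; split; last by rewrite (linB (proj1 bS)) Sz subrr.
by apply: subspaceB => //; [case: cY|apply: Yinf_sub].
Qed.

(* A point of [Yinf] at distance [t] from [x] is improved to one at distance
   [c |(S - mu) x| + t / 2]. *)
Lemma Yinf_near : exists2 c : R, 0 < c & forall mu, nr mu * c <= 2^-1 -> forall x, Y x ->
  exists2 z, Yinf Y S z & nr (x - z) <= c * nr (shift S mu x).
Proof.
have [c c0 hc] := closed_rng_lifts cY bS (proj1 kS).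
exists (3 * c); first lra.
move=> mu hmu x Yx; set y := shift S mu x.
have Sx : S x = y + mu *: x by rewrite /y /shift subrK.
have key n : exists2 z, Yinf Y S z & nr (x - z) <= 2 * c * nr y + nr x * 2^-1 ^+ n.
  elim: n => [|n [z hz nz]].
    exists 0; first by case: Yinf_csub => [[]].
    by rewrite subr0 expr0 mulr1 lerDr !mulr_ge0 ?nr_ge0 // ltW.
  (* For [w] a bounded lift of [S (x - z')], the point [x - w] is [z'] up to a kernel vector, so it
     is again in the hyperrange; the factor [nr mu * c] at least halves the previous error. *)
  have [z' hz' Sz'] : exists2 z', Yinf Y S z' & S z' = mu *: z.
    by apply: Yinf_surj; apply: (subspaceZ (proj1 Yinf_csub)).
  have Yxz : Y (x - z') by apply: subspaceB => //; [case: cY|apply: Yinf_sub].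
  have [w [Yw Sw nw]] := hc _ Yxz.
  exists (x - w).
    have -> : x - w = (x - z' - w) + z' by lmod.
    apply: (subspaceD (proj1 Yinf_csub)) => //.
    apply: Yinf_ker; split; last by rewrite (linB (proj1 bS)) Sw subrr.
    by apply: subspaceB => //; case: cY.
  rewrite subKr; apply: (le_trans nw).
  have -> : S (x - z') = y + mu *: (x - z) by rewrite (linB (proj1 bS)) Sx Sz'; lmod.
  have h1 := nrD y (mu *: (x - z)); rewrite nrZ in h1.
  have h2 : c * nr (y + mu *: (x - z)) <= c * (nr y + nr mu * nr (x - z)) by apply: ler_wpM2l => //; exact: ltW.
  have h3 : nr mu * c * nr (x - z) <= 2^-1 * nr (x - z).
    by apply: ler_wpM2r; rewrite ?nr_ge0 //; have := nr_ge0 mu; nra.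
  by rewrite exprS; nlra.
(* If [y] is zero the errors tend to zero and closedness puts [x] itself in the hyperrange;
   otherwise the iteration stops once the remainder is below [c * nr y], which accounts for the
   constant [3 * c]. *)
have [y0|y0] := eqVneq y 0.
  exists x; last by rewrite subrr nr0 y0 nr0 mulr0.
  have [_ /closedP] := Yinf_csub; apply => e e0.
  have [||N hN] := @geo_small R (2^-1) _ _ (nr x) e (nr_ge0 x) e0; [lra|lra|].
  have [z hz nz] := key N; exists z => //; apply: (le_lt_trans nz).
  by rewrite y0 nr0 mulr0 add0r; apply: hN.
have cy : 0 < c * nr y by rewrite mulr_gt0 // nr_gt0.
have [||N hN] := @geo_small R (2^-1) _ _ (nr x) _ (nr_ge0 x) cy; [lra|lra|].
have [z hz nz] := key N; exists z => //.
by have := hN N (leqnn N); nlra.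
Qed.

(** Perturbation of a surjection: a bounded [S]-preimage [x] of [y] leaves the residual [mu *: x],
    of norm at most half that of [y]. *)
Lemma Yinf_shift_surj : exists2 c : R, 0 < c & forall mu, nr mu * c <= 2^-1 -> forall y, Yinf Y S y ->
  exists x, [/\ Yinf Y S x, shift S mu x = y & nr x <= 2 * c * nr y].
Proof.
have rY : rng_on (Yinf Y S) S = Yinf Y S.
  apply/seteqP; split; first exact: rng_inv Yinf_inv.
  by move=> y /Yinf_surj [x hx <-]; exists x.
have [|c c0 hc] := closed_rng_lifts Yinf_csub bS; first by rewrite rY; case: Yinf_csub.
exists c => // mu hmu.
have [lU bU] := blin_shift mu bS.
have th : 0 <= (2^-1 : R) < 1 by apply/andP; split; lra.
have [sI cI] := Yinf_csub.
have hs : forall y, Yinf Y S y -> exists x,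
    [/\ Yinf Y S x, nr x <= c * nr y, Yinf Y S (y - shift S mu x) & nr (y - shift S mu x) <= 2^-1 * nr y].
  move=> y /Yinf_surj [x' hx' Sx']; have [x [hx Sx nx]] := hc x' hx'; rewrite Sx' in Sx nx.
  have e : y - shift S mu x = mu *: x by rewrite /shift Sx; lmod.
  exists x; rewrite e; split => //; first exact: (subspaceZ sI).
  rewrite nrZ; apply: (@le_trans _ _ (nr mu * (c * nr y))); first by rewrite ler_wpM2l ?nr_ge0.
  by rewrite mulrA ler_wpM2r ?nr_ge0.
move=> y /(approx lU bU sI (closed_complete cI) (ltW c0) th hs) [x [hx Sx nx]].
exists x; split => //; apply: (le_trans nx); rewrite le_eqVlt; apply/orP; left; apply/eqP.
by congr (_ * _); field.
Qed.

(** A point [x] is split as [(x - xi) + xi] with [xi] in the hyperrange. [Yinf_near] bounds the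
    first term, and the second is replaced by a bounded preimage of the same value inside the
    hyperrange. That [c] does not depend on [mu] is what the comparison of nearby points rests
    on. *)
Lemma Kato_lifts : exists2 e : R, 0 < e & exists2 c : R, 0 < c & forall mu, nr mu < e ->
  Kato_on Y (shift S mu) /\ lifts Y (shift S mu) c.
Proof.
have [c1 c10 h1] := Yinf_near; have [c2 c20 h2] := Yinf_shift_surj.
have [lS /bndP[K K0 hK]] := bS.
pose e : R := Num.min 1 (Num.min (2^-1 / c1) (2^-1 / c2)).
have e0 : 0 < e by rewrite !lt_min ltr01 !divr_gt0.
have e1 : e <= 1 by rewrite ge_min lexx.
have e2 : e <= 2^-1 / c1 by rewrite !ge_min lexx orbT.
have e3 : e <= 2^-1 / c2 by rewrite !ge_min lexx !orbT.
pose c := c1 + 2 * c2 * (1 + (K + 1) * c1).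
have c0 : 0 < c by rewrite /c; do 4!rewrite ?addr_gt0 ?mulr_gt0 //.
exists e => //; exists c => // mu mue.
have [lU bU] := blin_shift mu bS.
have m1 : nr mu * c1 <= 2^-1 by rewrite -ler_pdivlMr //; lra.
have m2 : nr mu * c2 <= 2^-1 by rewrite -ler_pdivlMr //; lra.
have hl : lifts Y (shift S mu) c.
  move=> x Yx; have [xi hxi nxi] := h1 mu m1 x Yx.
  have Yr : Y (x - xi) by apply: subspaceB => //; [case: cY|apply: Yinf_sub].
  have hU : Yinf Y S (shift S mu xi).
    exact: (shift_inv mu (proj1 Yinf_csub) Yinf_inv hxi).
  have [v [hv Uv nv]] := h2 mu m2 _ hU.
  exists ((x - xi) + v); split.
  - by apply: subspaceD => //; [case: cY|apply: Yinf_sub].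
  - by rewrite (linD lU) (linB lU) Uv subrK.
  apply: (le_trans (nrD _ _)); rewrite /c [in leRHS]mulrDl lerD //.
  apply: (le_trans nv); rewrite -[leRHS]mulrA; apply: ler_wpM2l; first lra.
  have -> : shift S mu xi = shift S mu x - shift S mu (x - xi) by rewrite (linB lU) subKr.
  apply: (le_trans (nrB _ _)); rewrite mulrDl mul1r lerD //.
  rewrite {1}/shift; apply: (le_trans (nrB _ _)); rewrite nrZ.
  have := hK (x - xi).
  have : nr mu * nr (x - xi) <= 1 * nr (x - xi) by apply: ler_wpM2r; rewrite ?nr_ge0 //; lra.
  have : (K + 1) * nr (x - xi) <= (K + 1) * (c1 * nr (shift S mu x)) by apply: ler_wpM2l => //; lra.
  by nlra.
split => //; split; first exact: (lifts_closed_rng cY (blin_shift mu bS) (ltW c0) hl).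
move=> n x [Yx Ux].
(* A kernel vector of the shifted operator is at distance zero from the hyperrange of [S], which the
   shifted operator maps onto itself; so it lies in every iterated range. *)
have hx : Yinf Y S x.
  have [z hz] := h1 mu m1 x Yx; rewrite Ux nr0 mulr0 => /nr_le0 /eqP.
  by rewrite subr_eq0 => /eqP ->.
elim: n x hx {Yx Ux} => [|n IH] x hx; first by rewrite rng_iter0; apply: Yinf_sub.
by rewrite rng_iterS; have [v [hv <- _]] := h2 mu m2 _ hx; exists v => //; apply: IH.
Qed.

(* The hypothesis is uniform on the disc, so finitely many steps along the
   segment from [mu] to [nu] suffice. *)
Lemma walk (P : C -> Prop) (e k : R) : 0 <= k ->
  (forall mu nu, nr mu < e -> nr nu < e -> nr (mu - nu) * k < 1 -> P mu -> P nu) ->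
  forall mu nu, nr mu < e -> nr nu < e -> P mu -> P nu.
Proof.
move=> k0 h mu nu hm hn Pm.
pose N := (Num.truncn (nr (mu - nu) * k)).+1.
have N0 : 0 < N%:R :> R by rewrite ltr0n.
have hN : nr (mu - nu) * k < N%:R by apply: truncnS_gt.
pose p (j : nat) : C := mu + (j%:R / N%:R : R)%:C%C * (nu - mu).
have pe j : (j <= N)%N -> nr (p j) < e.
  move=> jN; pose t : R := j%:R / N%:R.
  have t0 : 0 <= t by rewrite divr_ge0.
  have t1 : t <= 1 by rewrite ler_pdivrMr // mul1r ler_nat.
  have -> : p j = (1 - t)%:C%C * mu + t%:C%C * nu by rewrite /p -/t rmorphB rmorph1; ring.
  apply: (le_lt_trans (nrD _ _)); rewrite !nrM !nr_real !ger0_norm ?subr_ge0 //.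
  have [->|tn0] := eqVneq t 0; first lra.
  have : 0 < t by rewrite lt_neqAle eq_sym tn0.
  by nra.
have pS j : nr (p j - p j.+1) * k < 1.
  have -> : p j - p j.+1 = (N%:R^-1 : R)%:C%C * (mu - nu).
    by rewrite /p -[j.+1]addn1 natrD mulrDl rmorphD /= mul1r; ring.
  rewrite nrM nr_real ger0_norm ?invr_ge0 // -mulrA mulrC ltr_pdivrMr // mul1r.
  exact: hN.
have Pp j : (j <= N)%N -> P (p j).
  elim: j => [_|j IH jN]; first by rewrite /p mul0r mul0r addr0.
  by apply: (h (p j)); [apply: pe; lia|apply: pe|apply: pS|apply: IH; lia].
have -> : nu = p N by rewrite /p divff ?gt_eqF // rmorph1 mul1r addrC subrK.
exact: Pp.
Qed.

(** On the kernel of [shift S nu] the operator [shift S mu] is multiplication by [nu - mu], so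
    subtracting a lift moves a kernel vector into the other kernel by a relatively small amount. For
    ranges, the values of the two operators at one lift differ by the same multiple of it. The gap
    lemmas thus cover steps shorter than [1 / (c * kap n.+1)], and [walk] joins arbitrary points of
    the disc. *)
Lemma Kato_stable : exists2 e : R, 0 < e & (forall mu, nr mu < e -> Kato_on Y (shift S mu)) /\
  forall mu nu n, nr mu < e -> nr nu < e ->
   (dimle (ker_on Y (shift S mu)) [set 0] n -> dimle (ker_on Y (shift S nu)) [set 0] n) /\
   (dimle Y (rng_on Y (shift S mu)) n -> dimle Y (rng_on Y (shift S nu)) n).
Proof.
have [e e0 [c c0 h]] := Kato_lifts; exists e => //; split; first by move=> mu /h[].
move=> mu nu n hm hn; have sY := proj1 cY.
have k0 : 0 <= c * kap n.+1 :> R by rewrite mulr_ge0 // ltW ?kap_gt0.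
split.
- apply: (@walk (fun mu => dimle (ker_on Y (shift S mu)) [set 0] n) e _ k0) hm hn.
  move=> {mu nu} mu nu hm hn hmn hd.
  apply: (@gap_dim _ _ _ _ n (nr (mu - nu) * c)) hd _ _ _.
  - by apply: ker_subspace => //; apply: blin_shift.
  - by rewrite mulr_ge0 ?nr_ge0 // ltW.
  - by rewrite -mulrA.
  move=> x [Yx Ux]; have [_ /(_ x Yx)[z [Yz Uz nz]]] := h mu hm.
  have e1 : shift S mu x = (nu - mu) *: x.
    by move: Ux; rewrite /shift => /eqP; rewrite subr_eq0 => /eqP ->; lmod.
  exists (x - z); last first.
    by rewrite subKr; apply: (le_trans nz); rewrite e1 nrZ nrC mulrA [c * _]mulrC.
  split; first exact: subspaceB.
  by rewrite (linB (proj1 (blin_shift mu bS))) Uz subrr.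
apply: (@walk (fun mu => dimle Y (rng_on Y (shift S mu)) n) e _ k0) hm hn.
move=> {mu nu} mu nu hm hn hmn hd.
have bm := blin_shift mu bS; have bn := blin_shift nu bS.
apply: (@gap_codim _ _ _ _ _ n (nr (mu - nu) * c)) hd _ _ _ => //.
- exact: rng_subspace.
- by have [[]] := h nu hn.
- by apply: rng_inv; apply: shift_inv.
- exact: rng_subspace.
- by rewrite mulr_ge0 ?nr_ge0 // ltW.
- by rewrite -mulrA.
move=> _ [x Yx <-]; have [_ /(_ x Yx)[z [Yz Uz nz]]] := h mu hm.
exists (shift S nu z); first by exists z.
rewrite -Uz; have -> : shift S mu z - shift S nu z = (nu - mu) *: z by rewrite /shift; lmod.
by rewrite nrZ nrC -mulrA ler_wpM2l ?nr_ge0 // Uz.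
Qed.
End OneKato.
End Kato.

(** * Direct sums, finite dimension and codimension *)

Section DirectSum.
Context {R : realType} {X : completeNormedModType R[i]}.
Local Notation C := R[i].
Ltac lmod := lmod_gen (R[i] : comNzRingType) (X : lmodType R[i]).
Implicit Types (A B D W V Y M N Z : set X) (S U : X -> X) (s t : nat -> X).

(* No complete normed module structure is inferred on [X * X]; completeness of
   the closed subsets of it that are used is proved by hand. *)
Lemma nr_pair (p : X * X) : nr p = Num.max (nr p.1) (nr p.2).
Proof.
apply: (complexI (R:=R)); rewrite -nrE.
have -> : `|p| = Num.max `|p.1| `|p.2| by [].
by rewrite !nrE /Order.max ltcR; case: ifP.
Qed.

Lemma nr_fst (p : X * X) : nr p.1 <= nr p.
Proof. by rewrite nr_pair le_max lexx. Qed.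
Lemma nr_snd (p : X * X) : nr p.2 <= nr p.
Proof. by rewrite nr_pair le_max lexx orbT. Qed.
Lemma nr_pair_lt (p : X * X) (e : R) : nr p.1 < e -> nr p.2 < e -> nr p < e.
Proof. by rewrite nr_pair gt_max => -> ->. Qed.

(** Open mapping for [(x, y) |-> S x + y]. With [S] the identity it bounds the projections of a
    direct sum; with [B] a finite-dimensional complement of a range it leads to closedness of the
    range. *)
Lemma open_mapping2 S A B : blin S -> closed_subspace A -> closed_subspace B ->
  closed [set z | exists x y, [/\ A x, B y & z = S x + y]] ->
  exists2 c : R, 0 < c & forall x y, A x -> B y -> exists x' y',
    [/\ A x', B y', S x' + y' = S x + y, nr x' <= c * nr (S x + y) & nr y' <= c * nr (S x + y)].
Proof.
move=> [lS bS] [sA cA] [sB cB] cR.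
pose D : set (X * X) := [set p | A p.1 /\ B p.2].
pose F (p : X * X) : X := S p.1 + p.2.
have FD : F @` D = [set z | exists x y, [/\ A x, B y & z = S x + y]].
  apply/seteqP; split=> z /=; first by move=> [[x y] [Ax By] <-]; exists x, y.
  by move=> [x [y [Ax By ->]]]; exists (x, y).
have lF : lin F by move=> a [x y] [x' y']; rewrite /F /= lS; lmod.
have bF : bnd F.
  have [K K0 hK] := bndP bS; exists (K + 1) => p.
  apply: (le_trans (nrD _ _)); rewrite mulrDl mul1r lerD ?nr_snd //.
  by apply: (le_trans (hK _)); rewrite ler_wpM2l ?nr_fst // ltW.
have sD : subspace D.
  split; first by split; [case: sA|case: sB].
  by move=> a p q [h1 h2] [h3 h4]; split; [apply: (proj2 sA)|apply: (proj2 sB)].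
have cD : complete_on D.
  move=> u Du cu.
  have [x Ax ux] : exists2 x, A x & limr (fst \o u) x.
    apply: (closed_complete cA) => [n|e e0]; first by case: (Du n).
    have [k hk] := cu e e0; exists k => m n hm hn.
    by apply: le_lt_trans (hk m n hm hn); exact: (nr_fst (u m - u n)).
  have [y By uy] : exists2 y, B y & limr (snd \o u) y.
    apply: (closed_complete cB) => [n|e e0]; first by case: (Du n).
    have [k hk] := cu e e0; exists k => m n hm hn.
    by apply: le_lt_trans (hk m n hm hn); exact: (nr_snd (u m - u n)).
  exists (x, y) => // e e0; have [k hk] := ux e e0; have [k' hk'] := uy e e0.
  exists (maxn k k') => n; rewrite geq_max => /andP[/hk h1 /hk' h2].
  exact: nr_pair_lt.
have [|c c0 hc] := open_mapping lF bF sD cD; first by rewrite FD.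
exists c => // x y Ax By; have [|[x' y'] [[Ax' By'] Fz nz]] := hc (x, y); first by [].
exists x', y'; split => //.
  exact: le_trans (nr_fst (x', y')) nz.
exact: le_trans (nr_snd (x', y')) nz.
Qed.

Definition setsum A B : set X := [set x | exists a b, [/\ A a, B b & x = a + b]].
Definition dsum Y M N := [/\ M `<=` Y, N `<=` Y, M `&` N = [set 0] &
  forall x, Y x -> exists m n, [/\ M m, N n & x = m + n]].

Lemma closed_subspace0 : closed_subspace [set 0 : X].
Proof.
split; first exact: subspace0.
apply/closedP => x hx; apply: nr_eq0; apply/eqP; rewrite eq_le nr_ge0 andbT leNgt.
by apply/negP => /hx [a /= ->]; rewrite subr0 ltxx.
Qed.

Lemma setsum_subspace A B : subspace A -> subspace B -> subspace (setsum A B).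
Proof.
move=> [A0 sA] [B0 sB]; split; first by exists 0, 0; rewrite addr0.
move=> a _ _ [x [y [Ax By ->]]] [x' [y' [Ax' By' ->]]].
by exists (a *: x + x'), (a *: y + y'); split; [apply: sA|apply: sB|lmod].
Qed.

Lemma dsum_uniq Y M N m n m' n' : subspace M -> subspace N -> dsum Y M N ->
  M m -> N n -> M m' -> N n' -> m + n = m' + n' -> m = m' /\ n = n'.
Proof.
move=> sM sN [_ _ MN _] Mm Nn Mm' Nn' e.
have e2 : m - m' = n' - n.
  by have -> : m = m' + n' - n by [rewrite -e addrK]; lmod.
have : (M `&` N) (m - m') by split; [apply: subspaceB|rewrite e2; apply: subspaceB].
rewrite MN => /= /eqP; rewrite subr_eq0 => /eqP h; split=> //.
by move: e; rewrite h => /addrI.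
Qed.

Lemma dsum_uniq0 Y M N m n : subspace M -> subspace N -> dsum Y M N ->
  M m -> N n -> m + n = 0 -> m = 0 /\ n = 0.
Proof.
move=> sM sN h Mm Nn e; apply: (dsum_uniq sM sN h) => //; rewrite ?addr0 //.
  by case: sM.
by case: sN.
Qed.

Lemma dsum_bnd Y M N : closed Y -> closed_subspace M -> closed_subspace N -> subspace Y -> dsum Y M N ->
  exists2 c : R, 0 < c & forall m n, M m -> N n -> nr m <= c * nr (m + n) /\ nr n <= c * nr (m + n).
Proof.
move=> cY cM cN sY h; have [MY NY _ hY] := h.
have bi : blin (fun x : X => x) by split; [|exists 1 => x; rewrite mul1r].
have [|c c0 hc] := open_mapping2 bi cM cN.
  suff -> : [set z | exists x y, [/\ M x, N y & z = x + y]] = Y by [].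
  apply/seteqP; split=> z; last by exact: hY.
  by move=> [x [y [/MY Mx /NY Ny ->]]]; apply: subspaceD.
exists c => // m n Mm Nn; have [m' [n' [Mm' Nn' e nm nn]]] := hc m n Mm Nn.
by have [<- <-] := dsum_uniq (proj1 cM) (proj1 cN) h Mm' Nn' Mm Nn e; rewrite e.
Qed.

(** The projections being bounded, the components of a limit point are limits of the components. *)
Lemma closed_setsum Y M N A B : closed_subspace Y -> closed_subspace M -> closed_subspace N ->
  dsum Y M N -> A `<=` M -> B `<=` N -> subspace A -> subspace B -> closed A -> closed B -> closed (setsum A B).
Proof.
move=> [sY cY] cM cN h AM BN sA sB cA cB; have [c c0 hc] := dsum_bnd cY cM cN sY h.
have [MY NY _ hY] := h; have [sM _] := cM; have [sN _] := cN.
apply/closedP => x hx.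
have Yx : Y x.
  apply: (iffLR (closedP Y) cY) => e e0; have [_ [a [b [Aa Bb ->]]] hab] := hx e e0.
  by exists (a + b) => //; apply: subspaceD => //; [exact/MY/AM|exact/NY/BN].
have [m [n [Mm Nn e]]] := hY x Yx; exists m, n; split => //.
  apply: (iffLR (closedP A) cA) => d d0.
  have [|_ [a [b [Aa Bb ->]]] hab] := hx (d / c); first by rewrite divr_gt0.
  exists a => //; have [h1 _] := hc (m - a) (n - b) (subspaceB sM Mm (AM _ Aa)) (subspaceB sN Nn (BN _ Bb)).
  apply: (le_lt_trans h1); rewrite mulrC -ltr_pdivlMr //.
  by move: hab; rewrite e; congr (nr _ < _); lmod.
apply: (iffLR (closedP B) cB) => d d0.
have [|_ [a [b [Aa Bb ->]]] hab] := hx (d / c); first by rewrite divr_gt0.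
exists b => //; have [_ h1] := hc (m - a) (n - b) (subspaceB sM Mm (AM _ Aa)) (subspaceB sN Nn (BN _ Bb)).
apply: (le_lt_trans h1); rewrite mulrC -ltr_pdivlMr //.
by move: hab; rewrite e; congr (nr _ < _); lmod.
Qed.

Lemma dsum_assoc Y Z M N P : subspace Y -> subspace Z -> subspace M -> subspace N -> subspace P ->
  dsum Y Z P -> dsum Z M N -> dsum Y M (setsum N P).
Proof.
move=> sY sZ sM sN sP h h'; have [ZY PY ZP hY] := h; have [MZ NZ MN hZ] := h'.
split.
- by move=> x /MZ/ZY.
- by move=> _ [a [b [/NZ/ZY Na /PY Pb ->]]]; apply: subspaceD.
- apply/seteqP; split=> x /=; last first.
    by move=> ->; split; [case: sM|case: (setsum_subspace sN sP)].
  move=> [Mx [a [b [Na Pb e]]]].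
  have e0 : (a - x) + b = 0 by rewrite e; lmod.
  have [ax b0] := dsum_uniq0 sZ sP h (subspaceB sZ (NZ _ Na) (MZ _ Mx)) Pb e0.
  have : (M `&` N) x by split=> //; move/eqP: ax; rewrite subr_eq0 => /eqP <-.
  by rewrite MN.
move=> x /hY [z [p [Zz Pp ->]]]; have [m [n [Mm Nn ->]]] := hZ z Zz.
by exists m, (n + p); split=> //; [exists n, p|rewrite addrA].
Qed.

Lemma dsum_full Y : subspace Y -> dsum Y Y [set 0].
Proof.
move=> [Y0 _]; split=> //; first by move=> x ->.
  by apply/seteqP; split=> x /=; [case|move=> ->].
by move=> x Yx; exists x, 0; rewrite addr0.
Qed.

Lemma dimle_trans A B W p q : dimle A B p -> dimle B W q -> dimle A W (p + q).
Proof.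
move=> [s hs] [t ht]; exists (fun i => if (i < p)%N then s i else t (i - p)%N) => x /hs [c /ht [d hd]].
exists (fun i => if (i < p)%N then c i else d (i - p)%N).
rewrite big_split_ord /=.
rewrite [\sum_(i < p) _](_ : _ = \sum_(i < p) c i *: s i); last by apply: eq_bigr => i _; rewrite ltn_ord.
rewrite [\sum_(i < q) _](_ : _ = \sum_(i < q) d i *: t i); last first.
  by apply: eq_bigr => i _; rewrite ltnNge leq_addr /= addKn.
by move: hd; congr (W _); lmod.
Qed.

Lemma dimle_img A W S n : lin S -> dimle A W n -> dimle (rng_on A S) (rng_on W S) n.
Proof.
move=> lS [s hs]; exists (fun i => S (s i)) => _ [x /hs [c hc] <-].
exists c, (x - \sum_(i < n) c i *: s i) => //.
by rewrite (linB lS) (lin_sum lS); congr (_ - _); apply: eq_bigr => i _; rewrite (linZ lS).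
Qed.

Lemma dimle_setsum A B W V n m : dimle A W n -> dimle B V m -> dimle (setsum A B) (setsum W V) (n + m).
Proof.
move=> [s hs] [t ht]; exists (fun i => if (i < n)%N then s i else t (i - n)%N) => _ [a [b [/hs [c hc] /ht [d hd] ->]]].
exists (fun i => if (i < n)%N then c i else d (i - n)%N).
rewrite big_split_ord /=.
rewrite [\sum_(i < n) _](_ : _ = \sum_(i < n) c i *: s i); last by apply: eq_bigr => i _; rewrite ltn_ord.
rewrite [\sum_(i < m) _](_ : _ = \sum_(i < m) d i *: t i); last first.
  by apply: eq_bigr => i _; rewrite ltnNge leq_addr /= addKn.
by eexists; eexists; split; [exact: hc|exact: hd|lmod].
Qed.

Lemma setsum00 : setsum [set 0] [set 0] = [set 0 : X].
Proof.
apply/seteqP; split=> x; first by move=> [_ [_ [-> -> ->]]]; rewrite addr0.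
by move=> ->; exists 0, 0; rewrite addr0.
Qed.

Lemma dimle_self0 n : dimle [set 0 : X] [set 0] n.
Proof.
exists (fun=> 0) => x ->; exists (fun=> 0).
by rewrite big1 ?subr0 // => i _; rewrite scaler0.
Qed.

Lemma dimle_refl A n : subspace A -> dimle A A n.
Proof. by move=> sA; exists (fun=> 0); apply: spn_sub. Qed.

Lemma sum_ext0 n (c : 'I_n -> C) (s : 'I_n -> X) :
  \sum_(i < n) ext0 c i *: ext0 s i = \sum_(i < n) c i *: s i.
Proof. by apply: eq_bigr => i _; rewrite !ext0E. Qed.

Lemma findimP A : findim A <-> exists n, dimle A [set 0] n.
Proof.
split=> [[n [s hs]]|[n [s hs]]].
  exists n, (ext0 s) => x /hs [c ->]; exists (ext0 c).
  by rewrite sum_ext0 subrr.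
exists n, (fun i : 'I_n => s i) => x /hs [c /= /eqP]; rewrite subr_eq0 => /eqP ->.
by exists (fun i : 'I_n => c i).
Qed.

Lemma dim_isP A n : dim_is A n <-> rdim A [set 0] n.
Proof.
split=> [[s [As [is_ hs]]]|[s [As is_] hs]].
  exists (ext0 s); first split.
  - by move=> i ni; rewrite (ext0E s (Ordinal ni)).
  - move=> c hc i ni; apply: (is_ (fun i => c i) _ (Ordinal ni)).
    by rewrite -[RHS]hc; apply: eq_bigr => j _; rewrite ext0E.
  by move=> x /hs [c ->]; exists (ext0 c); rewrite sum_ext0 subrr.
exists (fun i : 'I_n => s i); split; first by move=> i; apply: As.
split=> [c hc i|x /hs [c /= /eqP]]; last first.
  by rewrite subr_eq0 => /eqP ->; exists (fun i : 'I_n => c i).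
rewrite -(ext0E c); apply: is_ => //=.
by rewrite -[RHS]hc; apply: eq_bigr => j _; rewrite ext0E.
Qed.

Lemma codim_inP Y B n : subspace B -> codim_in Y B n <-> rdim Y B n.
Proof.
move=> sB; split=> [[s [Ys [hs is_]]]|[s [Ys is_] hs]].
  exists (ext0 s); first split.
  - by move=> i ni; rewrite (ext0E s (Ordinal ni)).
  - move=> c hc i ni; apply: (is_ (fun i => c i) _ (subspaceN sB hc) _ (Ordinal ni)).
    by rewrite addrC; apply/eqP; rewrite subr_eq0; apply/eqP; apply: eq_bigr => j _; rewrite ext0E.
  by move=> x /hs [c [b [Bb ->]]]; exists (ext0 c); rewrite sum_ext0 addrK.
exists (fun i : 'I_n => s i); split; first by move=> i; apply: Ys.
split=> [x /hs [c hc]|c b Bb /eqP].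
  by exists (fun i : 'I_n => c i), (x - \sum_(i < n) c i *: s i); rewrite subrK.
rewrite addr_eq0 => /eqP hb i; rewrite -(ext0E c); apply: is_ => //=.
have -> : \sum_(j < n) ext0 c j *: s j = - b; last exact: subspaceN.
by rewrite hb opprK; apply: eq_bigr => j _; rewrite ext0E.
Qed.

(** With [F] a finite-dimensional complement of the range, open mapping for [S x + f] bounds the
    [F]-component of a point by a multiple of its distance to the range; on the closure of the range
    that component vanishes. *)
Lemma codim_closed Y S n : closed_subspace Y -> inv_on Y S -> blin S ->
  dimle Y (rng_on Y S) n -> closed (rng_on Y S).
Proof.
move=> cY iY bS; have [sY clY] := cY; have sR := rng_subspace sY bS.
move=> /(dimle_rdim sR) [m _ [s [Ys is_] hs]].
pose F := spn [set 0] m s.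
have cF : closed_subspace F.
  by have [? ?] := closed_subspace0; split; [apply: spn_subspace|apply: spn_closed].
have FY : F `<=` Y.
  move=> x [c /= /eqP]; rewrite subr_eq0 => /eqP ->.
  by apply: subspace_sum => // i; apply: subspaceZ => //; apply: Ys.
have F0 f : F f -> rng_on Y S f -> f = 0.
  move=> [c /= /eqP]; rewrite subr_eq0 => /eqP -> /is_ h.
  by rewrite big1 // => i _; rewrite h ?scale0r.
have YE y : Y y -> exists x f, [/\ Y x, F f & y = S x + f].
  move=> /hs [c [x Yx Sx]]; exists x, (\sum_(i < m) c i *: s i); split=> //; last by rewrite Sx subrK.
  by exists c; rewrite subrr.
have [|c c0 hc] := open_mapping2 bS cY cF.
  suff -> : [set z | exists x y, [/\ Y x, F y & z = S x + y]] = Y by [].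
  apply/seteqP; split=> z; last exact: YE.
  by move=> [x [f [Yx /FY Yf ->]]]; apply: subspaceD => //; apply: iY.
apply/closedP => y hy.
have Yy : Y y.
  apply: (iffLR (closedP Y) clY) => e e0; have [_ [x Yx <-] hx] := hy e e0.
  by exists (S x) => //; apply: iY.
have [x [f [Yx Ff ey]]] := YE y Yy.
suff f0 : f = 0 by rewrite ey f0 addr0; exists x.
apply: nr_le0; rewrite leNgt; apply/negP => nf.
have [|_ [z Yz <-] hz] := hy (nr f / c); first by rewrite divr_gt0.
have [x' [f' [Yx' Ff' e _ nf']]] := hc (x - z) f (subspaceB sY Yx Yz) Ff.
have ff : f' = f.
  apply/eqP; rewrite -subr_eq0; apply/eqP; apply: F0; first by apply: subspaceB => //; case: cF.
  exists (x - z - x'); first by apply: subspaceB => //; apply: subspaceB.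
  rewrite (linB (proj1 bS)); have -> : S (x - z) = S x' + f' - f by rewrite e addrK.
  by lmod.
move: nf'; rewrite ff (linB (proj1 bS)) -[S x - S z + f]addrAC -ey => h1.
have : c * nr (y - S z) < nr f by rewrite mulrC -ltr_pdivlMr.
by nlra.
Qed.

End DirectSum.

(** * Kato's decomposition of semi-Fredholm operators *)

Section KatoDecomposition.
Context {R : realType} {X : completeNormedModType R[i]}.
Local Notation C := R[i].
Ltac lmod := lmod_gen (R[i] : comNzRingType) (X : lmodType R[i]).
Implicit Types (A B D W Y M N Z : set X) (S U : X -> X) (s t : nat -> X).

Definition decomp_on Y S (P Q : set X -> Prop) := exists M N : set X,
  [/\ closed_subspace M, closed_subspace N, inv_on M S, inv_on N S & [/\ dsum Y M N, P M & Q N]].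

(* The range of [S ^ j] is enlarged by the kernel of [S], which does not change
   its image, so that [closed_img] applies. *)
Lemma PhiP_iter_closed Y S n j : closed_subspace Y -> inv_on Y S -> blin S ->
  dimle (ker_on Y S) [set 0] n -> closed (rng_on Y S) -> closed (rng_on Y (iter j S)).
Proof.
move=> cY iY bS hn cR; have [sY clY] := cY.
elim: j => [|j IH]; first by rewrite rng_iter0.
have [s0 c0] := @closed_subspace0 R X.
have [m _ [s [ks _] hs]] := dimle_rdim s0 hn.
set B := rng_on Y (iter j S) in IH *.
have sB : subspace B by apply: rng_subspace; [|apply: blin_iter].
have BY : B `<=` Y by apply: rng_inv; apply: iter_inv.
rewrite rng_iterS.
suff -> : rng_on B S = rng_on (spn B m s) S.
  apply: (@closed_img _ _ Y) => //.
  - by split; [apply: spn_subspace|apply: spn_closed].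
  - move=> x [c /BY Yx]; rewrite -(subrK (\sum_(i < m) c i *: s i) x); apply: subspaceD => //.
    by apply: subspace_sum => // i; apply: subspaceZ => //; case: (ks i (ltn_ord i)).
  move=> x /hs [c /= hc]; exists c; rewrite hc; by case: sB.
apply/seteqP; split=> _ [x Bx <-]; first by exists x => //; apply: spn_sub.
have [c hc] := Bx; exists (x - \sum_(i < m) c i *: s i) => //.
have lS := proj1 bS; rewrite (linB lS) (lin_sum lS) big1 ?subr0 // => i _.
by rewrite (linZ lS); have [_ ->] := ks i (ltn_ord i); rewrite scaler0.
Qed.

Lemma PhiM_iter_closed Y S n j : closed_subspace Y -> inv_on Y S -> blin S ->
  dimle Y (rng_on Y S) n -> closed (rng_on Y (iter j S)).
Proof.
move=> cY iY bS hn.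
have [m hm] : exists m, dimle Y (rng_on Y (iter j S)) m.
  elim: j => [|j [m hm]]; first by exists 0%N; rewrite rng_iter0; apply: dimle_refl; case: cY.
  exists (n + m)%N; apply: (dimle_trans hn); rewrite rng_iterS.
  by apply: dimle_img hm; case: bS.
by apply: (codim_closed cY _ _ hm); [apply: iter_inv|apply: blin_iter].
Qed.

Lemma dsum_iter_rng Y Z N S j : subspace Z -> subspace N -> lin S -> inv_on Z S -> inv_on N S ->
  dsum Y Z N -> rng_on Z (iter j S) = rng_on Y (iter j S) `&` Z.
Proof.
move=> sZ sN lS iZ iN h; have [ZY NY ZN hY] := h.
have lI : lin (iter j S) by elim: j => [|j IH] // a x y; rewrite !iterS IH lS.
apply/seteqP; split=> x.
  by move=> [z Zz <-]; split; [exists z => //; apply: ZY|apply: iter_inv].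
move=> [[y /hY [z [n [Zz Nn ->]]] <-] Zx].
have e : iter j S z + iter j S n = iter j S (z + n) + 0 by rewrite (linD lI) addr0.
have [e1 _] := dsum_uniq sZ sN h (iter_inv j iZ Zz) (iter_inv j iN Nn) Zx (proj1 sN) e.
by exists z.
Qed.

(* West's reduction: a chain [y, S y, ..., S ^ k' y] leaving the range of
   [S ^ k'.+1] at its last vector, a kernel vector, splits off; [Z] is its
   complement, defined by a functional vanishing on the range of [S ^ k'.+1]. *)
Lemma split_chain Y S k' (y : X) : closed_subspace Y -> inv_on Y S -> blin S ->
  closed (rng_on Y (iter k'.+1 S)) -> Y y -> iter k'.+1 S y = 0 ->
  ~ rng_on Y (iter k'.+1 S) (iter k' S y) ->
  exists Z N, [/\ closed_subspace Z, closed_subspace N, inv_on Z S, inv_on N S & [/\ dsum Y Z N,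
    exists n, dimle N [set 0] n, forall x, N x -> iter k'.+1 S x = 0,
    forall (b : X) (a : C), Z b -> b + a *: iter k' S y = 0 -> a = 0 &
    forall (b : X) (a : C), Z b -> rng_on Y S (b + a *: y) -> a = 0]].
Proof.
move=> cY iY bS cR Yy ky nu; have [sY clY] := cY; have lS := proj1 bS.
set k := k'.+1 in cR ky nu *.
have lI j : lin (iter j S) by case: (blin_iter j bS).
have [f [fl [K hK] fR fu]] := separation (rng_subspace sY (blin_iter k bS)) cR nu.
have fD x z : f (x + z) = f x + f z by have := fl 1 x z; rewrite scale1r mul1r.
have f0 : f 0 = 0.
  by apply: (@addrI _ (f 0)); rewrite -fD !addr0.
have fZ a x : f (a *: x) = a * f x by have := fl a x 0; rewrite !addr0 f0 addr0.
have fB x z : f (x - z) = f x - f z by rewrite -scaleN1r fD fZ mulN1r.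
have fk j x : (k <= j)%N -> Y x -> f (iter j S x) = 0.
  move=> kj Yx; apply: fR; rewrite -(subnKC kj) iterD; exists (iter (j - k) S x) => //.
  exact: iter_inv.
have yk j : (k <= j)%N -> iter j S y = 0.
  by move=> kj; rewrite -(subnK kj) iterD ky (lin0 (lI _)).
pose Z : set X := [set x | Y x /\ forall j, f (iter j S x) = 0].
pose N := spn [set 0] k (fun j => iter j S y).
have NE x : N x -> exists c : nat -> C, x = \sum_(j < k) c j *: iter j S y.
  by move=> [c /= /eqP]; rewrite subr_eq0 => /eqP ->; exists c.
have [s0 c0] := @closed_subspace0 R X.
have sN : subspace N by exact: spn_subspace.
have sZ : subspace Z.
  split; first by split=> [|j]; [case: sY|rewrite (lin0 (lI j))].
  move=> a x z [Yx hx] [Yz hz]; split=> [|j]; first by case: sY => _; apply.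
  by rewrite lI fl hx hz mulr0 addr0.
have Ng j : N (iter j S y).
  by have [jk|kj] := ltnP j k; [apply: spn_gen|rewrite yk //; case: sN].
have NY : N `<=` Y.
  move=> x /NE [c ->]; apply: subspace_sum => // j; apply: subspaceZ => //; exact: iter_inv.
exists Z, N; split.
- split=> //; apply/closedP => x hx; split.
    by apply: (iffLR (closedP Y) clY) => e e0; have [a [Ya _] ha] := hx e e0; exists a.
  move=> j; have [Kj Kj0 hKj] := bndP (proj2 (blin_iter j bS)).
  pose K' := `|K| + 1; have K'0 : 0 < K' by rewrite /K'; have := normr_ge0 K; lra.
  apply: nr_le0; rewrite leNgt; apply/negP => nf.
  have [|a [_ ha] hxa] := hx (nr (f (iter j S x)) / (K' * Kj)).
    by rewrite divr_gt0 // mulr_gt0.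
  have h1 : nr (f (iter j S x)) <= K' * (Kj * nr (x - a)).
    rewrite -[f _]subr0 -(ha j) -fB -(linB (lI j)).
    apply: (le_trans (hK _)); apply: (@le_trans _ _ (K' * nr (iter j S (x - a)))).
      by apply: ler_wpM2r; rewrite ?nr_ge0 // /K'; have := ler_norm K; lra.
    by apply: ler_wpM2l; [exact: ltW|exact: hKj].
  move: hxa; rewrite ltr_pdivlMr ?mulr_gt0 // => h2.
  have h3 : K' * (Kj * nr (x - a)) = nr (x - a) * (K' * Kj) by ring.
  by rewrite h3 in h1; have := le_lt_trans h1 h2; rewrite ltxx.
- by split; [|apply: spn_closed].
- by move=> x [Yx hx]; split=> [|j]; [apply: iY|rewrite -iterSr].
- move=> x /NE [c ->]; rewrite (lin_sum lS); apply: subspace_sum => // j.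
  by rewrite (linZ lS) -iterS; apply: subspaceZ.
split.
- split=> //; first by move=> x [].
    apply/seteqP; split=> x /=; last first.
      by move=> ->; split; [case: sZ|case: sN].
    move=> [[_ hx] /NE [c ex]].
    (* The system is triangular: [f \o iter (k' - n) S] isolates [c n], since the earlier
       coefficients vanish by induction and the later terms contain at least [k] applications of [S]
       to [y]. *)
    suff hc : forall n j, (j < n)%N -> (j < k)%N -> c j = 0.
      by rewrite ex big1 // => i _; rewrite (hc k) ?scale0r.
    elim=> // n IH j; rewrite ltnS leq_eqVlt => /predU1P[->{j}|]; last exact: IH.
    move=> nk; have := hx (k' - n)%N; rewrite ex (lin_sum (lI _)).
    rewrite (bigD1 (Ordinal nk)) //= (linZ (lI _)) -iterD subnK // fD fZ fu mulr1 => h1.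
    move: h1; set T := (\sum_(i < k | _) _).
    suff -> : T = 0 by rewrite f0 addr0.
    rewrite /T big1 // => i /eqP hi; rewrite (linZ (lI _)) -iterD.
    have [ilt|ige] := ltnP i n; first by rewrite (IH i) ?scale0r.
    rewrite yk ?scaler0 // /k.
    have : (i : nat) <> n by move=> e; apply: hi; apply: val_inj.
    have : (n <= k')%N by [].
    by move: (nat_of_ord i) ige => j; lia.
  (* The values [f (S ^ j x)] are cancelled from [j = k'] downwards: a multiple of [S ^ m y]
     corrects the one at [j = k' - m] and leaves those at larger [j] unchanged. *)
  have key m : (m <= k)%N -> forall x, Y x -> exists2 v, N v & forall j, (k - m <= j)%N -> f (iter j S (x - v)) = 0.
    elim: m => [_|m IH mk] x Yx.
      exists 0; first by case: sN.
      by move=> j; rewrite subn0 => kj; rewrite subr0 fk.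
    have [|v Nv hv] := IH _ x Yx; first exact: ltnW.
    exists (v + f (iter (k' - m) S (x - v)) *: iter m S y).
      by apply: subspaceD => //; apply: subspaceZ.
    move=> j hj; have -> : x - (v + f (iter (k' - m) S (x - v)) *: iter m S y) =
      (- f (iter (k' - m) S (x - v))) *: iter m S y + (x - v) by lmod.
    rewrite (lI j) fD fZ -iterD.
    have [jj|jj] := eqVneq j (k' - m)%N.
      by rewrite jj subnK // fu mulr1 addNr.
    have mk' : (m <= k')%N by [].
    have kj : (k - m <= j)%N.
      by move: hj jj; rewrite /k subSS subSn // ltn_neqAle eq_sym => -> ->.
    rewrite (hv j kj) addr0 yk ?f0 ?mulr0 //.
    by rewrite addnC -leq_subLR.
  move=> x Yx; have [v Nv hv] := key k (leqnn k) x Yx.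
  exists (x - v), v; split=> //; last by rewrite subrK.
  split; first by apply: subspaceB => //; apply: NY.
  by move=> j; apply: hv; rewrite subnn.
- by exists k; exists (fun j => iter j S y).
- move=> x /NE [c ->]; rewrite (lin_sum (lI k)) big1 // => i _.
  by rewrite (linZ (lI k)) -iterD yk ?scaler0 // leq_addr.
- move=> b a [_ hb] e; have := hb 0%N; rewrite /=.
  have -> : b = - a *: iter k' S y + 0 by rewrite -e; lmod.
  by rewrite addr0 fZ fu mulr1 => /eqP; rewrite oppr_eq0 => /eqP.
move=> b a [_ hb] [x Yx e].
have : f (iter k' S (b + a *: y)) = a by rewrite (linD (lI k')) fD hb add0r (linZ (lI k')) fZ fu mulr1.
by rewrite -e -iterSr fk.
Qed.

(** As the ranges are closed, failure of the Kato property is a kernel vector [u] outside some range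
    of [S ^ k]; for the least [k] it is the end of a chain that splits off. The complement loses [u]
    from its kernel and [y] from its quotient by the range, so whichever of nullity and defect is
    bounded, the bound goes down by one. *)
Lemma not_Kato_split Y S n : closed_subspace Y -> inv_on Y S -> blin S -> ~ Kato_on Y S ->
  (forall j, closed (rng_on Y (iter j S))) ->
  dimle (ker_on Y S) [set 0] n \/ dimle Y (rng_on Y S) n ->
  (0 < n)%N /\ exists Z N, [/\ closed_subspace Z, closed_subspace N, inv_on Z S, inv_on N S &
   [/\ dsum Y Z N, exists n, dimle N [set 0] n, Nilp_on N S, (forall j, closed (rng_on Z (iter j S))) &
    dimle (ker_on Z S) [set 0] n.-1 \/ dimle Z (rng_on Z S) n.-1]].
Proof.
move=> cY iY bS nkS cR hd; have sY := proj1 cY; have s0 := @subspace0 R X; have lS := proj1 bS.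
have hk : exists k, `[< exists2 u, ker_on Y S u & ~ rng_on Y (iter k S) u >].
  apply: contrapT => hh; apply: nkS; split; first by have := cR 1%N; rewrite rng_iterS rng_iter0.
  move=> k u ku; apply: contrapT => hu; apply: hh; exists k; apply/asboolP; by exists u.
case: (ex_minnP hk) => k /asboolP[u [Yu Su] nu] mink.
(* [k] is positive, because the range of the zeroth iterate is [Y]; minimality then provides [y]
   with [S ^ k' y = u]. *)
case: k nu mink => [|k'] nu mink; first by case: nu; rewrite rng_iter0.
have [y Yy ey] : rng_on Y (iter k' S) u.
  apply: contrapT => h; suff : (k'.+1 <= k')%N by rewrite ltnn.
  by apply: mink; apply/asboolP; exists u.
have nu' : ~ rng_on Y (iter k'.+1 S) (iter k' S y) by rewrite ey.
have yk : iter k'.+1 S y = 0 by rewrite iterS ey.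
have [Z [N [cZ cN iZ iN [dY [q hq] nN ku kr]]]] := split_chain cY iY bS (cR k'.+1) Yy yk nu'.
have sZ := proj1 cZ; have sN := proj1 cN; have [ZY NY _ _] := dY.
have rZ := dsum_iter_rng _ sZ sN lS iZ iN dY.
have rZ1 : rng_on Z S = rng_on Y S `&` Z by have := rZ 1%N; rewrite !rng_iterS !rng_iter0.
have sRY := rng_subspace sY bS; have sRZ := rng_subspace sZ bS.
have [n0 hd'] : (0 < n)%N /\ (dimle (ker_on Z S) [set 0] n.-1 \/ dimle Z (rng_on Z S) n.-1).
  case: hd => hd.
    have [|||n0 h] := @dimle_drop _ _ _ (ker_on Z S) _ [set 0] n u s0 s0 hd _ _ (ker_subspace sZ bS).
    - by move=> x [Zx Sx]; split=> //; apply: ZY.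
    - by [].
    - move=> b a [Zb _] /= e; have a0 := ku b a Zb (ltac:(by rewrite ey)).
      by move: e; rewrite a0 scale0r addr0.
    by split=> //; left.
  have [|n0 h] := @dimle_drop _ _ _ Z _ (rng_on Z S) n y sRY sRZ hd ZY Yy sZ.
    move=> b a Zb e; have a0 := kr b a Zb e; split=> //.
    by rewrite rZ1; split=> //; move: e; rewrite a0 scale0r addr0.
  by split=> //; right.
split=> //; exists Z, N; split=> //; split=> //; [by exists q|by exists k'.+1|].
by move=> j; rewrite rZ; apply: closedI; [exact: cR|case: cZ].
Qed.

Lemma findim_setsum A B : findim A -> findim B -> findim (setsum A B).
Proof.
move=> /findimP [n hn] /findimP [m hm]; apply/findimP; exists (n + m)%N.
by rewrite -setsum00; apply: dimle_setsum.
Qed.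

Lemma setsum_inv A B S : lin S -> inv_on A S -> inv_on B S -> inv_on (setsum A B) S.
Proof.
move=> lS iA iB _ [a [b [Aa Bb ->]]]; exists (S a), (S b).
by split; [exact: iA|exact: iB|exact: linD].
Qed.

Lemma setsum_nilp A B S : blin S -> Nilp_on A S -> Nilp_on B S -> Nilp_on (setsum A B) S.
Proof.
move=> bS [p hp] [q hq]; exists (p + q)%N => _ [a [b [Aa Bb ->]]].
have lI j : lin (iter j S) by case: (blin_iter j bS).
have ha : iter (p + q) S a = 0 by rewrite addnC iterD hp // (lin0 (lI _)).
have hb : iter (p + q) S b = 0 by rewrite iterD hq // (lin0 (lI _)).
by rewrite (linD (lI _)) ha hb addr0.
Qed.

Lemma decomp_on_trivial Y S (P Q : set X -> Prop) : closed_subspace Y -> inv_on Y S -> lin S ->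
  P Y -> Q [set 0] -> decomp_on Y S P Q.
Proof.
move=> cY iY lS PY Q0; exists Y, [set 0]; split=> //; first exact: closed_subspace0.
  by move=> x ->; rewrite (lin0 lS).
by split=> //; apply: dsum_full; case: cY.
Qed.

Lemma decomp_on_refine Y Z N S (P Q Q' : set X -> Prop) :
  closed_subspace Y -> closed_subspace Z -> closed_subspace N -> lin S -> inv_on N S ->
  dsum Y Z N -> decomp_on Z S P Q ->
  (forall N', closed_subspace N' -> closed_subspace (setsum N' N) -> inv_on N' S ->
     dsum (setsum N' N) N' N -> Q N' -> Q' (setsum N' N)) -> decomp_on Y S P Q'.
Proof.
move=> cY cZ cN lS iN dY [M [N' [cM cN' iM iN' [dZ PM QN]]]] h.
have sY := proj1 cY; have sZ := proj1 cZ; have sN := proj1 cN.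
have sM := proj1 cM; have sN' := proj1 cN'.
have cNN : closed_subspace (setsum N' N).
  split; first exact: setsum_subspace.
  apply: (closed_setsum cY cZ cN dY) => //; first by case: dZ.
    by case: cN'.
  by case: cN.
exists M, (setsum N' N); split=> //; last split=> //.
- exact: setsum_inv.
- exact: (dsum_assoc sY sZ sM sN' sN dY dZ).
apply: h => //; split=> //.
- by move=> x N'x; exists x, 0; rewrite addr0; split=> //; case: sN.
- by move=> x Nx; exists 0, x; rewrite add0r; split=> //; case: sN'.
- apply/seteqP; split=> x /=; last by move=> ->; split; [case: sN'|case: sN].
  move=> [N'x Nx]; have [_ _ ZN _] := dY; have [_ N'Z _ _] := dZ.
  by have : (Z `&` N) x by [split=> //; apply: N'Z]; rewrite ZN.
Qed.

(** Induction on a bound for the nullity or for the defect. At [0] no chain can be split off, so [S]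
    is Kato; otherwise each chain removed joins the nilpotent summand. *)
Lemma Kato_decomp Y S n : closed_subspace Y -> inv_on Y S -> blin S ->
  (forall j, closed (rng_on Y (iter j S))) ->
  dimle (ker_on Y S) [set 0] n \/ dimle Y (rng_on Y S) n ->
  decomp_on Y S (fun M => Kato_on M S) (fun N => findim N /\ Nilp_on N S).
Proof.
move=> + + bS; elim: n Y => [|n IH] Y cY iY cR hd.
  have [kS|nkS] := pselect (Kato_on Y S); last by have [] := not_Kato_split cY iY bS nkS cR hd.
  apply: decomp_on_trivial => //; first by case: bS.
  by split; [apply/findimP; exists 0%N; exact: dimle_self0|exists 0%N].
have [kS|nkS] := pselect (Kato_on Y S).
  apply: decomp_on_trivial => //; first by case: bS.
  by split; [apply/findimP; exists 0%N; exact: dimle_self0|exists 0%N].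
have [_ [Z [N [cZ cN iZ iN [dY hN nN cRZ hdZ]]]]] := not_Kato_split cY iY bS nkS cR hd.
apply: (decomp_on_refine cY cZ cN (proj1 bS) iN dY (IH Z cZ iZ cRZ hdZ)).
move=> N' _ _ _ _ [fN' nN']; split; last exact: setsum_nilp.
by apply: findim_setsum => //; apply/findimP.
Qed.

Lemma PhiP_decomp Y S : closed_subspace Y -> inv_on Y S -> blin S -> PhiP_on Y S ->
  decomp_on Y S (fun M => Kato_on M S) (fun N => findim N /\ Nilp_on N S).
Proof.
move=> cY iY bS [/findimP [n hn] cR]; apply: (@Kato_decomp _ _ n) => //; last by left.
by move=> j; apply: PhiP_iter_closed hn cR.
Qed.

Lemma PhiM_dimle Y S : closed_subspace Y -> blin S -> PhiM_on Y S <-> exists n, dimle Y (rng_on Y S) n.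
Proof.
move=> cY bS; have sR := rng_subspace (proj1 cY) bS; split=> [[n /(codim_inP _ _ sR)]|[n]].
  by move=> /rdim_dimle h; exists n.
by move=> /(dimle_rdim sR) [m _ hm]; exists m; apply/codim_inP.
Qed.

Lemma PhiM_decomp Y S : closed_subspace Y -> inv_on Y S -> blin S -> PhiM_on Y S ->
  decomp_on Y S (fun M => Kato_on M S) (fun N => findim N /\ Nilp_on N S).
Proof.
move=> cY iY bS /(PhiM_dimle cY bS) [n hn]; apply: (@Kato_decomp _ _ n) => //; last by right.
by move=> j; apply: PhiM_iter_closed hn.
Qed.

Lemma PhiM_closed Y S : closed_subspace Y -> inv_on Y S -> blin S -> PhiM_on Y S -> closed (rng_on Y S).
Proof. by move=> cY iY bS /(PhiM_dimle cY bS) [n hn]; apply: codim_closed hn. Qed.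

End KatoDecomposition.

(** * Riesz operators *)

(** Connectedness of the segment: [s] is the infimum of the points from which [P] holds up to [b],
    and if [a < s], local constancy at [s] would allow going further left. *)
Lemma segment_const (R : realType) (P : R -> Prop) (a b : R) : a <= b ->
  (forall t, a <= t <= b -> exists2 d : R, 0 < d &
     forall t', a <= t' <= b -> `|t' - t| < d -> (P t' <-> P t)) -> P b -> P a.
Proof.
move=> ab h Pb.
pose E := [set t | a <= t <= b /\ forall u, t <= u <= b -> P u].
have Eb : E b by split=> [|u /andP[h1 h2]]; [rewrite ab lexx|have -> : u = b by lra].
have hE : has_inf E by split; [exists b|exists a => t [/andP[]]].
pose s := inf E.
have sE t : E t -> s <= t by move=> Et; apply: ge_inf => //; case: hE.
have as_ : a <= s by apply: lb_le_inf; [case: hE|move=> t [/andP[]]].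
have sb : s <= b by exact: sE.
have [|d d0 hd] := h s; first by rewrite as_ sb.
have [t [/andP[at_ tb] ht] ts] := inf_adherent d0 hE.
have st : s <= t by apply: sE; split; [rewrite at_ tb|].
have Ps : P s.
  apply/(hd t); first by rewrite at_ tb.
    by rewrite ger0_norm ?subr_ge0 // /s; lra.
  by apply: ht; rewrite lexx tb.
have near u : a <= u <= b -> `|u - s| < d -> P u by move=> h1 h2; apply/(hd u h1 h2).
suff sa : s = a by rewrite -sa.
apply/eqP; rewrite eq_le as_ andbT leNgt; apply/negP => lt.
pose s' := Num.max a (s - d / 2).
have s'1 : a <= s' by rewrite le_max lexx.
have s'2 : s - d / 2 <= s' by rewrite le_max lexx orbT.
have s'3 : s' < s by rewrite gt_max lt; lra.
have := sE s'; suff : E s' by move=> e /(_ e); lra.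
split=> [|u /andP[h1 h2]]; first by rewrite s'1; lra.
have [ut|tu] := leP t u; first by apply: ht; rewrite ut h2.
apply: near; first by rewrite h2 andbT; lra.
by rewrite ltr_norml; move: ts; rewrite -/s => ts; apply/andP; split; lra.
Qed.

Section Browder.
Context {R : realType} {X : completeNormedModType R[i]}.
Local Notation C := R[i].
Ltac lmod := lmod_gen (R[i] : comNzRingType) (X : lmodType R[i]).
Implicit Types (A B D W Y M N Z : set X) (S U : X -> X) (l mu nu : C).

Definition bij_on Y U := (forall x, Y x -> U x = 0 -> x = 0) /\ rng_on Y U = Y.
(** For a Fredholm operator this amounts to finite ascent and descent; as a decomposition it can be
    followed under small shifts. *)
Definition browder Y U := decomp_on Y U (fun M => bij_on M U) (fun N => findim N /\ Nilp_on N U).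

Lemma dimle0P A W : dimle A W 0 <-> A `<=` W.
Proof.
split=> [[s hs] x /hs [c]|AW]; first by rewrite big_ord0 subr0.
by exists (fun=> 0) => x /AW Wx; exists (fun=> 0); rewrite big_ord0 subr0.
Qed.

(** Brings bijectivity under [Kato_stable], with [n = 0]. *)
Lemma bij_onP Y U : inv_on Y U -> bij_on Y U <->
  dimle (ker_on Y U) [set 0] 0 /\ dimle Y (rng_on Y U) 0.
Proof.
move=> iY; rewrite !dimle0P; split=> [[h1 h2]|[h1 h2]].
  by split; [move=> x [Yx Ux]; apply: h1|rewrite h2].
split; first by move=> x Yx Ux; apply: h1.
by apply/seteqP; split=> //; apply: rng_inv.
Qed.

Lemma bij_Kato Y U : subspace Y -> closed Y -> bij_on Y U -> Kato_on Y U.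
Proof.
move=> sY cY [h1 h2]; split; first by rewrite h2.
move=> n x [Yx Ux]; have -> : x = 0 by apply: h1.
have -> : rng_on Y (iter n U) = Y; last by case: sY.
by elim: n => [|n IH]; [rewrite rng_iter0|rewrite rng_iterS IH].
Qed.

Lemma bij_dsum Y M N U : lin U -> subspace M -> subspace N -> subspace Y -> inv_on M U -> inv_on N U -> dsum Y M N ->
  bij_on Y U <-> bij_on M U /\ bij_on N U.
Proof.
move=> lU sM sN sY iM iN h; have [MY NY MN hY] := h; split.
  move=> [h1 h2]; split; split.
  - by move=> x /MY; apply: h1.
  - apply/seteqP; split; first exact: rng_inv.
    move=> m Mm; have : Y m by exact: MY.
    rewrite -[in Y m]h2 => -[_ /hY [m' [n' [Mm' Nn' ->]]]]; rewrite (linD lU) => e.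
    have [e1 _] := dsum_uniq sM sN h (iM _ Mm') (iN _ Nn') Mm (proj1 sN) (etrans e (esym (addr0 m))).
    by exists m'.
  - by move=> x /NY; apply: h1.
  - apply/seteqP; split; first exact: rng_inv.
    move=> n Nn; have : Y n by exact: NY.
    rewrite -[in Y n]h2 => -[_ /hY [m' [n' [Mm' Nn' ->]]]]; rewrite (linD lU) => e.
    have [_ e1] := dsum_uniq sM sN h (iM _ Mm') (iN _ Nn') (proj1 sM) Nn (etrans e (esym (add0r n))).
    by exists n'.
move=> [[m1 m2] [n1 n2]]; split.
  move=> _ /hY [m [n [Mm Nn ->]]]; rewrite (linD lU) => e.
  have [/(m1 _ Mm) -> /(n1 _ Nn) ->] := dsum_uniq0 sM sN h (iM _ Mm) (iN _ Nn) e.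
  by rewrite addr0.
apply/seteqP; split.
  by move=> _ [_ /hY [m [n [Mm Nn ->]]] <-]; rewrite (linD lU); apply: subspaceD => //; [exact/MY/iM|exact/NY/iN].
move=> _ /hY [m [n [Mm Nn ->]]].
move: Mm Nn; rewrite -[in M m]m2 -[in N n]n2 => -[m' Mm' <-] [n' Nn' <-].
by exists (m' + n'); [apply: subspaceD => //; [exact: MY|exact: NY]|rewrite (linD lU)].
Qed.

(** Partial sums of the Neumann series of the resolvent at [l], by telescoping. The remainder
    vanishes for nilpotent [U] and becomes small for quasinilpotent [U]. *)
Lemma geometric_inverse U l p y : lin U -> l != 0 ->
  shift U l (- \sum_(k < p) l^-1 ^+ k.+1 *: iter k U y) = y - l^-1 ^+ p *: iter p U y.
Proof.
move=> lU l0; elim: p => [|p IH].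
  by rewrite big_ord0 oppr0 /shift (lin0 lU) scaler0 subr0 expr0 scale1r subrr.
have lsh : lin (shift U l) by move=> a x z; rewrite /shift lU; lmod.
rewrite big_ord_recr opprD (linB lsh) IH /= (linZ lsh) {1}/shift scalerBr scalerA exprSr -mulrA mulVf // mulr1.
by rewrite -iterS; lmod.
Qed.

Lemma shift_eigen U l p x : lin U -> shift U l x = 0 -> iter p U x = l ^+ p *: x.
Proof.
move=> lU /eqP; rewrite subr_eq0 => /eqP e; elim: p => [|p IH]; first by rewrite expr0 scale1r.
by rewrite iterS IH (linZ lU) e scalerA exprSr.
Qed.

Lemma nilp_shift_bij N U l : subspace N -> lin U -> inv_on N U -> Nilp_on N U -> l != 0 ->
  bij_on N (shift U l).
Proof.
move=> sN lU iN [p hp] l0; split=> [x Nx /(shift_eigen p lU)|].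
  rewrite hp // => /esym/eqP; rewrite scaler_eq0 expf_eq0 (negPf l0) andbF /= => /eqP //.
apply/seteqP; split; first by apply: rng_inv; apply: shift_inv.
move=> y Ny; exists (- \sum_(k < p) l^-1 ^+ k.+1 *: iter k U y).
  by apply: subspaceN => //; apply: subspace_sum => // k; apply: subspaceZ => //; apply: iter_inv.
by rewrite geometric_inverse // hp // scaler0 subr0.
Qed.

Lemma quasinil_Riesz N S : closed_subspace N -> inv_on N S -> blin S -> Quasinil_on N S -> Riesz_on N S.
Proof.
move=> cN iN bS hq l l0; have [sN clN] := cN; have [lS _] := bS.
have nl := nr_gt0 l0.
(* With half of [nr l] as radius, [l^-1 ^+ q *: S ^ q] has norm at most [2^-1 ^+ q] on [N]; choosing
   [q = p.+1] makes this at most one half even for [p = 0]. *)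
have [|p hp] := hq (nr l / 2)%:C%C; first by rewrite ltcR divr_gt0.
have {}hp n x : (p <= n)%N -> N x -> nr (iter n S x) <= (nr l / 2) ^+ n * nr x.
  move=> pn Nx; have := hp n pn x Nx.
  by rewrite !nrE -rmorphXn -rmorphM lecR.
pose q := p.+1.
have h2 : (2^-1 : R) ^+ q <= 2^-1.
  by rewrite exprS; apply: ler_piMr; [lra|apply: exprn_ile1; lra].
have hres y : N y -> nr (l^-1 ^+ q *: iter q S y) <= 2^-1 * nr y.
  move=> Ny; rewrite nrZ nrX nrV.
  apply: (@le_trans _ _ ((nr l)^-1 ^+ q * ((nr l / 2) ^+ q * nr y))).
    by apply: ler_wpM2l; [rewrite exprn_ge0 // invr_ge0 ltW|apply: hp].
  rewrite mulrA -exprMn mulrA mulVf ?gt_eqF // mul1r.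
  by apply: ler_wpM2r; rewrite ?nr_ge0.
have ker0 x : ker_on N (shift S l) x -> x = 0.
  move=> [Nx /(shift_eigen q lS) e]; have := hres x Nx.
  rewrite e scalerA -exprMn mulVf // expr1n scale1r => h.
  by apply: nr_le0; lra.
have hq0 q0 : exists2 K : R, 0 <= K & forall y, nr (\sum_(k < q0) l^-1 ^+ k.+1 *: iter k S y) <= K * nr y.
  elim: q0 => [|q0 [K K0 hK]].
    by exists 0 => // y; rewrite big_ord0 nr0 mul0r.
  have [K' K'0 hK'] := bndP (proj2 (blin_iter q0 bS)).
  exists (K + nr (l^-1 ^+ q0.+1) * K'); first by rewrite addr_ge0 // mulr_ge0 ?nr_ge0 // ltW.
  move=> y; rewrite big_ord_recr /=; apply: (le_trans (nrD _ _)).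
  by rewrite mulrDl lerD // nrZ -mulrA ler_wpM2l ?nr_ge0.
have [K hK hK'] := hq0 q.
have bU := blin_shift l bS.
have th : 0 <= (2^-1 : R) < 1 by apply/andP; split; lra.
have hs : forall y, N y -> exists x, [/\ N x, nr x <= K * nr y, N (y - shift S l x) & nr (y - shift S l x) <= 2^-1 * nr y].
  move=> y Ny; exists (- \sum_(k < q) l^-1 ^+ k.+1 *: iter k S y).
  rewrite geometric_inverse // subKr nrN; split; [|exact: hK'| |exact: hres].
    by apply: subspaceN => //; apply: subspace_sum => // k; apply: subspaceZ => //; apply: iter_inv.
  by apply: subspaceZ => //; apply: iter_inv.
have sur : N `<=` rng_on N (shift S l).
  move=> y /(approx (proj1 bU) (proj2 bU) sN (closed_complete clN) hK th hs) [x [Nx <- _]].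
  by exists x.
have rE : rng_on N (shift S l) = N.
  by apply/seteqP; split=> //; apply: rng_inv; apply: shift_inv.
split; first split.
- by apply/findimP; exists 0%N; apply/dimle0P.
- by rewrite rE.
by apply/(PhiM_dimle cN bU); exists 0%N; apply/dimle0P; rewrite rE.
Qed.

Lemma bij_large Y S : closed_subspace Y -> inv_on Y S -> blin S ->
  exists2 t : R, 0 < t & forall l, t <= nr l -> bij_on Y (shift S l).
Proof.
move=> cY iY bS; have [sY clY] := cY; have [lS /bndP[K K0 hK]] := bS.
(* For [nr l] at least [2 * K], the first approximation [- l^-1 *: y] leaves the residual
   [l^-1 *: S y], of norm at most half that of [y]. *)
exists (2 * K); first lra.
move=> l hl; have nl : 0 < nr l by lra.
have l0 : l != 0 by apply/eqP => e; move: nl; rewrite e nr0 ltxx.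
have bU := blin_shift l bS.
split=> [x Yx /eqP|].
  rewrite subr_eq0 => /eqP e; apply: nr_le0.
  have := hK x; rewrite e nrZ => h.
  have : 2 * K * nr x <= nr l * nr x by apply: ler_wpM2r; rewrite ?nr_ge0.
  have := nr_ge0 x; nra.
apply/seteqP; split; first by apply: rng_inv; apply: shift_inv.
have th : 0 <= (2^-1 : R) < 1 by apply/andP; split; lra.
have c0 : 0 <= (nr l)^-1 by rewrite invr_ge0 ltW.
have hs : forall y, Y y -> exists x, [/\ Y x, nr x <= (nr l)^-1 * nr y, Y (y - shift S l x) & nr (y - shift S l x) <= 2^-1 * nr y].
  move=> y Yy; exists (- (l^-1 *: y)).
  have e : y - shift S l (- (l^-1 *: y)) = l^-1 *: S y.
    rewrite /shift (linN lS) (linZ lS) scalerN scalerA mulfV // scale1r; lmod.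
  rewrite e nrN !nrZ nrV; split=> //.
  - by apply: subspaceN => //; apply: subspaceZ.
  - by apply: subspaceZ => //; apply: iY.
  rewrite mulrC ler_pdivrMr // mulrAC; apply: (le_trans (hK y)).
  by apply: ler_wpM2r; rewrite ?nr_ge0 //; lra.
move=> y /(approx (proj1 bU) (proj2 bU) sY (closed_complete clY) c0 th hs) [x [Yx <- _]].
by exists x.
Qed.

Lemma bij_browder Y U : closed_subspace Y -> inv_on Y U -> lin U -> bij_on Y U -> browder Y U.
Proof.
move=> cY iY lU bU; apply: decomp_on_trivial => //.
by split; [apply/findimP; exists 0%N; exact: dimle_self0|exists 0%N].
Qed.

Lemma Kato_bij_stable Y U : closed_subspace Y -> inv_on Y U -> blin U -> Kato_on Y U ->
  exists2 e : R, 0 < e & forall mu nu, nr mu < e -> nr nu < e -> bij_on Y (shift U mu) -> bij_on Y (shift U nu).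
Proof.
move=> cY iY bU kU; have [e e0 [_ he]] := Kato_stable cY iY bU kU; exists e => // mu nu hm hn.
have i l := shift_inv l (proj1 cY) iY.
move/(bij_onP (i mu)) => [h1 h2]; apply/(bij_onP (i nu)).
by have [k1 k2] := he mu nu 0%N hm hn; split; [exact: k1|exact: k2].
Qed.

(** In Kato's decomposition nonzero shifts of the nilpotent part are bijective, and bijectivity on
    the Kato part is constant near [0]. A decomposition coming from [browder Y U] is unrelated to
    this one; the two are compared through bijectivity on all of [Y]. *)
Lemma browder_near Y U : closed_subspace Y -> inv_on Y U -> blin U -> PhiP_on Y U ->
  exists2 e : R, 0 < e & forall nu, nu != 0 -> nr nu < e -> (bij_on Y (shift U nu) <-> browder Y U).
Proof.
move=> cY iY bU fU; have [M [N [cM cN iM iN [dY kM [fN nN]]]]] := PhiP_decomp cY iY bU fU.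
have [e e0 he] := Kato_bij_stable cM iM bU kM; exists e => // nu nu0 hnu.
have bs l : bij_on Y (shift U l) <-> bij_on M (shift U l) /\ bij_on N (shift U l).
  apply: bij_dsum => //; try by case: cM; case: cN; case: cY.
  - by case: (blin_shift l bU).
  - by apply: shift_inv => //; case: cM.
  - by apply: shift_inv => //; case: cN.
have nb l : l != 0 -> bij_on N (shift U l).
  by move=> l0; apply: nilp_shift_bij => //; [case: cN|case: bU].
split.
  move=> /bs [bM _]; exists M, N; split=> //; split=> //.
  by have := he nu 0 hnu; rewrite nr0 shift0; apply.
move=> [M' [N' [cM' cN' iM' iN' [dY' bM' [fN' nN']]]]].
have [e' e'0 he'] := Kato_bij_stable cM' iM' bU (bij_Kato (proj1 cM') (proj2 cM') bM').
(* A single nonzero shift lying in the discs of both decompositions. *)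
pose r : R := Num.min e e' / 2.
have r0 : 0 < r by rewrite divr_gt0 // lt_min e0.
have re : r < e by have : Num.min e e' <= e by [rewrite ge_min lexx]; rewrite /r; lra.
have re' : r < e' by have : Num.min e e' <= e' by [rewrite ge_min lexx orbT]; rewrite /r; lra.
have nr' : nr (r%:C%C : C) = r by rewrite nr_real ger0_norm // ltW.
have rc : r%:C%C != 0 :> C by apply/eqP => h; move: nr'; rewrite h nr0; lra.
apply/bs; split; last exact: nb.
apply: (he r%:C%C) => //; first by rewrite nr'.
suff : bij_on Y (shift U r%:C%C) by move=> /bs[].
apply/(bij_dsum _ _ _ _ _ _ dY').
- by case: (blin_shift r%:C%C bU).
- by case: cM'.
- by case: cN'.
- by case: cY.
- by apply: shift_inv => //; case: cM'.
- by apply: shift_inv => //; case: cN'.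
split; last by apply: nilp_shift_bij => //; [case: cN'|case: bU].
by apply: (he' 0); rewrite ?nr0 ?nr' // shift0.
Qed.

(* Being a Browder point is a locally constant property along the ray
   [t *: l], [t >= 1], which ends in the resolvent set. *)
Lemma Riesz_browder Y S l : closed_subspace Y -> inv_on Y S -> blin S -> Riesz_on Y S -> l != 0 ->
  browder Y (shift S l).
Proof.
move=> cY iY bS hR l0; have nl := nr_gt0 l0.
pose p (t : R) : C := t%:C%C * l.
have np t : 0 < t -> nr (p t) = t * nr l by move=> t0; rewrite nrM nr_real gtr0_norm.
have p0 t : 0 < t -> p t != 0.
  by move=> t0; apply/eqP => h; have := np t t0; rewrite h nr0; have := mulr_gt0 t0 nl; lra.
have pB t t' : nr (p t' - p t) = `|t' - t| * nr l.
  by rewrite /p -mulrBl -rmorphB nrM nr_real.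
have sp t t' : shift (shift S (p t)) (p t' - p t) = shift S (p t') by rewrite shift_shift addrC subrK.
have bb t : bij_on Y (shift S (p t)) -> browder Y (shift S (p t)).
  apply: bij_browder => //; first by apply: shift_inv => //; case: cY.
  by case: (blin_shift (p t) bS).
have near t : 0 < t -> exists2 d : R, 0 < d & forall t', t' != t -> `|t' - t| < d ->
    (bij_on Y (shift S (p t')) <-> browder Y (shift S (p t))).
  move=> t0; have [||e e0 he] := @browder_near Y (shift S (p t)) cY _ (blin_shift _ bS).
  - by apply: shift_inv => //; case: cY.
  - by have [] := hR _ (p0 t t0).
  exists (e / nr l); first by rewrite divr_gt0.
  move=> t' tt' ht'; have := he (p t' - p t); rewrite sp; apply.
    by apply/eqP => h; move: (pB t t'); rewrite h nr0 => /esym/eqP; rewrite mulf_eq0 normr_eq0 subr_eq0 (negPf tt') gt_eqF.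
  by rewrite pB -ltr_pdivlMr.
have [t1 t10 ht1] := bij_large cY iY bS.
(* At [t = b] the point [p t] is large enough for [bij_large]. *)
pose b : R := Num.max 1 (t1 / nr l).
have b1 : 1 <= b by rewrite le_max lexx.
have bt : t1 / nr l <= b by rewrite le_max lexx orbT.
suff : browder Y (shift S (p 1)) by rewrite /p rmorph1 mul1r.
apply: (@segment_const _ (fun t => browder Y (shift S (p t))) 1 b) => //; last first.
  by apply: bb; apply: ht1; rewrite np ?ler_pdivrMr // -?ler_pdivrMr //; lra.
move=> t /andP[t1' tb]; have [|d d0 hd] := near t; first lra.
exists d => // t' /andP[t1'' tb'] ht'.
have [->//|tt'] := eqVneq t' t.
split; last by move=> /(hd t' tt' ht'); exact: bb.
have [|d' d'0 hd'] := near t'; first lra.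
move=> Bt'.
(* The parameter [t' + s] differs from [t] and [t'] and is close to both, so bijectivity there is
   equivalent to being Browder at either point. *)
pose s : R := Num.min (d' / 2) (Num.min ((d - `|t' - t|) / 2) (`|t' - t| / 2)).
have n0 : 0 < `|t' - t| by rewrite normr_gt0 subr_eq0.
have s0 : 0 < s by rewrite !lt_min !divr_gt0 ?subr_gt0.
have s1 : s <= d' / 2 by rewrite ge_min lexx.
have s2 : s <= (d - `|t' - t|) / 2 by rewrite !ge_min lexx orbT.
have s3 : s <= `|t' - t| / 2 by rewrite !ge_min lexx !orbT.
apply/(hd (t' + s)).
- apply/eqP => h; have : `|t' - t| = s.
    by rewrite -h opprD addrA subrr add0r normrN gtr0_norm.
  by lra.
- rewrite addrAC; apply: (le_lt_trans (ler_normD _ _)); rewrite (gtr0_norm s0); lra.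
apply/(hd' (t' + s)) => //.
- by apply/eqP => h; have : s = 0 by [apply: (@addrI _ t'); rewrite addr0]; lra.
by rewrite addrAC subrr add0r gtr0_norm //; lra.
Qed.

Lemma dimle_mono A W W' n : W `<=` W' -> dimle A W n -> dimle A W' n.
Proof. by move=> h [s hs]; exists s => x /hs [c /h]; exists c. Qed.

(** [k + r] and [r + q] both compute the dimension of [N], with [r] the rank. *)
Lemma rank_nullity N U : subspace N -> blin U -> inv_on N U -> findim N ->
  exists k, rdim (ker_on N U) [set 0] k /\ rdim N (rng_on N U) k.
Proof.
move=> sN bU iN /findimP [d hd]; have s0 := @subspace0 R X; have lU := proj1 bU.
have sK := ker_subspace sN bU; have sR := rng_subspace sN bU.
have [k _ hk] : exists2 k, (k <= d)%N & rdim (ker_on N U) [set 0] k.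
  by apply: dimle_rdim => //; apply: dimle_sub hd; move=> x [].
have [r _ hr] : exists2 r, (r <= d)%N & rdim N (ker_on N U) r.
  by apply: dimle_rdim => //; apply: dimle_mono hd => x ->; case: sK.
have [q _ hq] : exists2 q, (q <= d)%N & rdim N (rng_on N U) q.
  by apply: dimle_rdim => //; apply: dimle_mono hd => x ->; case: sR.
have hr' : rdim (rng_on N U) [set 0] r.
  have [t [Nt it] ht] := hr; exists (fun i => U (t i)).
    split=> [i /Nt ?|c /= hc]; first by exists (t i).
    apply: it; split; first by apply: subspace_sum => // i; apply: subspaceZ => //; apply: Nt.
    by rewrite (lin_sum lU) -[RHS]hc; apply: eq_bigr => i _; rewrite (linZ lU).
  move=> _ [x /ht [c [_ hc]] <-]; exists c => /=; rewrite -[RHS]hc (linB lU) (lin_sum lU).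
  by congr (_ - _); apply: eq_bigr => i _; rewrite (linZ lU).
have h1 : rdim N [set 0] (k + r).
  by apply: (rdim_add s0 _ _ sN sK hk hr); [move=> x ->; case: sK|move=> x []].
have h2 : rdim N [set 0] (r + q).
  by apply: (rdim_add s0 _ _ sN sR hr' hq); [move=> x ->; case: sR|exact: rng_inv].
have kq : k = q by have := rdim_inj s0 h1 h2; lia.
by exists k; split=> //; rewrite kq.
Qed.

Lemma browder_facts Y U : closed_subspace Y -> inv_on Y U -> blin U -> browder Y U ->
  [/\ exists p, forall q, (p <= q)%N -> forall x, Y x -> iter q U x = 0 -> iter p U x = 0,
      fin_descent Y U &
      exists k, rdim (ker_on Y U) [set 0] k /\ rdim Y (rng_on Y U) k].
Proof.
move=> cY iY bU [M [N [cM cN iM iN [dY [bM1 bM2] [fN [p hp]]]]]].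
have sY := proj1 cY; have sM := proj1 cM; have sN := proj1 cN; have lU := proj1 bU.
have lI j : lin (iter j U) by case: (blin_iter j bU).
have [MY NY MN hY] := dY.
have bMI j m : M m -> iter j U m = 0 -> m = 0.
  by elim: j => [//|j IH] Mm /bM1 h; apply: IH => //; apply: h; exact: (iter_inv j iM Mm).
have rMI j : rng_on M (iter j U) = M.
  by elim: j => [|j IH]; [rewrite rng_iter0|rewrite rng_iterS IH].
have hp' j n : (p <= j)%N -> N n -> iter j U n = 0.
  by move=> pj Nn; rewrite -(subnK pj) iterD hp // (lin0 (lI _)).
split.
- exists p => q pq _ /hY [m [n [Mm Nn ->]]]; rewrite !(linD (lI _)) (hp' q n) // addr0 => /(bMI q _ Mm) ->.
  by rewrite (lin0 (lI _)) add0r hp.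
- exists p; have rE j : (p <= j)%N -> rng_on Y (iter j U) = M.
    move=> pj; apply/seteqP; split.
      move=> _ [_ /hY [m [n [Mm Nn ->]]] <-]; rewrite (linD (lI _)) [X in _ + X]hp' // addr0.
      exact: iter_inv.
    by rewrite -[X in X `<=` _](rMI j) => _ [m Mm <-]; exists m => //; apply: MY.
  by rewrite !rE.
have [k [hk1 hk2]] := rank_nullity sN bU iN fN; exists k; split.
  suff -> : ker_on Y U = ker_on N U by [].
  apply/seteqP; split=> x [Yx Ux]; last by split=> //; apply: NY.
  have [m [n [Mm Nn e]]] := hY x Yx; split=> //; rewrite e.
  move: Ux; rewrite e (linD lU) => e'.
  have [/(bM1 _ Mm) -> _] := dsum_uniq0 sM sN dY (iM _ Mm) (iN _ Nn) e'.
  by rewrite add0r.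
have [s [Ns is_] hs] := hk2; exists s.
  split=> [i /Ns/NY //|c [_ /hY [m [n [Mm Nn ->]]]]].
  rewrite (linD lU) => e; apply: is_; exists n => //.
  have Sn : N (\sum_(i < k) c i *: s i) by apply: subspace_sum => // i; apply: subspaceZ => //; apply: Ns.
  by have [] := dsum_uniq sM sN dY (iM _ Mm) (iN _ Nn) (proj1 sM) Sn (etrans e (esym (add0r _))).
move=> _ /hY [m [n [Mm Nn ->]]]; have [c [n' Nn' e]] := hs n Nn.
move: Mm; rewrite -[in M m]bM2 => -[m' Mm' <-].
exists c, (m' + n'); first by apply: subspaceD => //; [exact: MY|exact: NY].
by rewrite (linD lU) e addrA.
Qed.

End Browder.

(** * Kato plus Riesz operators *)

Section Classes.
Context {R : realType} {X : completeNormedModType R[i]}.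
Local Notation C := R[i].
Ltac lmod := lmod_gen (R[i] : comNzRingType) (X : lmodType R[i]).
Implicit Types (A B D W Y M N Z : set X) (S U T : X -> X) (l mu nu : C).

Lemma ker_dsum Y M N U : subspace M -> subspace N -> lin U -> inv_on M U -> inv_on N U -> dsum Y M N ->
  subspace Y -> ker_on Y U = setsum (ker_on M U) (ker_on N U).
Proof.
move=> sM sN lU iM iN h sY; have [MY NY _ hY] := h; apply/seteqP; split.
  move=> _ [/hY [m [n [Mm Nn ->]]]]; rewrite (linD lU) => e.
  by have [e1 e2] := dsum_uniq0 sM sN h (iM _ Mm) (iN _ Nn) e; exists m, n.
move=> _ [m [n [[Mm e1] [Nn e2] ->]]]; split; last by rewrite (linD lU) e1 e2 addr0.
by apply: subspaceD => //; [exact: MY|exact: NY].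
Qed.

Lemma rng_dsum Y M N U : lin U -> subspace Y -> dsum Y M N ->
  rng_on Y U = setsum (rng_on M U) (rng_on N U).
Proof.
move=> lU sY [MY NY _ hY]; apply/seteqP; split.
  move=> _ [_ /hY [m [n [Mm Nn ->]]] <-]; exists (U m), (U n); split; [by exists m|by exists n|].
  by rewrite (linD lU).
move=> _ [_ [_ [[m Mm <-] [n Nn <-] ->]]]; exists (m + n); last by rewrite (linD lU).
by apply: subspaceD => //; [exact: MY|exact: NY].
Qed.

Lemma closed_rng_dsum Y M N U : closed_subspace Y -> closed_subspace M -> closed_subspace N ->
  blin U -> inv_on M U -> inv_on N U -> dsum Y M N ->
  closed (rng_on M U) -> closed (rng_on N U) -> closed (rng_on Y U).
Proof.
move=> cY cM cN bU iM iN h cRM cRN; rewrite (rng_dsum (proj1 bU) (proj1 cY) h).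
apply: (closed_setsum cY cM cN h) => //; try exact: rng_inv.
  by apply: rng_subspace => //; case: cM.
by apply: rng_subspace => //; case: cN.
Qed.

Lemma Phi_dsum Y M N U : closed_subspace Y -> closed_subspace M -> closed_subspace N ->
  blin U -> inv_on M U -> inv_on N U -> dsum Y M N -> Phi_on M U -> Phi_on N U -> Phi_on Y U.
Proof.
move=> cY cM cN bU iM iN h [[f1 c1] /(PhiM_dimle cM bU) [p hp]] [[f2 c2] /(PhiM_dimle cN bU) [q hq]].
have [_ _ _ hY] := h.
split; first split.
- rewrite (ker_dsum (proj1 cM) (proj1 cN) (proj1 bU) iM iN h (proj1 cY)); exact: findim_setsum.
- exact: closed_rng_dsum h c1 c2.
apply/(PhiM_dimle cY bU); exists (p + q)%N; rewrite (rng_dsum (proj1 bU) (proj1 cY) h).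
by apply: dimle_sub (dimle_setsum hp hq).
Qed.

Lemma findim_Phi N U : closed_subspace N -> blin U -> inv_on N U -> findim N -> Phi_on N U.
Proof.
move=> cN bU iN /findimP [d hd]; have sR := rng_subspace (proj1 cN) bU.
have hM : PhiM_on N U.
  by apply/(PhiM_dimle cN bU); exists d; apply: dimle_mono hd => x ->; case: sR.
split=> //; split; last exact: PhiM_closed.
by apply/findimP; exists d; apply: dimle_sub hd => x [].
Qed.

(* [a m] stands for: the nullity is at most [m], and [b n] for: the defect is at
   most [n]; an infinite value satisfies none of them. *)
Definition cond (r : clsA) (a b : nat -> Prop) : Prop :=
  match r with
  | cBP => a 0%N | cBM => b 0%N | cB => a 0%N /\ b 0%N
  | cPhiP => exists m, a m | cPhiM => exists n, b n | cPhi => (exists m, a m) /\ exists n, b n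
  | cWP => (exists m, a m) /\ forall n, b n -> a n
  | cWM => (exists n, b n) /\ forall n, a n -> b n
  | cW => [/\ exists m, a m, exists n, b n & forall n, a n <-> b n]
  end.

(* [U] is Kato on [M] and Browder on [N]: the contribution of [N] to the
   nullity and to the defect is the same, so that each class is decided by [M]. *)
Section Kato_plus_browder.
Variables (Y M N : set X) (U : X -> X).
Hypotheses (cY : closed_subspace Y) (cM : closed_subspace M) (cN : closed_subspace N).
Hypotheses (bU : blin U) (iM : inv_on M U) (iN : inv_on N U) (h : dsum Y M N).
Hypotheses (kM : Kato_on M U) (fN : Phi_on N U) (bN : browder N U).

Let a m := dimle (ker_on M U) [set 0] m.
Let b n := dimle M (rng_on M U) n.
Let sY : subspace Y := proj1 cY.
Let sM : subspace M := proj1 cM.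
Let sN : subspace N := proj1 cN.
Let lU : lin U := proj1 bU.
Let lI j : lin (iter j U) := proj1 (blin_iter j bU).
Let MY : M `<=` Y. Proof. by case: h. Qed.
Let NY : N `<=` Y. Proof. by case: h. Qed.
Let hY x : Y x -> exists m n, [/\ M m, N n & x = m + n]. Proof. by case: h => _ _ _; apply. Qed.

Lemma closed_rngY : closed (rng_on Y U).
Proof. by apply: (closed_rng_dsum cY cM cN bU iM iN h); [case: kM|case: fN => -[]]. Qed.

(** [k] is at once the nullity and the defect of [U] on [N], which agree because [U] is Browder
    there; it cancels from every comparison of nullity with defect. *)
Lemma KB_dims : exists k,
  (forall p, rdim (ker_on M U) [set 0] p -> rdim (ker_on Y U) [set 0] (p + k)) /\
  (forall q, rdim M (rng_on M U) q -> rdim Y (rng_on Y U) (q + k)).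
Proof.
have [_ _ [k [hk1 hk2]]] := browder_facts cN iN bU bN; exists k.
have s0 := @subspace0 R X; have sKM := ker_subspace sM bU; have sKY := ker_subspace sY bU.
have sRM := rng_subspace sM bU; have sRN := rng_subspace sN bU; have sRY := rng_subspace sY bU.
have kE := ker_dsum sM sN lU iM iN h sY; have rE := rng_dsum lU sY h.
split=> [p hp|q hq].
  apply: (rdim_add s0 _ _ sKY sKM hp); first by move=> x ->; case: sKM.
    by move=> x [Mx Ux]; split=> //; apply: MY.
  have [s [Ks is_] hs] := hk1; exists s.
    split=> [i /Ks [Ni Ui]|c [Mc _]]; first by split=> //; apply: NY.
    apply: is_; have Nc : N (\sum_(i < k) c i *: s i).
      by apply: subspace_sum => // i; apply: subspaceZ => //; case: (Ks i (ltn_ord i)).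
    by have [_ _ MN _] := h; rewrite -MN.
  rewrite kE => _ [m [n [Km /hs [c /= hc] ->]]]; exists c.
  by rewrite -addrA hc addr0.
(* The defect is counted in two layers: [M + U N] modulo [U Y] contributes the defect on [M], and
   [Y] modulo [M + U N] the defect on [N]. *)
have sB : subspace (setsum M (rng_on N U)) by apply: setsum_subspace.
apply: (@rdim_add _ _ _ (setsum M (rng_on N U))) => //.
- rewrite rE => _ [x [y [Rx Ry ->]]]; exists x, y; split=> //; exact: rng_inv Rx.
- move=> _ [m [n [Mm Rn ->]]]; apply: subspaceD => //; first exact: MY.
  by apply: NY; apply: rng_inv Rn.
- have [s [Ms is_] hs] := hq; exists s.
    split=> [i /Ms Mi|c]; first by exists (s i), 0; rewrite addr0; split=> //; case: sRN.
    rewrite rE => -[x [y [Rx Ry e]]]; apply: is_.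
    have Mc : M (\sum_(i < q) c i *: s i) by apply: subspace_sum => // i; apply: subspaceZ => //; apply: Ms.
    have [-> _] // := dsum_uniq sM sN h Mc (proj1 sN) (rng_inv iM Rx) (rng_inv iN Ry) (etrans (addr0 _) e).
  move=> _ [m [n [/hs [c hc] Rn ->]]]; exists c; rewrite rE addrAC.
  by exists (m - \sum_(i < q) c i *: s i), n.
have [s [Ns is_] hs] := hk2; exists s.
  split=> [i /Ns /NY//|c [m [n [Mm Rn e]]]]; apply: is_.
  have Nc : N (\sum_(i < k) c i *: s i) by apply: subspace_sum => // i; apply: subspaceZ => //; apply: Ns.
  have [_ ->] // := dsum_uniq sM sN h (proj1 sM) Nc Mm (rng_inv iN Rn) (etrans (add0r _) e).
move=> _ /hY [m [n [Mm /hs [c hc] ->]]]; exists c.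
by exists m, (n - \sum_(i < k) c i *: s i); rewrite addrA.
Qed.

Lemma KB_PhiP : PhiP_on Y U <-> exists m, a m.
Proof.
split=> [[/findimP [n hn] _]|[m hm]].
  by exists n; apply: dimle_sub hn => x [Mx Ux]; split=> //; apply: MY.
split; last exact: closed_rngY.
have [k [hk _]] := KB_dims; have [p _ hp] := dimle_rdim (@subspace0 R X) hm.
by apply/findimP; exists (p + k)%N; apply: rdim_dimle; apply: hk.
Qed.

Lemma KB_PhiM : PhiM_on Y U <-> exists n, b n.
Proof.
have sRM := rng_subspace sM bU; have sRY := rng_subspace sY bU.
split=> [/(PhiM_dimle cY bU) [n hn]|[n hn]].
  exists n; case: (dim_dich M n.+1 sRM) => [[m mn /rdim_dimle]|[t [Mt it]]]; first exact: dimle_widen.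
  have : indep Y (rng_on Y U) n.+1 t.
    split=> [i /Mt/MY//|c [_ /hY [m [n' [Mm Nn ->]]]]]; rewrite (linD lU) => e; apply: it.
    have Mc : M (\sum_(i < n.+1) c i *: t i) by apply: subspace_sum => // i; apply: subspaceZ => //; apply: Mt.
    have [e1 _] := dsum_uniq sM sN h (iM Mm) (iN Nn) Mc (proj1 sN) (etrans e (esym (addr0 _))).
    by exists m.
  by move=> it'; have := indep_le sRY it' hn; rewrite ltnn.
have [k [_ hk]] := KB_dims; have [p _ hp] := dimle_rdim sRM hn.
by exists (p + k)%N; apply/codim_inP => //; apply: hk.
Qed.

Lemma KB_nullity : (exists m, a m) -> forall k, 
  (forall p, rdim (ker_on M U) [set 0] p -> rdim (ker_on Y U) [set 0] (p + k)) ->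
  exists p, (forall m, a m <-> (p <= m)%N) /\ forall m, dim_is (ker_on Y U) m <-> m = (p + k)%N.
Proof.
move=> [m hm] k hk; have s0 := @subspace0 R X; have [p _ hp] := dimle_rdim s0 hm.
exists p; split=> m'; first split=> [hm'|pm]; first exact: rdim_le hp hm'.
  by apply: dimle_widen pm (rdim_dimle hp).
rewrite dim_isP; split=> [h'|->]; last exact: hk.
exact: rdim_inj s0 h' (hk _ hp).
Qed.

Lemma KB_defect : (exists n, b n) -> forall k, 
  (forall q, rdim M (rng_on M U) q -> rdim Y (rng_on Y U) (q + k)) ->
  exists q, (forall n, b n <-> (q <= n)%N) /\ forall n, codim_in Y (rng_on Y U) n <-> n = (q + k)%N.
Proof.
move=> [m hm] k hk; have sRM := rng_subspace sM bU; have sRY := rng_subspace sY bU.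
have [p _ hp] := dimle_rdim sRM hm.
exists p; split=> m'; first split=> [hm'|pm]; first exact: rdim_le hp hm'.
  by apply: dimle_widen pm (rdim_dimle hp).
rewrite codim_inP //; split=> [h'|->]; last exact: hk.
exact: rdim_inj sRY h' (hk _ hp).
Qed.

(** On the Kato part finite ascent means injectivity: a kernel vector is [U ^ p m], so [m] lies in
    the kernel of [U ^ p.+1], which is that of [U ^ p]. *)
Lemma KB_ascent : fin_ascent Y U <-> a 0%N.
Proof.
split=> [[p hp]|/dimle0P hi].
  apply/dimle0P => x kx; have [m Mm e] := (proj2 kM) p x kx.
  have : ker_on Y (iter p.+1 U) m by split; [exact: MY|rewrite iterS e; case: kx].
  by rewrite -hp => -[_ e']; rewrite /= -e.
have [[p hp] _ _] := browder_facts cN iN bU bN; exists p.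
have inj j m : M m -> iter j U m = 0 -> m = 0.
  elim: j => [//|j IH] Mm hm; apply: IH => //; apply: hi; split=> //.
  exact: (iter_inv j iM Mm).
apply/seteqP; split=> x [Yx hx]; split=> //; first by rewrite iterS hx (lin0 lU).
move: hx; have [m [n [Mm Nn ->]]] := hY Yx; rewrite !(linD (lI _)) => e.
have [e1 e2] := dsum_uniq0 sM sN h (iter_inv p.+1 iM Mm) (iter_inv p.+1 iN Nn) e.
by rewrite (inj _ _ Mm e1) (hp p.+1 _ _ Nn e2) // (lin0 (lI _)) addr0.
Qed.

(** On the Kato part finite descent means surjectivity: if [U ^ q m = U ^ q.+1 m'], then [m - U m']
    is in the kernel of [U ^ q], hence in the hyperrange and in the range. *)
Lemma KB_descent : fin_descent Y U <-> b 0%N.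
Proof.
split=> [[q hq]|/dimle0P hs].
  apply/dimle0P => m Mm.
  have : rng_on Y (iter q U) (iter q U m) by exists m => //; apply: MY.
  rewrite hq => -[_ /hY [m' [n' [Mm' Nn' ->]]]]; rewrite (linD (lI _)) => e.
  have [e1 _] := dsum_uniq sM sN h (iter_inv q.+1 iM Mm') (iter_inv q.+1 iN Nn') (iter_inv q iM Mm) (proj1 sN)
    (etrans e (esym (addr0 _))).
  have : ker_on M (iter q U) (m - U m').
    split; first by apply: subspaceB => //; apply: iM.
    by rewrite (linB (lI _)) -iterSr e1 subrr.
  move/(Yinf_ker_iter cM iM bU kM)/(_ 1%N); rewrite rng_iterS rng_iter0 => Rm.
  rewrite -(subrK (U m') m); apply: subspaceD => //; first exact: rng_subspace.
  by exists m'.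
have [_ [q hq] _] := browder_facts cN iN bU bN; exists q.
have rM j : rng_on M (iter j U) = M.
  elim: j => [|j IH]; first by rewrite rng_iter0.
  by rewrite rng_iterS IH; apply/seteqP; split=> //; apply: rng_inv.
apply/seteqP; split; last by move=> _ [x Yx <-]; rewrite iterSr; exists (U x) => //;
  move: Yx => /hY [m [n [Mm Nn ->]]]; rewrite (linD lU); apply: subspaceD => //; [exact/MY/iM|exact/NY/iN].
move=> _ [_ /hY [m [n [Mm Nn ->]]] <-]; rewrite (linD (lI _)).
have : rng_on M (iter q.+1 U) (iter q U m) by rewrite rM; apply: (iter_inv q iM Mm).
have : rng_on N (iter q.+1 U) (iter q U n) by rewrite -hq; exists n.
move=> [n' Nn' <-] [m' Mm' <-]; exists (m' + n'); last by rewrite (linD (lI _)).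
by apply: subspaceD => //; [exact: MY|exact: NY].
Qed.

(** The Weyl classes compare a dimension with a codimension when both are finite. The common summand
    [k] cancels, and the comparison of two numbers becomes an implication between their upper
    bounds. *)
Lemma clsA_cond r : clsA_on r Y U <-> cond r a b.
Proof.
have hP := KB_PhiP; have hM := KB_PhiM; have hA := KB_ascent; have hD := KB_descent.
have [k [hk1 hk2]] := KB_dims.
have ex0 (p : nat -> Prop) : p 0%N -> exists m, p m by exists 0%N.
case: r => /=; rewrite /BP_on /BM_on /B_on /Phi_on /WP_on /WM_on /W_on /Phi_on ?hP ?hM ?hA ?hD.
- by split=> [[]//|a0]; split=> //; exact: ex0.
- by split=> [[]//|a0]; split=> //; exact: ex0.
- by split=> [[_ []]//|[a0 b0]]; split=> //; split; exact: ex0.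
- by [].
- by [].
- by [].
- split=> [[ea hw]|[ea hw]]; split=> //.
    move=> n bn; have [p [ap kp]] := KB_nullity ea hk1.
    have [q [bq cq]] := KB_defect (ex_intro _ n bn) hk2.
    apply/ap; have /bq qn := bn; apply: leq_trans qn.
    by rewrite -(leq_add2r k); apply: hw; [apply/kp|apply/cq].
  move=> m n; have [p [ap kp]] := KB_nullity ea hk1; move=> /kp -> hn.
  have eb : exists n, b n by apply/hM; exists n.
  have [q [bq cq]] := KB_defect eb hk2; move/cq: hn => ->.
  by rewrite leq_add2r; apply/ap; apply: hw; apply/bq.
- split=> [[eb hw]|[eb hw]]; split=> //.
    move=> n an; have [q [bq cq]] := KB_defect eb hk2.
    have [p [ap kp]] := KB_nullity (ex_intro _ n an) hk1.
    apply/bq; have /ap pn := an; apply: leq_trans pn.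
    by rewrite -(leq_add2r k); apply: hw; [apply/kp|apply/cq].
  move=> m n hm; have [q [bq cq]] := KB_defect eb hk2; move=> /cq ->.
  have ea : exists n, a n.
    by apply/hP; split; [exists m; move: hm => [s [_ [_ hs]]]; exists s|exact: closed_rngY].
  have [p [ap kp]] := KB_nullity ea hk1; move/kp: hm => ->.
  by rewrite leq_add2r; apply/bq; apply: hw; apply/ap.
split=> [[[ea eb] hw]|[ea eb hw]].
  split=> // n; have [q [bq cq]] := KB_defect eb hk2; have [p [ap kp]] := KB_nullity ea hk1.
  have : (p + k = q + k)%N by apply: hw; [apply/kp|apply/cq].
  by move/addIn => pq; rewrite ap bq pq.
split=> // m n; have [q [bq cq]] := KB_defect eb hk2; have [p [ap kp]] := KB_nullity ea hk1.
move=> /kp -> /cq ->; congr (_ + _)%N; apply/eqP; rewrite eqn_leq.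
by apply/andP; split; [apply/ap/hw/bq|apply/bq/hw/ap].
Qed.
End Kato_plus_browder.

End Classes.

(** * Spectra *)

Section Spectra.
Context {R : realType} {X : completeNormedModType R[i]}.
Local Notation C := R[i].
Implicit Types (M N Y : set X) (S T U : X -> X) (l mu nu : C).

Lemma closed_subspaceT : closed_subspace [set: X].
Proof. by split; [|exact: closedT]. Qed.

Lemma decompE S P Q : decomp S P Q <-> decomp_on [set: X] S P Q.
Proof.
split=> -[M [N [cM cN iM iN hh]]]; exists M, N; split=> //.
- by move=> x Mx; apply: iM; exists x.
- by move=> x Nx; apply: iN; exists x.
- by have [MN hX PM QN] := hh.
- by move=> _ [x Mx <-]; exact: iM.
- by move=> _ [x Nx <-]; exact: iN.
by have [[_ _ MN hX] PM QN] := hh; split=> // x; exact: hX.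
Qed.

Lemma decomp_on_mono Y S (P Q P' Q' : set X -> Prop) :
  (forall M, closed_subspace M -> inv_on M S -> P M -> P' M) ->
  (forall N, closed_subspace N -> inv_on N S -> Q N -> Q' N) ->
  decomp_on Y S P Q -> decomp_on Y S P' Q'.
Proof.
move=> hP hQ [M [N [cM cN iM iN [dY PM QN]]]]; exists M, N; split=> //; split=> //.
  exact: hP.
exact: hQ.
Qed.

Lemma GKRD_punctured S (r : clsA) : blin S -> GKRD S ->
  exists2 e : R, 0 < e & forall mu nu, mu != 0 -> nu != 0 -> nr mu < e -> nr nu < e ->
    clsA_on r setT (shift S mu) -> clsA_on r setT (shift S nu).
Proof.
move=> bS /decompE [M [N [cM cN iM iN [dX kM rN]]]].
have [e e0 [hK he]] := Kato_stable cM iM bS kM; exists e => // mu nu m0 n0 hm hn.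
pose a l m := dimle (ker_on M (shift S l)) [set 0] m.
pose b l m := dimle M (rng_on M (shift S l)) m.
have cE l : l != 0 -> nr l < e -> clsA_on r setT (shift S l) <-> cond r (a l) (b l).
  move=> l0 hl; apply: (clsA_cond closed_subspaceT cM cN (blin_shift l bS) _ _ dX).
  - by apply: shift_inv => //; case: cM.
  - by apply: shift_inv => //; case: cN.
  - exact: hK.
  - exact: rN.
  - exact: Riesz_browder.
have aE : a mu = a nu.
  apply/funext => m; apply/propext; split=> h.
    by have [k _] := he mu nu m hm hn; apply: k.
  by have [k _] := he nu mu m hn hm; apply: k.
have bE : b mu = b nu.
  apply/funext => m; apply/propext; split=> h.
    by have [_ k] := he mu nu m hm hn; apply: k.
  by have [_ k] := he nu mu m hn hm; apply: k.
by rewrite !cE // aE bE.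
Qed.

Lemma GKRD_not_accp T (r : clsA) l : blin T -> GKRD (shift T l) ->
  (forall e : R, 0 < e -> exists mu, [/\ mu != l, nr (mu - l) < e & clsA_on r setT (shift T mu)]) ->
  ~ accp (spec (clsA_on r setT) T) l.
Proof.
move=> bT gT hmu /accpP hacc.
have [e e0 he] := GKRD_punctured r (blin_shift l bT) gT.
have [mu [ml hm cm]] := hmu e e0; have [nu [cn nl hn]] := hacc e e0.
apply: cn; have := he (mu - l) (nu - l); rewrite !subr_eq0 !shift_shift ![l + _]addrC !subrK.
by apply.
Qed.

Lemma clsA_semiFredholm r Y U : clsA_on r Y U -> PhiP_on Y U \/ PhiM_on Y U.
Proof.
case: r => /=.
- by move=> [h _]; left.
- by move=> [h _]; right.
- by move=> [[h _] _]; left.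
- by left.
- by right.
- by move=> [h _]; left.
- by move=> [h _]; left.
- by move=> [h _]; right.
by move=> [[h _] _]; left.
Qed.

Lemma clsA_decomp r Y U : closed_subspace Y -> inv_on Y U -> blin U -> clsA_on r Y U ->
  decomp_on Y U (fun M => Kato_on M U) (fun N => findim N /\ Nilp_on N U).
Proof.
by move=> cY iY bU /clsA_semiFredholm [h|h]; [exact: PhiP_decomp|exact: PhiM_decomp].
Qed.

Lemma clsA_closed r Y U : closed_subspace Y -> inv_on Y U -> blin U -> clsA_on r Y U ->
  closed (rng_on Y U).
Proof.
by move=> cY iY bU /clsA_semiFredholm [[]//|h]; exact: PhiM_closed.
Qed.

Lemma Nilp_Quasinil N U : Nilp_on N U -> inv_on N U -> blin U -> Quasinil_on N U.
Proof.
move=> [p hp] iN bU e e0; exists p => n pn x Nx.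
have lI j : lin (iter j U) by case: (blin_iter j bU).
rewrite -(subnK pn) iterD hp // (lin0 (lI _)) normr0.
by rewrite mulr_ge0 // exprn_ge0 // ltW.
Qed.

Lemma EssKato_KatoType S : EssKato S -> KatoType S.
Proof. by move=> /decompE h; apply/decompE; apply: decomp_on_mono h => // N _ _ []. Qed.

Lemma KatoType_GKD S : blin S -> KatoType S -> GKD S.
Proof.
move=> bS /decompE h; apply/decompE; apply: decomp_on_mono h => // N _ iN nN.
exact: Nilp_Quasinil.
Qed.

Lemma GKD_GKRD S : blin S -> GKD S -> GKRD S.
Proof.
move=> bS /decompE h; apply/decompE; apply: decomp_on_mono h => // N cN iN.
exact: quasinil_Riesz.
Qed.

Lemma Kato_EssKato S : blin S -> Kato_on setT S -> EssKato S.
Proof.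
move=> [lS _] kS; apply/decompE; apply: (decomp_on_trivial closed_subspaceT _ lS) => //.
by split; [apply/findimP; exists 0%N; exact: dimle_self0|exists 0%N].
Qed.

Lemma Riesz0 S : blin S -> Riesz_on [set 0] S.
Proof.
move=> bS l _; apply: findim_Phi; [exact: closed_subspace0|exact: blin_shift| |].
  by move=> x ->; apply: (lin0 (proj1 (blin_shift l bS))).
by apply/findimP; exists 0%N; exact: dimle_self0.
Qed.

Lemma gDR_sub (P : set X -> (X -> X) -> Prop) T : blin T ->
  sigma_gDR P T `<=` spec (P setT) T.
Proof.
move=> bT l nd Pl; apply: nd; have bS := blin_shift l bT.
apply/decompE; apply: (decomp_on_trivial closed_subspaceT _ (proj1 bS)) => //.
exact: Riesz0.
Qed.

(** The finite-dimensional nilpotent part of the summand in the class is moved to the Riesz part,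
    which stays Riesz because operators on a finite-dimensional space are Fredholm. *)
Lemma clsA_gDR_GKRD r S : blin S ->
  decomp S (fun M => clsA_on r M S) (fun N => Riesz_on N S) -> GKRD S.
Proof.
move=> bS /decompE [M [N [cM cN iM iN [dX hM hN]]]]; apply/decompE.
apply: (decomp_on_refine closed_subspaceT cM cN (proj1 bS) iN dX (clsA_decomp cM iM bS hM)).
move=> N' cN' cNN iN' dN [fN' _] l l0.
have bU := blin_shift l bS.
have iN'l : inv_on N' (shift S l) by apply: shift_inv => //; case: cN'.
have iNl : inv_on N (shift S l) by apply: shift_inv => //; case: cN.
by apply: (Phi_dsum cNN cN' cN bU iN'l iNl dN); [exact: findim_Phi|exact: hN].
Qed.

Lemma BddBelow_nr Y U : BddBelow_on Y U -> exists2 c : R, 0 < c & forall x, Y x -> c * nr x <= nr (U x).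
Proof.
move=> [c [/C_gt0 [r r0 ->] h]]; exists r => // x Yx.
by have := h x Yx; rewrite !nrE -rmorphM lecR.
Qed.

Lemma BddBelow_ker Y U x : BddBelow_on Y U -> Y x -> U x = 0 -> x = 0.
Proof.
move=> /BddBelow_nr [c c0 h] Yx Ux; apply: nr_le0.
by have := h x Yx; rewrite Ux nr0 pmulr_rle0.
Qed.

Lemma BddBelow_closed Y U : closed_subspace Y -> blin U -> BddBelow_on Y U -> closed (rng_on Y U).
Proof.
move=> cY bU /BddBelow_nr [c c0 h].
apply: (@lifts_closed_rng _ _ Y U c^-1 cY bU); first by rewrite invr_ge0 ltW.
by move=> x Yx; exists x; split=> //; rewrite mulrC ler_pdivlMr // mulrC; apply: h.
Qed.

Lemma Inv_bij Y U : subspace Y -> lin U -> Inv_on Y U -> inv_on Y U -> bij_on Y U.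
Proof.
move=> [Y0 _] lU [g [hg _]] iY; split=> [x Yx Ux|].
  by have [_ _ <-] := hg x Yx; have [_ _] := hg 0 Y0; rewrite Ux (lin0 lU).
apply/seteqP; split; first exact: rng_inv.
by move=> y Yy; have [Yg Ug _] := hg y Yy; exists (g y).
Qed.

Lemma inj_PhiP Y U : closed (rng_on Y U) -> (forall x, Y x -> U x = 0 -> x = 0) -> PhiP_on Y U.
Proof.
by move=> cR hi; split=> //; apply/findimP; exists 0%N; apply/dimle0P => x [Yx /hi]; apply.
Qed.

Lemma surj_PhiM Y U : closed_subspace Y -> blin U -> rng_on Y U = Y -> PhiM_on Y U.
Proof.
by move=> cY bU rE; apply/(PhiM_dimle cY bU); exists 0%N; apply/dimle0P; rewrite rE.
Qed.

Lemma inj_ascent Y U : subspace Y -> lin U -> (forall x, Y x -> U x = 0 -> x = 0) -> fin_ascent Y U.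
Proof.
move=> [Y0 _] lU hi; exists 0%N; apply/seteqP; split=> x [Yx]; last first.
  by move=> /= Ux; split=> //=; apply: hi.
by move=> /= ->; split=> //=; rewrite (lin0 lU).
Qed.

Lemma surj_descent Y U : rng_on Y U = Y -> fin_descent Y U.
Proof. by move=> rE; exists 0%N; rewrite rng_iterS rng_iter0 rE. Qed.

(** Recasts the second class of each pair as one of the nine, so that [GKRD_not_accp] covers both
    halves of the theorem. *)
Definition partner (r : clsB) : clsA := match r with cM => cBP | cQ => cBM | cInv => cB end.

Lemma partnerE r : @clsB_partner R X r = clsA_on (partner r).
Proof. by case: r. Qed.

Lemma clsB_partner_on r Y U : closed_subspace Y -> inv_on Y U -> blin U ->
  clsB_on r Y U -> clsA_on (partner r) Y U.
Proof.
move=> cY iY bU; have lU := proj1 bU; have [sY clY] := cY; case: r => /= h.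
- have hi x := BddBelow_ker (x:=x) h.
  by split; [apply: inj_PhiP => //; exact: BddBelow_closed|exact: inj_ascent].
- by split; [exact: surj_PhiM|exact: surj_descent].
have [hi hs] := Inv_bij sY lU h iY; split; first split.
- by apply: inj_PhiP => //; rewrite hs.
- exact: surj_PhiM.
by split; [exact: inj_ascent|exact: surj_descent].
Qed.

Lemma surj_Kato Y U : closed Y -> rng_on Y U = Y -> Kato_on Y U.
Proof.
move=> cY rE; split; first by rewrite rE.
move=> n x [Yx _]; suff -> : rng_on Y (iter n U) = Y by [].
by elim: n => [|n IH]; [rewrite rng_iter0|rewrite rng_iterS IH].
Qed.

Lemma clsB_Kato r Y U : closed_subspace Y -> inv_on Y U -> blin U -> clsB_on r Y U -> Kato_on Y U.
Proof.
move=> cY iY bU; have [sY clY] := cY; case: r => /= h.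
- split; first exact: BddBelow_closed.
  move=> n x [Yx /(BddBelow_ker h Yx) ->].
  by have [] := rng_subspace sY (blin_iter n bU).
- exact: surj_Kato.
by apply: bij_Kato => //; apply: Inv_bij => //; case: bU.
Qed.

Lemma bdry_approx (P : (X -> X) -> Prop) T l : spec P T l -> bdry (spec P T) l ->
  forall e : R, 0 < e -> exists mu, [/\ mu != l, nr (mu - l) < e & P (shift T mu)].
Proof.
move=> sl [_ /clos_ptP h] e e0; have [mu nmu hmu] := h e e0; have Pmu := contrapT nmu.
by exists mu; split=> //; apply/eqP => ml; apply: sl; rewrite -ml.
Qed.

Lemma spec_sub (P Q : (X -> X) -> Prop) T : (forall l, P (shift T l) -> Q (shift T l)) ->
  spec Q T `<=` spec P T.
Proof. by move=> h l nQ /h. Qed.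

End Spectra.

Theorem theorem3p21 (R : realType) (X : completeNormedModType R[i])
  (T : {linear X -> X}) :
  ~ findim [set: X] -> continuous T ->
  (forall r : clsA,
     let sR := spec (clsA_on r setT) T in
     sR = bdry sR -> sR = accp sR ->
     [/\ sigma_ec T `<=` sigma_gKR T, sigma_gKR T = sigma_gK T,
         sigma_gK T = sigma_Kt T, sigma_Kt T = sigma_eK T &
         sigma_eK T = sR /\ sR = sigma_gDR (clsA_on r) T]) /\
  (forall r : clsB,
     let sR := spec (clsB_on r setT) T in
     let sR' := spec (clsB_partner r setT) T in
     sR = bdry sR -> bdry sR `<=` accp sR' ->
     [/\ sigma_ec T `<=` sigma_gKR T, sigma_gKR T = sigma_gK T,
         sigma_gK T = sigma_Kt T, sigma_Kt T = sigma_eK T &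
         [/\ sigma_eK T = sigma_K T, sigma_K T = sR & sR = sigma_gDR (clsB_on r) T]]).
Proof.
move=> _ cT.
have bT : blin T by split; [move=> a x y; rewrite linearP|exact: continuous_bnd].
have bS l : blin (shift T l) by exact: blin_shift.
have iT l : inv_on [set: X] (shift T l) by [].
have cX := @closed_subspaceT R X.
have g1 : sigma_gKR T `<=` sigma_gK T by apply: spec_sub => l; apply: GKD_GKRD.
have g2 : sigma_gK T `<=` sigma_Kt T by apply: spec_sub => l; apply: KatoType_GKD.
have g3 : sigma_Kt T `<=` sigma_eK T by apply: spec_sub => l; apply: EssKato_KatoType.
split=> r sR.
- move=> hb ha.
  have h1 : sR `<=` sigma_gKR T.
    move=> l sl gl; have : accp sR l by rewrite -ha.
    apply: (GKRD_not_accp bT gl); apply: bdry_approx => //.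
    by move: sl; rewrite {1}hb.
  have h2 : sigma_eK T `<=` sR.
    by apply: spec_sub => l hl; apply/decompE; apply: clsA_decomp hl.
  have h3 : sR `<=` sigma_gDR (clsA_on r) T.
    by move=> l /h1 ng /(clsA_gDR_GKRD (bS l)).
  have h4 : sigma_ec T `<=` sR.
    by move=> l nc hl; apply: nc; apply: clsA_closed hl.
  (* The inclusions close up into a cycle, so each equality combines one link with the composite of
     the others. *)
  split; [exact: subset_trans h4 h1| | | |split]; apply/seteqP; split=> //.
  + exact: subset_trans g2 (subset_trans g3 (subset_trans h2 h1)).
  + exact: subset_trans g3 (subset_trans h2 (subset_trans h1 g1)).
  + exact: subset_trans h2 (subset_trans h1 (subset_trans g1 g2)).
  + exact: subset_trans h1 (subset_trans g1 (subset_trans g2 g3)).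
  + exact: gDR_sub.
move=> sR' hb ha.
have h1 : sR `<=` sigma_gKR T.
  move=> l sl gl; have bl : bdry sR l by rewrite -hb.
  (* Nearby points outside [sR] are outside [sR'] as well, so it is the accumulation of [sR'] at [l]
     that is contradicted. *)
  have := ha l bl; rewrite /sR' partnerE; apply: (GKRD_not_accp bT gl) => e e0.
  have [mu [ml hm hmu]] := bdry_approx sl bl e0; exists mu; split=> //.
  exact: clsB_partner_on.
have h2 : sigma_K T `<=` sR by apply: spec_sub => l; apply: clsB_Kato.
have g4 : sigma_eK T `<=` sigma_K T by apply: spec_sub => l; apply: Kato_EssKato.
have h3 : sR `<=` sigma_gDR (clsB_on r) T.
  move=> l /h1 ng /decompE hd; apply: ng; apply/decompE; apply: decomp_on_mono hd => // M cM iM.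
  exact: clsB_Kato.
have h4 : sigma_ec T `<=` sR.
  by move=> l nc /(clsB_Kato cX (iT l) (bS l)) [cl _]; apply: nc.
split; [exact: subset_trans h4 h1| | | |split]; apply/seteqP; split=> //.
- exact: subset_trans g2 (subset_trans g3 (subset_trans g4 (subset_trans h2 h1))).
- exact: subset_trans g3 (subset_trans g4 (subset_trans h2 (subset_trans h1 g1))).
- exact: subset_trans g4 (subset_trans h2 (subset_trans h1 (subset_trans g1 g2))).
- exact: subset_trans h2 (subset_trans h1 (subset_trans g1 (subset_trans g2 g3))).
- exact: subset_trans h1 (subset_trans g1 (subset_trans g2 (subset_trans g3 g4))).
- exact: gDR_sub.
Qed.
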